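(* Suppose that the rates $(c_{\Delta}(\cdot, \xi_{\Delta}))_{\Delta \Subset \mathbb{Z}^d, \xi_{\Delta}\in \Omega_{\Delta}}$ of an interacting particle system with generator $\mathscr{L}$ satisfy conditions (R1)–(R6) listed in the context. Moreover, assume that there exists a probability measure $\mu$ on $\Omega$ which is translation-invariant and time-stationary for the process generated by $\mathscr{L}$ and such that $\mu \in \mathscr{G}(\gamma)$, where the specification $\gamma = (\gamma_{\Lambda})_{\Lambda \Subset \mathbb{Z}^d}$ satisfies conditions (S1)–(S4) listed in the context. Then the following holds. (i) For all $\nu \in \mathcal{M}_1^{inv}(\Omega)$ the approximating relative entropy loss density $\tilde{g}_{\mathscr{L}}(\nu | \mu)$ exists as a limit in $\mathbb{R} \cup \{-\infty\}$ (i.e. the limsup defining it is a limit). (ii) The function $\nu \mapsto \tilde{g}_{\mathscr{L}}(\nu| \mu)$ is upper-semicontinuous on $\mathcal{M}_1^{inv}(\Omega)$ (with the weak topology). (iii) For all $\nu \in \mathcal{M}_1^{inv}(\Omega)$ we have $\tilde{g}_{\mathscr{L}}(\nu | \mu) \leq 0$. (iv) For all $\nu \in \mathcal{M}_1^{inv}(\Omega)$ with $\tilde{g}_{\mathscr{L}}(\nu | \mu) = 0$ we have $\nu \in \mathscr{G}(\gamma)$.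
   Context: **Configurations.** Fix $q,d\in\mathbb{N}$ and let $\Omega=\{1,\dots,q\}^{\mathbb{Z}^d}$ with the product topology and Borel $\sigma$-algebra $\mathcal F$. $\Lambda\Subset\mathbb{Z}^d$ means $\Lambda$ is a finite subset; $\Omega_\Lambda=\{1,\dots,q\}^\Lambda$; $\eta_\Lambda$ is the restriction of $\eta$ to $\Lambda$; $\eta_\Lambda\omega_\Delta$ is concatenation for disjoint $\Lambda,\Delta$. Sums $\sum_{\xi_\Delta}$ run over $\Omega_\Delta$. $\mathcal{M}_1(\Omega)$ (resp. $\mathcal{M}_1^{inv}(\Omega)$) is the set of (translation-invariant) probability measures on $\Omega$; $\nu(\eta_\Lambda):=\nu(\{\omega:\omega_\Lambda=\eta_\Lambda\})$, and $\mathbf 1_{\eta_\Lambda}$ is the indicator of this cylinder. $(\tau_x\eta)_y=\eta_{y-x}$. For $z\in\mathbb{Z}^d$, $i\in\{1,\dots,q\}$, $\eta^{z,i}$ equals $\eta$ except that its value at $z$ is $i$, and $\nabla_z^i f(\eta)=f(\eta^{z,i})-f(\eta)$. **Specifications.** A specification $\gamma=(\gamma_\Lambda)_{\Lambda\Subset\mathbb{Z}^d}$ is a family of probability kernels $\gamma_\Lambda$ from $\Omega_{\Lambda^c}$ to $\mathcal{M}_1(\Omega)$ that are proper ($\gamma_\Lambda(\eta_\Lambda\eta_\Delta|\eta_{\Lambda^c})=\gamma_\Lambda(\eta_\Lambda|\eta_{\Lambda^c})\mathbf 1_{\eta_\Delta}(\eta_{\Lambda^c})$ for $\Delta\subset\Lambda^c$)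 and consistent ($\gamma_\Lambda(\gamma_\Delta(\eta_\Delta|\cdot)|\eta_{\Lambda^c})=\gamma_\Lambda(\eta_\Delta|\eta_{\Lambda^c})$ for $\Delta\subset\Lambda\Subset\mathbb{Z}^d$). $\gamma_\Lambda(\cdot|\cdot)$ is also viewed as the function $\omega\mapsto\gamma_\Lambda(\omega_\Lambda|\omega_{\Lambda^c})$. $\mathscr G(\gamma)$ is the set of Gibbs measures: $\mu\in\mathcal{M}_1(\Omega)$ with $\mu(\gamma_\Lambda(\eta_\Lambda|\cdot))=\mu(\eta_\Lambda)$ for all $\Lambda\Subset\mathbb{Z}^d$ and $\eta_\Lambda$. **Rates and dynamics.** Rates are functions $c_\Delta(\cdot,\xi_\Delta):\Omega\to[0,\infty)$, and $\mathscr{L}f(\eta)=\sum_{\Delta\Subset\mathbb{Z}^d}\sum_{\xi_\Delta}c_\Delta(\eta,\xi_\Delta)[f(\xi_\Delta\eta_{\Delta^c})-f(\eta)]$; under (R1)–(R4) this (on the core of $f\in C(\Omega)$ with $\sum_x\sup_{\eta_{x^c}=\xi_{x^c}}|f(\eta)-f(\xi)|<\infty$) generates a Markov semigroup $(P_t)_{t\ge0}$ on $C(\Omega)$. $\nu_t:=\nu P_t$; $\mu$ is time-stationary if $\mu P_t=\mu$ for all $t\geq 0$. **Conditions on the rates.** (R1) Each $\eta\mapsto c_\Delta(\eta,\xi_\Delta)$ is continuous. (R2) There are at most finitely many $\Delta\ni0$ with $c_\Delta:=\sup_{\xi_\Delta}\|c_\Delta(\cdot,\xi_\Delta)\|_\infty>0$.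 (R3) $\sum_{z\ne0}\sum_{\Delta\ni0}\sum_{\xi_\Delta}\sum_{i=1}^q\|\nabla_z^ic_\Delta(\cdot,\xi_\Delta)\|_\infty<\infty$. (R4) $c_{\Delta+x}(\tau_x\eta,\cdot)=c_\Delta(\eta,\cdot)$ for all $x,\Delta,\eta$ (with $\Omega_{\Delta+x}$ and $\Omega_\Delta$ identified by translation). (R5) $\inf\{c_\Delta(\eta,\xi_\Delta):\Delta\Subset\mathbb{Z}^d,\xi_\Delta,\eta,\ c_\Delta(\eta,\xi_\Delta)>0\}>0$. (R6) For every $\eta\in\Omega$, $\Delta\Subset\mathbb{Z}^d$, $\xi_\Delta\in\Omega_\Delta$ there is a finite sequence $\eta^{(0)},\dots,\eta^{(n)}\in\Omega$ with $\eta^{(0)}=\eta$, $\eta^{(n)}=\xi_\Delta\eta_{\Delta^c}$ and positive transition rate from $\eta^{(i)}$ to $\eta^{(i+1)}$ for all $0\le i\le n-1$. **Conditions on the specification.** (S1) Quasilocal: for all $\Lambda\Subset\mathbb{Z}^d$, $\lim_{\Delta\uparrow\mathbb{Z}^d}\sup_{\eta,\xi}|\gamma_\Lambda(\eta_\Lambda|\eta_{\Delta\setminus\Lambda}\xi_{\Delta^c})-\gamma_\Lambda(\eta_\Lambda|\eta_{\Lambda^c})|=0$. (S2) Non-null: $\inf_{\eta}\gamma_{\{0\}}(\eta_0|\eta_{\{0\}^c})\ge\delta$ for some $\delta>0$. (S3) $\sum_{\Delta\ni0:\,c_\Delta>0}\sum_{z\ne0}\sum_{i=1}^q\|\nabla_z^i\gamma_\Delta(\cdot|\cdot)\|_\infty<\infty$.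 (S4) Translation-invariant: $\gamma_{\Lambda+x}((\tau_x\eta)_{\Lambda+x}|(\tau_x\eta)_{(\Lambda+x)^c})=\gamma_\Lambda(\eta_\Lambda|\eta_{\Lambda^c})$ for all $\Lambda,x,\eta$. **Approximating relative entropy loss.** Let $\Lambda_n=[-2^n+1,2^n-1]^d$ and $\tilde\Lambda_n=[-2^n+n+1,2^n-n-1]^d$ (integer boxes). Define $$\tilde g^n_{\mathscr L}(\nu|\mu)=\sum_{\eta_{\Lambda_n}}\sum_{\Delta\subset\tilde\Lambda_n}\sum_{\xi_\Delta}\int\nu(d\omega)\,c_\Delta(\omega,\xi_\Delta)\left[\mathbf 1_{\eta_{\Lambda_n}}(\xi_\Delta\omega_{\Delta^c})-\mathbf 1_{\eta_{\Lambda_n}}(\omega)\right]\log\left(\frac{\nu(\eta_{\Lambda_n})}{\mu(\eta_{\Lambda_n})}\right)$$ (conventions $0\log0=0$ and $a\log0=-\infty$ for $a>0$), and the approximating relative entropy loss density $\tilde g_{\mathscr L}(\nu|\mu)=\limsup_{n\to\infty}|\Lambda_n|^{-1}\tilde g^n_{\mathscr L}(\nu|\mu)$.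
   Formalization: Consistency of the specification is taken in the standard form γ_Λγ_Δ = γ_Λ on all events for Δ ⊂ Λ, not only on cylinders based on Δ; under the literal condition (iv) fails (μ, ν plus and minus Ising phases, γ_Λ the product of μ_Λ with a point mass off Λ). *)

(* Defs.v *)
From HB Require Import structures.
From mathcomp Require Import all_boot all_order all_algebra finmap.
From mathcomp Require Import all_classical all_reals all_analysis.
From mathcomp Require Import summability zify.

Set Implicit Arguments.
Unset Strict Implicit.
Unset Printing Implicit Defensive.

Import Order.TTheory GRing.Theory Num.Theory.
Import numFieldNormedType.Exports.

Local Open Scope classical_set_scope.
Local Open Scope ring_scope.

(** * Configurations *)

Definition site (d : nat) : Type := 'rV[int]_d.
HB.instance Definition _ d := GRing.Zmodule.on (site d).

(* A measurable type must be inhabited, so the number of colours is q.+1;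
   letting q range over nat gives every positive number of colours. *)
Definition colour (q : nat) : Type := discrete_topology 'I_q.+1.
HB.instance Definition _ q := Finite.copy (colour q) 'I_q.+1.
HB.instance Definition _ q :=
  Topological.copy (colour q) (discrete_topology 'I_q.+1).
HB.instance Definition _ q := isPointed.Build (colour q) (ord0 : 'I_q.+1).

Definition conf (d q : nat) : Type := {ptws site d -> colour q}.
HB.instance Definition _ d q :=
  Topological.copy (conf d q) {ptws site d -> colour q}.
HB.instance Definition _ d q :=
  isPointed.Build (conf d q) (fun=> point : colour q).

(* the Borel sigma-algebra of the product topology *)
HB.instance Definition _ d q :=
  Measurable.copy (conf d q) (g_sigma_algebraType (@open (conf d q))).

Definition pattern (d q : nat) (D : {fset site d}) : finType :=
  {ffun D -> colour q}.

Section configurations.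
Context {d q : nat}.
Implicit Types (D : {fset site d}) (w : conf d q).

Definition restr D w : pattern q D := [ffun x => w (val x)].

(* the concatenation of xi on D with w off D *)
Definition glue D (xi : pattern q D) w : conf d q :=
  fun x => if insub x is Some y then xi y else w x.

Definition cyl D (xi : pattern q D) : set (conf d q) :=
  [set w | restr D w = xi].

Definition tau (x : site d) w : conf d q := fun y => w (y - x).

Definition upd w (z : site d) (i : colour q) : conf d q :=
  fun y => if y == z then i else w y.

End configurations.

Definition translate (d : nat) (x : site d) (D : {fset site d}) :
  {fset site d} := [fset (y + x)%R | y in D]%fset.

(* the integer box [-k, k]^d *)
Definition box (d k : nat) : {fset site d} :=
  fset_set [set x : site d | forall i, - k%:Z <= x 0 i <= k%:Z].

Lemma mem_box (d k : nat) (x : site d) :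
  (x \in box d k) = [forall i, - k%:Z <= x 0 i <= k%:Z].
Proof.
rewrite in_fset_set; last first.
  apply: (@sub_finite_set _ _ ((fun f : {ffun 'I_d -> 'I_k.*2.+1} =>
    \row_i ((f i : nat)%:Z - k%:Z)) @` setT)); last exact: finite_image.
  move=> /= y yk; exists [ffun i => inord `|(y 0 i + k%:Z)%R|%N] => //.
  apply/rowP => i; rewrite mxE ffunE; have /andP[yl yr] := yk i.
  by rewrite inordK; lia.
by apply/idP/forallP => [/set_mem|xk]; [|apply/mem_set].
Qed.

Section functions.
Context {R : realType} {d q : nat}.
Implicit Types (f : conf d q -> R).

Definition supnorm f : \bar R := ereal_sup (range (fun w => `|f w|%:E)).

Definition nabla (z : site d) (i : colour q) f : conf d q -> R :=
  fun w => f (upd w z i) - f w.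

Definition osc (x : site d) f : \bar R :=
  ereal_sup [set `|f wp.1 - f wp.2|%:E |
    wp in [set wp : conf d q * conf d q | forall y : site d, y != x -> wp.1 y = wp.2 y]].

End functions.

(** * Specifications and Gibbs measures *)

Section specifications.
Context {R : realType} {d q : nat}.
Implicit Types (D L : {fset site d}) (mu : probability (conf d q) R)
  (g : {fset site d} -> R.-pker conf d q ~> conf d q).
Local Open Scope ereal_scope.

(* A kernel from the configurations off L is encoded as a kernel on all
   configurations which ignores the colours in L. *)
Definition ignores_inside g := forall L (w w' : conf d q),
  (forall x, x \notin L -> w x = w' x) ->
  forall A, measurable A -> g L w A = g L w' A.

Definition proper_kernels g := forall L D (eta : pattern q L)
    (zeta : pattern q D) (w : conf d q), [disjoint L & D]%fset ->
  g L w (cyl eta `&` cyl zeta) = g L w (cyl eta) * (\1_(cyl zeta) w)%:E.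

(* The identity of kernels g_L g_D = g_L, i.e. tested on all events and not
   only on cylinders based on D: the latter would be satisfied by
   g_L(. | w) := (mu restricted to L) x (Dirac mass at w off L), for any mu. *)
Definition consistent_kernels g := forall D L (w : conf d q)
    (A : set (conf d q)), (D `<=` L)%fset -> measurable A ->
  \int[g L w]_w' g D w' A = g L w A.

Definition specification g :=
  [/\ ignores_inside g, proper_kernels g & consistent_kernels g].

Definition gibbs g mu := forall L (eta : pattern q L),
  \int[mu]_w g L w (cyl eta) = mu (cyl eta).

Definition cond g L (eta w : conf d q) : R := fine (g L w (cyl (restr L eta))).

Definition spec_fun g L : conf d q -> R := fun w => cond g L w w.

Definition quasilocal g := forall L,
  (fun D => ereal_sup [set `|cond g L ex.1 (glue (restr D ex.1) ex.2)
                             - cond g L ex.1 ex.1|%R%:E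
                      | ex in [set: conf d q * conf d q]]) @ totally --> 0.

Definition nonnull g := exists2 delta : R, (0 < delta)%R &
  delta%:E <= ereal_inf (range (fun w => (spec_fun g [fset 0%R]%fset w)%:E)).

Definition spec_translation_invariant g := forall L x (w : conf d q),
  spec_fun g (translate x L) (tau x w) = spec_fun g L w.

Definition translation_invariant mu := forall x (A : set (conf d q)),
  measurable A -> mu (tau x @^-1` A) = mu A.

End specifications.

(** * Rates and dynamics *)

Definition rates (R : realType) (d q : nat) : Type :=
  forall D : {fset site d}, conf d q -> pattern q D -> R.

Section rates.
Context {R : realType} {d q : nat}.
Variable c : rates R d q.
Arguments c : clear implicits.
Implicit Types (D : {fset site d}) (w : conf d q) (f g : conf d q -> R).

Definition rate_sup D : \bar R :=
  ereal_sup (range (fun xi : pattern q D => supnorm (c D ^~ xi))).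

Definition rates_nonneg := forall D w (xi : pattern q D), 0 <= c D w xi.

Definition rates_continuous := forall D (xi : pattern q D),
  continuous (c D ^~ xi : conf d q -> R).

Definition rates_finite_type :=
  finite_set [set D : {fset site d} | 0 \in D /\ (0 < rate_sup D)%E].

Definition rates_summable :=
  (\esum_(z in [set z : site d | z != 0%R])
   \esum_(D in [set D : {fset site d} | 0%R \in D])
   \sum_(xi : pattern q D) \sum_(i : colour q)
     supnorm (nabla z i (c D ^~ xi)) < +oo)%E.

(* Patterns on D and on its translate are identified by writing them as the
   restrictions of s and of tau x s. *)
Definition rates_translation_invariant := forall x D w (s : conf d q),
  c (translate x D) (tau x w) (restr (translate x D) (tau x s)) = c D w (restr D s).

Definition rates_bounded_below :=
  (0 < ereal_inf [set r%:E | r in [set r : R | (0 < r)%R /\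
         exists D w (xi : pattern q D), r = c D w xi]])%E.

Definition jump w w' :=
  exists D (xi : pattern q D), 0 < c D w xi /\ w' = glue xi w.

Definition rates_irreducible := forall w D (xi : pattern q D),
  exists (n : nat) (s : nat -> conf d q),
    [/\ s 0%N = w, s n = glue xi w & forall i, (i < n)%N -> jump (s i) (s i.+1)].

Definition spec_summable (g : {fset site d} -> R.-pker conf d q ~> conf d q) :=
  (\esum_(D in [set D : {fset site d} | 0%R \in D /\ 0 < rate_sup D])
   \esum_(z in [set z : site d | z != 0%R])
   \sum_(i : colour q) supnorm (nabla z i (spec_fun g D)) < +oo)%E.

Definition gen f : conf d q -> R := fun w =>
  summability.sum (fun D : {fset site d} =>
    \sum_(xi : pattern q D) c D w xi * (f (glue xi w) - f w)).

Definition gen_core f :=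
  continuous f /\ (\esum_(x in [set: site d]) osc x f < +oo)%E.

(* P acts on C(Omega), the functions f with continuous f; its values elsewhere
   are irrelevant. *)
Definition markov_semigroup (P : R -> (conf d q -> R) -> conf d q -> R) :=
  [/\ forall (t : R) f, 0 <= t -> continuous f -> continuous (P t f),
      forall (t a : R) f g, 0 <= t -> continuous f -> continuous g ->
        P t (a *: f + g) = a *: P t f + P t g,
      forall t : R, 0 <= t -> P t (cst 1) = cst 1 &
      forall (t : R) f, 0 <= t -> continuous f -> (forall w, 0 <= f w) ->
        forall w, 0 <= P t f w] /\
  [/\ forall f, continuous f -> P 0 f = f,
      forall (s t : R) f, 0 <= s -> 0 <= t -> continuous f ->
        P (s + t) f = P s (P t f) &
      forall (t : R) f, 0 <= t -> continuous f ->
        supnorm (P s f - P t f) @[s --> t^'+] --> 0%E].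

Definition infinitesimal_generator (P : R -> (conf d q -> R) -> conf d q -> R)
    (f g : conf d q -> R) :=
  [/\ continuous f, continuous g &
      supnorm (t^-1 *: (P t f - f) - g) @[t --> 0^'+] --> 0%E].

(* the generator of P is the closure of gen restricted to gen_core *)
Definition generated_semigroup
    (P : R -> (conf d q -> R) -> conf d q -> R) :=
  markov_semigroup P /\
  forall f g, infinitesimal_generator P f g <->
    [/\ continuous f, continuous g & forall e : R, 0 < e -> exists h,
      [/\ gen_core h, (supnorm (h - f)%R <= e%:E)%E &
          (supnorm (gen h - g)%R <= e%:E)%E]].

Definition time_stationary (P : R -> (conf d q -> R) -> conf d q -> R)
    (mu : probability (conf d q) R) :=
  forall (t : R) f, 0 <= t -> continuous f -> \int[mu]_w P t f w = \int[mu]_w f w.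

(** * Approximating relative entropy loss *)

Definition Lam n : {fset site d} := box d (2 ^ n - 1).
(* n + 1 <= 2 ^ n, so the natural subtraction does not truncate *)
Definition Lam_tilde n : {fset site d} := box d (2 ^ n - n - 1).

Definition log_ratio (nu mu : probability (conf d q) R)
    (A : set (conf d q)) : \bar R :=
  lne (fine (nu A) / fine (mu A))%:E.

(* lne 0 = -oo and 0 * -oo = 0 in \bar R *)
Definition entropy_loss (nu mu : probability (conf d q) R) (n : nat) : \bar R :=
  (\sum_(eta : pattern q (Lam n))
   \sum_(D <- fpowerset (Lam_tilde n)) \sum_(xi : pattern q D)
     (\int[nu]_w (c D w xi * (\1_(cyl eta) (glue xi w) - \1_(cyl eta) w)))%R%:E
     * log_ratio nu mu (cyl eta))%E.

Definition entropy_loss_seq (nu mu : probability (conf d q) R) : (\bar R)^nat :=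
  fun n => ((#|` Lam n|%:R^-1)%:E * entropy_loss nu mu n)%E.

Definition entropy_loss_density (nu mu : probability (conf d q) R) : \bar R :=
  limn_esup (entropy_loss_seq nu mu).

End rates.

(** * The weak topology on probability measures *)

(* the coarsest topology making nu |-> \int f dnu continuous for f continuous *)
Definition weak_probability (R : realType) (d q : nat) : Type :=
  initial_topology (fun nu : probability (conf d q) R =>
    (fun f : continuousType (conf d q) R => \int[nu]_w f w)
    : {ptws continuousType (conf d q) R -> R}).
HB.instance Definition _ R d q := Topological.on (weak_probability R d q).

Definition upper_semicontinuous_on (R : realType) (X : topologicalType)
    (A : set X) (g : X -> \bar R) :=
  forall x, A x -> forall a : R, (g x < a%:E)%E ->
    \forall y \near within A (nbhs x), (g y < a%:E)%E.

(* Main.v *)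
(* Fix an update set D and a box L containing D, and for patterns eta on L and xi
   on D write v = nu(eta), u = nu(xi eta), r = mu(xi eta) / mu(eta). As r tends
   uniformly to the ratio of the specification (DLR equations and
   quasilocality), the contribution of D to the entropy loss in L can be written

     sum_{eta, xi} c (u / r - v)  -  sum_{eta, xi} c v F(u / (r v)),

   where F x = x - 1 - ln x >= 0. The first sum (the excess) converges to the
   nu-integral of the local function h_D which compares the rates of the
   time-reversed process with the original ones. Testing stationarity on the
   indicators of all cylinders over a large box shows that the sum of the h_D
   over D in the box is o(|box|) uniformly in the configuration, so excesses
   contribute nothing to the density, which is therefore minus a limit of
   averages of nonnegative defects.

   With r replaced by 1 and c by its infimum on the cylinder of eta, the second
   sum is monotone in L, because (u, v) |-> v F(u / v) is jointly convex and
   homogeneous; as positive rates are bounded below, this replacement costs only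
   a factor 1 + o(1). Hence each contribution converges as L grows, to an affine
   continuous function of nu minus a supremum of lower semicontinuous ones.

   If the density vanishes, so do the limiting defects, which forces u = r v in
   the limit wherever c > 0: along every allowed jump nu transforms like a Gibbs
   measure. Irreducibility and compactness extend this to all local changes. *)
Require Import Defs.
From HB Require Import structures.
From mathcomp Require Import all_boot all_order all_algebra finmap.
From mathcomp Require Import all_classical all_reals all_analysis.
From mathcomp Require Import summability zify ring lra.
Import Order.TTheory GRing.Theory Num.Theory.
Import numFieldNormedType.Exports.
Set Implicit Arguments.
Unset Strict Implicit.
Unset Printing Implicit Defensive.
Local Open Scope classical_set_scope.
Local Open Scope ring_scope.
(* mathcomp-analysis has another glue. *)
Local Notation glue := Defs.glue.
#[local] Existing Instance totally_filter.

(* Without these two instances type class search unfolds the product topology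
   and does not terminate. *)
#[local] Instance nbhs_conf_filter d q (w : conf d q) : Filter (nbhs w) | 0.
Proof. exact: (@nbhs_filter (conf d q) w). Qed.

#[local] Instance nbhs_conf_pfilter d q (w : conf d q) : ProperFilter (nbhs w) | 0.
Proof. exact: (@nbhs_pfilter (conf d q) w). Qed.

(** Two decompositions are needed because neither does everything. With the ratio replaced by 1, the
    subtracted sum no longer mentions [mu], so refining cylinders essentially increases it: this
    gives the limit and upper semicontinuity, but the remaining sum has no sign. With the true ratio
    the remaining sum is negligible, which gives the sign and the equality case, but the ratio
    changes with the box and monotonicity is lost. Both decompose the same extended real, so the
    second inherits its limit from the first. Since [nu] may give no mass to some patterns, the
    value -oo has to be carried along: each decomposition is a real number minus an element of
    [0, +oo]. Stationarity concerns [mu] alone, whereas the excess must be negligible under every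
    [nu]. The passage works because cylinders have positive [mu]-probability, because the margin n
    between the two boxes makes the bulk excess almost constant on a cylinder over the larger one,
    and because the update sets not contained in the smaller box but touching the larger one are
    few. *)

Section configurations.
Context {d q : nat}.
Implicit Types (D L : {fset site d}) (w : conf d q).

(** A canonical extension by the default colour. Functions of configurations can thus be sampled at
    patterns, and patterns on different sets need no coercions. *)
Definition rep D (xi : pattern q D) : conf d q := glue xi point.

Lemma glueE D (xi : pattern q D) w x :
  glue xi w x = if x \in D then rep xi x else w x.
Proof. by rewrite /rep /glue; case: insubP => [y ->//|/negbTE->]. Qed.

Lemma restrP D w w' :
  restr D w = restr D w' <-> (forall x, x \in D -> w x = w' x).
Proof.
split=> [ww' x xD|ww'].
  by have := congr1 (fun f : pattern q D => f [` xD]%fset) ww'; rewrite !ffunE.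
by apply/ffunP => x; rewrite !ffunE; exact/ww'/valP.
Qed.

Lemma restr_glue D (xi : pattern q D) w : restr D (glue xi w) = xi.
Proof.
apply/ffunP => x; rewrite ffunE /glue; case: insubP => [y _ /val_inj->//|].
by rewrite (valP x).
Qed.

Lemma restr_rep D (xi : pattern q D) : restr D (rep xi) = xi.
Proof. exact: restr_glue. Qed.

Lemma rep_restr D w x : x \in D -> rep (restr D w) x = w x.
Proof.
move: x; apply: (restrP D _ _).1; exact: restr_rep.
Qed.

Lemma glue_restrE D w w' x :
  glue (restr D w) w' x = if x \in D then w x else w' x.
Proof. by rewrite glueE; case: ifP => // /rep_restr->. Qed.

Lemma glue_restr D w : glue (restr D w) w = w.
Proof. by apply/funext => x; rewrite glue_restrE if_same. Qed.

Lemma glueK D (xi : pattern q D) w : glue (restr D w) (glue xi w) = w.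
Proof. by apply/funext => x; rewrite glue_restrE glueE; case: (x \in D). Qed.

Lemma glue_glue D (xi zeta : pattern q D) w : glue xi (glue zeta w) = glue xi w.
Proof. by apply/funext => x; rewrite !glueE; case: (x \in D). Qed.

Lemma restr_sub D L w w' : (D `<=` L)%fset ->
  restr L w = restr L w' -> restr D w = restr D w'.
Proof. by move=> /fsubsetP DL /restrP h; apply/restrP => x /DL/h. Qed.

Lemma restr_glue_eq D L (xi : pattern q D) w w' :
  restr L w = restr L w' -> restr L (glue xi w) = restr L (glue xi w').
Proof.
by move=> /restrP h; apply/restrP => x xL; rewrite !glueE; case: ifP => // _; exact: h.
Qed.

Lemma restr_glue_rep D L (xi : pattern q D) w :
  restr L (glue xi (rep (restr L w))) = restr L (glue xi w).
Proof. by apply: restr_glue_eq; rewrite restr_rep. Qed.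

Lemma restr_rep_sub D L w : (D `<=` L)%fset ->
  restr D (rep (restr L w)) = restr D w.
Proof. by move=> DL; apply: (restr_sub DL); rewrite restr_rep. Qed.

Lemma restr_glueT D L (xi : pattern q D) w : (D `<=` L)%fset ->
  restr D (rep (restr L (glue xi w))) = xi.
Proof. by move=> DL; rewrite restr_rep_sub // restr_glue. Qed.

Lemma cyl_indic (R : pzRingType) D (xi : pattern q D) w :
  \1_(cyl xi) w = (restr D w == xi)%:R :> R.
Proof.
by rewrite indicE; congr (nat_of_bool _)%:R; apply/idP/eqP => [/set_mem|/mem_set].
Qed.

(* (eta, xi) |-> (xi eta, eta_D) is an involution. *)
Lemma pattern_swap (V : nmodType) D L (F : pattern q L -> pattern q D -> V) :
  (D `<=` L)%fset ->
  \sum_(eta : pattern q L) \sum_(xi : pattern q D) F eta xi =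
  \sum_(eta : pattern q L) \sum_(xi : pattern q D)
    F (restr L (glue xi (rep eta))) (restr D (rep eta)).
Proof.
move=> DL; rewrite !pair_big /=.
pose s (p : pattern q L * pattern q D) :=
  (restr L (glue p.2 (rep p.1)), restr D (rep p.1)).
have sK : involutive s.
  move=> [eta xi]; rewrite /s /=; congr pair; last exact: restr_glueT.
  rewrite restr_glue_rep; have -> : glue (restr D (rep eta)) (glue xi (rep eta)) = rep eta.
    exact: glueK.
  exact: restr_rep.
by rewrite (reindex_inj (inv_inj sK)).
Qed.

Lemma in_translate (x y : site d) D : (y \in translate x D) = (y - x \in D).
Proof.
apply/imfsetP/idP => [[z /= zD ->]|yD]; first by rewrite addrK.
by exists (y - x) => //=; rewrite subrK.
Qed.

Lemma translateK (x : site d) D : translate (- x) (translate x D) = D.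
Proof. by apply/fsetP => y; rewrite !in_translate opprK addrK. Qed.

Lemma translateVK (x : site d) D : translate x (translate (- x) D) = D.
Proof. by rewrite -{1}(opprK x) translateK. Qed.

Lemma translate_sub (x : site d) D L :
  (translate x D `<=` translate x L)%fset = (D `<=` L)%fset.
Proof.
apply/fsubsetP/fsubsetP => h y; last by rewrite !in_translate => /h.
by have := h (y + x); rewrite !in_translate addrK.
Qed.

Lemma card_translate (x : site d) D : #|` translate x D| = #|` D|.
Proof. by rewrite card_imfset //= => y z; exact: addIr. Qed.

Lemma tauK (x : site d) w : tau (- x) (tau x w) = w.
Proof. by apply/funext => y; rewrite /tau opprK addrK. Qed.

Lemma tauVK (x : site d) w : tau x (tau (- x) w) = w.
Proof. by rewrite -{1}(opprK x) tauK. Qed.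

Lemma restr_tau x L w w' :
  restr (translate x L) (tau x w) = restr (translate x L) (tau x w') <->
  restr L w = restr L w'.
Proof.
split=> /restrP h; apply/restrP => y.
  by move=> yL; have := h (y + x); rewrite in_translate addrK /tau addrK; apply.
by rewrite in_translate => /h.
Qed.

Lemma glue_tau x D w w' :
  glue (restr (translate x D) (tau x w)) (tau x w') = tau x (glue (restr D w) w').
Proof.
by apply/funext => y; rewrite glue_restrE /tau glue_restrE in_translate.
Qed.

Lemma pattern_sum_translate (V : nmodType) x L (F : pattern q (translate x L) -> V) :
  \sum_(eta : pattern q (translate x L)) F eta =
  \sum_(eta : pattern q L) F (restr (translate x L) (tau x (rep eta))).
Proof.
pose f (eta : pattern q L) := restr (translate x L) (tau x (rep eta)).
pose g (eta : pattern q (translate x L)) := restr L (tau (- x) (rep eta)).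
rewrite (reindex f) //; exists g => eta _.
  rewrite /f /g -[RHS]restr_rep; apply/restrP => y yL.
  by rewrite /tau opprK rep_restr ?addrK // in_translate addrK.
rewrite /f /g -[RHS]restr_rep; apply/restrP => y; rewrite in_translate => yL.
by rewrite /tau rep_restr // opprK subrK.
Qed.

End configurations.

(** * Topology of the configuration space *)

Section topology.
Context {R : realType} {d q : nat}.
Implicit Types (D L : {fset site d}) (w : conf d q) (f g : conf d q -> R).

Lemma nbhs_restr L w : \forall w' \near w, restr L w' = restr L w.
Proof.
have : nbhs w (\bigcap_(x in [set` L]) [set w' : conf d q | w' x = w x]).
  apply: filter_bigI => x xL.
  have := @proj_continuous (site d) (fun _ => colour q) x w.
  by move=> /(_ [set w x]); apply; exact: (@discrete_set1 (colour q)).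
by apply: filterS => w' h; apply/restrP => x xL; exact: h.
Qed.

(** The filter generated by agreement with [w] on finite sets converges to [w] in each coordinate,
    hence in the product topology. *)
Lemma nbhs_confP w (A : set (conf d q)) :
  nbhs w A <-> exists D, forall w', restr D w' = restr D w -> A w'.
Proof.
split=> [wA|[D DA]]; last by apply: filterS (nbhs_restr D w).
pose F : set_system (conf d q) :=
  filter_from setT (fun D => [set w' | restr D w' = restr D w]).
have FF : Filter F.
  apply: filter_fromT_filter; first by exists fset0.
  move=> D D'; exists (D `|` D')%fset => w' /= h.
  by split; apply: restr_sub h; [exact: fsubsetUl|exact: fsubsetUr].
suff /(_ _ wA)[D _ DA] : F --> w by exists D.
apply/cvg_sup => x B; rewrite nbhsE => -[C [[E oE <-] wE] EB].
exists [fset x]%fset => // w' /restrP/(_ x (fset11 _)) w'x.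
by apply: EB; rewrite /= w'x.
Qed.

Lemma compact_conf : compact [set: conf d q].
Proof.
have cc : compact [set: colour q] by apply: finite_compact; exact: finite_finset.
have := @tychonoff (site d) (fun=> colour q) (fun=> setT) (fun=> cc).
by congr compact; apply/seteqP; split.
Qed.

(** Compactness: finitely many of the cylinders given by the hypothesis cover the space, so one
    threshold [D] serves all configurations. *)
Lemma near_totally_conf (P : {fset site d} -> conf d q -> Prop) :
  (forall w, exists D, forall w' L, (D `<=` L)%fset -> restr D w' = restr D w -> P L w') ->
  \forall L \near totally, forall w, P L w.
Proof.
move=> h; have := (compact_near_coveringP [set: conf d q]).1 compact_conf _ totally P _ _.
case.
  move=> w _; have [D HD] := h w.
  exists ([set w' | restr D w' = restr D w], [set L | D `<=` L]%fset).
    split; first exact: nbhs_restr.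
    by exists D.
  by move=> [w' L] /= [w'w DL]; exact: HD.
by move=> D _ HD; exists D => // L DL w; exact: (HD L DL w I).
Qed.

Lemma continuous_unif f : continuous f -> forall e : R, 0 < e ->
  \forall L \near totally, forall w w', restr L w = restr L w' -> `|f w - f w'| <= e.
Proof.
move=> cf e e0.
apply: near_totally_conf => w.
have /cvgrPdist_le/(_ (e / 2)) := cf w; rewrite divr_gt0 // => /(_ isT)/nbhs_confP[D HD].
exists D => w' L DL w'w w'' w'w''.
have h1 := HD _ w'w; have h2 := HD w''; rewrite -(restr_sub DL w'w'') in h2.
have {}h2 := h2 w'w.
rewrite (le_trans (ler_distD (f w) _ _)) // (splitr e) lerD //.
by rewrite distrC.
Qed.

Lemma unif_continuous f : (forall e : R, 0 < e -> exists D, forall w w',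
  restr D w = restr D w' -> `|f w - f w'| <= e) -> continuous f.
Proof.
move=> uf w; apply: (@cvgrPdist_le _ _ _ (nbhs w) _ _ _).2 => e e0.
have [D HD] := uf e e0; apply/nbhs_confP; exists D => w' w'w; exact: HD.
Qed.

Lemma continuous_local L f : (forall w w', restr L w = restr L w' -> f w = f w') ->
  continuous f.
Proof.
move=> lf; apply: unif_continuous => e e0; exists L => w w' /lf->.
by rewrite subrr normr0 ltW.
Qed.

(** [restr D] is locally constant, so near a point only one member of the family is seen. *)
Lemma continuous_restr D (F : pattern q D -> conf d q -> R) :
  (forall xi, continuous (F xi)) -> continuous (fun w => F (restr D w) w).
Proof.
move=> cF w A FA; have /nbhs_confP[L HL] := cF (restr D w) w A FA.
apply/nbhs_confP; exists (D `|` L)%fset => w' h.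
rewrite /preimage /= (restr_sub (fsubsetUl D L) h).
exact/HL/(restr_sub (fsubsetUr D L) h).
Qed.

Lemma continuous_glue D (xi : pattern q D) : continuous (glue xi).
Proof.
move=> w A /nbhs_confP[L HL]; apply/nbhs_confP; exists L => w' w'w; apply: HL.
exact: restr_glue_eq.
Qed.

Lemma continuous_tau x : continuous (@tau d q x).
Proof.
move=> w A /nbhs_confP[L HL]; apply/nbhs_confP; exists (translate (- x) L) => w' w'w.
by apply: HL; rewrite -(translateVK x L); apply/restr_tau.
Qed.

Lemma continuous_indic D (xi : pattern q D) : continuous (\1_(cyl xi) : conf d q -> R).
Proof. by apply: (@continuous_local D) => w w' h; rewrite !cyl_indic h. Qed.

Lemma contC (r : R) : continuous (fun _ : conf d q => r).
Proof. by move=> w; exact: cvg_cst. Qed.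

Lemma contD f g : continuous f -> continuous g -> continuous (fun w => f w + g w).
Proof. by move=> cf cg w; apply: cvgD; [exact: cf|exact: cg]. Qed.

Lemma contB f g : continuous f -> continuous g -> continuous (fun w => f w - g w).
Proof. by move=> cf cg w; apply: cvgB; [exact: cf|exact: cg]. Qed.

Lemma contM f g : continuous f -> continuous g -> continuous (fun w => f w * g w).
Proof. by move=> cf cg w; apply: cvgM; [exact: cf|exact: cg]. Qed.

Lemma contV f : (forall w, f w != 0) -> continuous f -> continuous (fun w => (f w)^-1).
Proof. by move=> f0 cf w; apply: cvgV; [exact: f0|exact: cf]. Qed.

Lemma cont_ln f : (forall w, 0 < f w) -> continuous f -> continuous (fun w => ln (f w)).
Proof.
by move=> f0 cf w; exact: (cvg_comp _ _ (cf w) (continuous_ln (f0 w))).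
Qed.

Lemma cont_glue D (xi : pattern q D) f :
  continuous f -> continuous (fun w => f (glue xi w)).
Proof.
by move=> cf w; exact: (cvg_comp _ _ (@continuous_glue D xi w) (cf _)).
Qed.

Lemma cont_glue_restr D (xi : pattern q D) (h : conf d q -> pattern q D -> R) :
  (forall zeta, continuous (h^~ zeta)) ->
  continuous (fun w => h (glue xi w) (restr D w)).
Proof.
move=> ch; apply: (@continuous_restr D (fun zeta w => h (glue xi w) zeta)) => zeta.
exact: (@cont_glue D xi (h^~ zeta) (ch zeta)).
Qed.

Lemma cont_tau x f : continuous f -> continuous (fun w => f (tau x w)).
Proof.
by move=> cf w; exact: (cvg_comp _ _ (@continuous_tau x w) (cf _)).
Qed.

Lemma cont_sum (I : Type) (r : seq I) (P : pred I) (F : I -> conf d q -> R) :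
  (forall i, P i -> continuous (F i)) -> continuous (fun w => \sum_(i <- r | P i) F i w).
Proof.
move=> cF; elim: r => [|i r IH].
  by under eq_fun do rewrite big_nil; exact: contC.
under eq_fun do rewrite big_cons.
case: (boolP (P i)) => Pi; last exact: IH.
by apply: contD; [exact: cF|exact: IH].
Qed.

Lemma continuous_bounded f : continuous f -> exists2 C : R, 0 < C & forall w, `|f w| <= C.
Proof.
move=> cf; have [L _ /(_ L (fsubset_refl _)) HL] := continuous_unif cf ltr01.
exists (\sum_(eta : pattern q L) `|f (rep eta)| + 1).
  by rewrite ltr_wpDl ?sumr_ge0.
move=> w; have h := HL w (rep (restr L w)); rewrite restr_rep in h.
rewrite -(subrK (f (rep (restr L w))) (f w)) addrC (le_trans (ler_normD _ _)) // lerD //; last exact: h.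
by rewrite (bigD1 (restr L w)) //= lerDl sumr_ge0.
Qed.

Lemma open_measurable_conf (A : set (conf d q)) : open A -> measurable A.
Proof. by move=> oA; apply: (@sub_sigma_algebra _ [set: conf d q] (@open (conf d q))). Qed.

Lemma open_cyl D (xi : pattern q D) : open (cyl xi : set (conf d q)).
Proof.
rewrite openE => w wxi; apply/nbhs_confP; exists D => w' w'w.
by rewrite /cyl /= w'w.
Qed.

Lemma measurable_cyl D (xi : pattern q D) : measurable (cyl xi : set (conf d q)).
Proof. by apply: open_measurable_conf; exact: open_cyl. Qed.

Lemma continuous_measurable f : continuous f -> measurable_fun setT f.
Proof.
move=> /continuousP cf; apply: (measurability _ (measurable_realfun.RGenOpens.measurableE R)).
move=> _ [_ [a [b ->] <-]]; rewrite setTI; apply: open_measurable_conf.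
exact/cf/interval_open.
Qed.

End topology.

(** * Integrals of continuous functions and cylinder probabilities *)

Section expectation.
Context {R : realType} {d q : nat}.
Implicit Types (D L : {fset site d}) (w : conf d q) (f g : conf d q -> R)
  (nu : probability (conf d q) R).

Lemma continuous_integrable nu f : continuous f -> nu.-integrable setT (EFin \o f).
Proof.
move=> cf; apply: measurable_bounded_integrable => //.
- apply: (@le_lt_trans _ _ 1%E); last exact: ltry.
  exact: (probability_le1 nu measurableT).
- exact: continuous_measurable.
have [C C0 HC] := continuous_bounded cf.
exists C; split; [exact: num_real|move=> x Cx w _].
by apply: (le_trans (HC w)); exact: ltW.
Qed.

Lemma ExpD nu f g : continuous f -> continuous g ->
  \int[nu]_w (f w + g w) = \int[nu]_w f w + \int[nu]_w g w.
Proof. by move=> cf cg; apply: RintegralD => //; exact: continuous_integrable. Qed.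

Lemma ExpB nu f g : continuous f -> continuous g ->
  \int[nu]_w (f w - g w) = \int[nu]_w f w - \int[nu]_w g w.
Proof. by move=> cf cg; apply: RintegralB => //; exact: continuous_integrable. Qed.

Lemma ExpZl nu f r : continuous f -> \int[nu]_w (r * f w) = r * \int[nu]_w f w.
Proof. by move=> cf; apply: RintegralZl => //; exact: continuous_integrable. Qed.

Lemma Exp_cst nu (r : R) : \int[nu]_w r = r.
Proof.
rewrite Rintegral_cst //.
exact: etrans (congr1 (fun z => r * fine z) (probability_setT nu)) (mulr1 r).
Qed.

Lemma le_Exp nu f g : continuous f -> continuous g -> (forall w, f w <= g w) ->
  \int[nu]_w f w <= \int[nu]_w g w.
Proof. by move=> cf cg fg; apply: le_Rintegral => //; exact: continuous_integrable. Qed.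

Lemma Exp_sum nu (I : Type) (r : seq I) (P : pred I) (F : I -> conf d q -> R) :
  (forall i, P i -> continuous (F i)) ->
  \int[nu]_w (\sum_(i <- r | P i) F i w) = \sum_(i <- r | P i) \int[nu]_w F i w.
Proof.
move=> cF; elim: r => [|i r IH].
  by under eq_Rintegral do rewrite big_nil; rewrite big_nil Exp_cst.
under eq_Rintegral do rewrite big_cons; rewrite big_cons.
case: ifPn => Pi; last exact: IH.
by rewrite ExpD ?IH //; [exact: cF|exact: cont_sum].
Qed.

Lemma Exp_dist nu f g e : continuous f -> continuous g ->
  (forall w, `|f w - g w| <= e) -> `|\int[nu]_w f w - \int[nu]_w g w| <= e.
Proof.
move=> cf cg fg; have ce := @contC R d q.
rewrite ler_distlC -{1}(Exp_cst nu e) -{2}(Exp_cst nu e) -ExpB // -ExpD //.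
by apply/andP; split; apply: le_Exp; [exact: contB|exact: cg| |exact: cg|exact: contD|];
  move=> w; have := fg w; rewrite ler_distlC => /andP[].
Qed.

Definition cp nu L (eta : pattern q L) : R := fine (nu (cyl eta)).

Lemma cpE nu L (eta : pattern q L) : nu (cyl eta) = (cp nu eta)%:E.
Proof. by rewrite /cp fineK // fin_num_measure //; exact: measurable_cyl. Qed.

Lemma cp_ge0 nu L (eta : pattern q L) : 0 <= cp nu eta.
Proof. exact: fine_ge0. Qed.

Lemma cp_Exp nu L (eta : pattern q L) : cp nu eta = \int[nu]_w \1_(cyl eta) w.
Proof.
by rewrite /Rintegral integral_indic ?setIT //; exact: measurable_cyl.
Qed.

Lemma localE L f w : (forall w w', restr L w = restr L w' -> f w = f w') ->
  f w = \sum_(eta : pattern q L) f (rep eta) * \1_(cyl eta) w.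
Proof.
move=> lf; under eq_bigr do rewrite cyl_indic.
rewrite (bigD1 (restr L w)) //= eqxx mulr1 big1 ?addr0; last first.
  by move=> eta /negbTE h; rewrite eq_sym h mulr0.
by apply: lf; rewrite restr_rep.
Qed.

Lemma Exp_local nu L f : (forall w w', restr L w = restr L w' -> f w = f w') ->
  \int[nu]_w f w = \sum_(eta : pattern q L) f (rep eta) * cp nu eta.
Proof.
move=> lf; have -> : f = fun w => \sum_(eta : pattern q L) f (rep eta) * \1_(cyl eta) w.
  by apply/funext => w; exact: localE.
rewrite Exp_sum => [|eta _]; last first.
  by apply: contM; [exact: contC|exact: continuous_indic].
apply: eq_bigr => eta _; rewrite ExpZl; last exact: continuous_indic.
by rewrite -cp_Exp -localE.
Qed.

(** A Riemann sum over cylinders. Integrals are compared with each other through such sums, that is,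
    through finitely many cylinder probabilities. *)
Lemma Exp_riem nu L f e : continuous f ->
  (forall w w', restr L w = restr L w' -> `|f w - f w'| <= e) ->
  `|\int[nu]_w f w - \sum_(eta : pattern q L) f (rep eta) * cp nu eta| <= e.
Proof.
move=> cf uf; pose g w := f (rep (restr L w)).
have lg w w' : restr L w = restr L w' -> g w = g w' by rewrite /g => ->.
have <- : \int[nu]_w g w = \sum_(eta : pattern q L) f (rep eta) * cp nu eta.
  by rewrite (Exp_local nu lg); apply: eq_bigr => eta _; rewrite /g restr_rep.
apply: Exp_dist => // [|w]; first exact: continuous_local lg.
by apply: uf; rewrite restr_rep.
Qed.

Lemma cp_sum1 nu L : \sum_(eta : pattern q L) cp nu eta = 1.
Proof.
rewrite -[RHS](Exp_cst nu 1) (@Exp_local nu L (fun=> 1)) //.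
by apply: eq_bigr => eta _; rewrite mul1r.
Qed.

Lemma cp_fiber nu D L (xi : pattern q D) : (D `<=` L)%fset ->
  cp nu xi = \sum_(eta : pattern q L | restr D (rep eta) == xi) cp nu eta.
Proof.
move=> DL; rewrite cp_Exp (@Exp_local nu L); last first.
  by move=> w w' /(restr_sub DL) h; rewrite !cyl_indic h.
rewrite [RHS]big_mkcond; apply: eq_bigr => eta _; rewrite cyl_indic.
by case: eqP => _; rewrite ?mul1r ?mul0r.
Qed.

End expectation.

(** * The relative entropy integrand *)

Section entropy_kernel.
Context {R : realType}.
Implicit Types (u v s c p k : R).

(* The perspective u - v - v ln (u / v) of x - 1 - ln x, as the supremum of its
   tangents: this form makes subadditivity and lower semicontinuity immediate
   and has the right values relgap 0 v = +oo and relgap u 0 = u on the boundary. *)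
Definition relgap u v : \bar R :=
  ereal_sup [set ((1 - s) * u + v * ln s)%:E | s in [set s | 0 < s]].

Lemma ln_le_sub1 x : 0 < x -> ln x <= x - 1 :> R.
Proof.
move=> x0; have := @le_ln1Dx R (x - 1); have -> : 1 + (x - 1) = x by ring.
by apply; lra.
Qed.

Lemma relgap_ub u v s : 0 < s -> (((1 - s) * u + v * ln s)%:E <= relgap u v)%E.
Proof. by move=> s0; apply: ereal_sup_ubound; exists s. Qed.

Lemma relgap_ge0 u v : (0 <= relgap u v)%E.
Proof. by have := relgap_ub u v (@ltr01 R); rewrite subrr mul0r ln1 mulr0 add0r. Qed.

Lemma relgap_pos u v : 0 < u -> 0 < v -> relgap u v = (u - v - v * ln (u / v))%:E.
Proof.
move=> u0 v0; apply/eqP; rewrite eq_le; apply/andP; split.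
  apply: ge_ereal_sup => _ [s s0 <-]; rewrite lee_fin.
  have := @ln_le_sub1 (s * (u / v)); rewrite mulr_gt0 ?divr_gt0 // => /(_ isT).
  have uv0 : 0 < u / v by rewrite divr_gt0.
  rewrite (@lnM R s (u / v)) ?posrE // => h.
  rewrite -subr_ge0; have := ler_wpM2l (ltW v0) h.
  have -> : v * (s * (u / v) - 1) = s * u - v by field; rewrite gt_eqF.
  lra.
(* The supremum is attained at [s = v / u]. *)
have := @relgap_ub u v (v / u); rewrite divr_gt0 // => /(_ isT).
rewrite !ln_div ?posrE //.
by have -> : (1 - v / u) * u + v * (ln v - ln u) = u - v - v * (ln u - ln v);
  [field; rewrite gt_eqF|].
Qed.

Lemma relgap_v0 u : 0 <= u -> relgap u 0 = u%:E.
Proof.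
move=> u0; apply/eqP; rewrite eq_le; apply/andP; split.
  apply: ge_ereal_sup => _ [s s0 <-]; rewrite lee_fin mul0r addr0.
  by rewrite ler_piMl // gerBl ltW.
apply/lee_addgt0Pr => e e0.
(* The supremum is approached as s tends to 0; the choice [s = e / (u + 1)] costs [s * u <= e]. *)
have u1 : 0 < u + 1 by rewrite ltr_wpDl.
have := @relgap_ub u 0 (e / (u + 1)); rewrite divr_gt0 // mul0r addr0 => /(_ isT) h.
apply: (@le_trans _ _ (((1 - e / (u + 1)) * u)%:E + e%:E)%E); last exact: leeD.
rewrite -EFinD lee_fin mulrBl mul1r -addrA lerDl addrC subr_ge0.
by rewrite -mulrA ler_piMr ?(ltW e0) // mulrC ler_pdivrMr // mul1r lerDl.
Qed.

Lemma relgap_u0 v : 0 < v -> relgap 0 v = +oo%E.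
Proof.
move=> v0; apply/eq_infty => t.
(* This s gives the tangent the arbitrary value t. *)
have := @relgap_ub 0 v (expR (t / v)); rewrite expR_gt0 expRK mulr0 add0r => /(_ isT).
by have -> : v * (t / v) = t by field; rewrite gt_eqF.
Qed.

(** A supremum of functions linear in (u, v) is subadditive. This is the log-sum inequality, in a
    form that includes vanishing arguments. *)
Lemma relgap_sum (I : finType) (P : pred I) (u v : I -> R) :
  (relgap (\sum_(i | P i) u i) (\sum_(i | P i) v i) <= \sum_(i | P i) relgap (u i) (v i))%E.
Proof.
apply: ge_ereal_sup => _ [s s0 <-]; rewrite mulr_sumr mulr_suml -big_split /= -sumEFin.
by apply: lee_sum => i _; exact: relgap_ub.
Qed.

(** A linearised Pinsker inequality: take the tangent at [1 - e] or [1 + e] according to the sign of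
    u - v, and [ln (1 -+ e) >= -+ e - 2 e^2]. The parameter e is optimised only at the point of
    use. *)
Lemma relgap_dist u v e : 0 <= v -> 0 < e -> e <= 1 / 2 ->
  ((e * `|u - v| - 2 * e ^+ 2 * v)%:E <= relgap u v)%E.
Proof.
move=> v0 e0 e2.
have ln_ge x : 0 < x -> 1 - x^-1 <= ln x :> R.
  move=> x0; have := @ln_le_sub1 x^-1; rewrite invr_gt0 x0 lnV ?posrE // => /(_ isT).
  lra.
have [uv|uv] := lerP v u.
  have s0 : 0 < 1 - e by lra.
  apply: le_trans (relgap_ub u v s0); rewrite lee_fin.
  have h : - e - 2 * e ^+ 2 <= ln (1 - e).
    apply: le_trans (ln_ge _ s0).
    have -> : 1 - (1 - e)^-1 = - e / (1 - e) by field; rewrite gt_eqF.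
    by rewrite ler_pdivlMr //; nra.
  have := ler_wpM2l v0 h; nra.
have s0 : 0 < 1 + e by lra.
apply: le_trans (relgap_ub u v s0); rewrite lee_fin.
have h : e - 2 * e ^+ 2 <= ln (1 + e).
  apply: le_trans (ln_ge _ s0).
  have -> : 1 - (1 + e)^-1 = e / (1 + e) by field; rewrite gt_eqF.
  by rewrite ler_pdivlMr //; nra.
have := ler_wpM2l v0 h; nra.
Qed.

(* k = 1 and k = p / p' give the two decompositions of the loss. *)
Lemma lne_relgap c u v p (p' : R) k : 0 <= c -> 0 <= u -> 0 <= v -> 0 < p -> 0 < p' -> 0 < k ->
  ((c * v)%:E * lne (u / p')%:E - (c * v)%:E * lne (v / p)%:E =
   (c * (u * k - v) - c * v * ln (p' / p * k))%:E - c%:E * relgap (u * k) v)%E.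
Proof.
move=> c0 u0 v0 p0 p'0 k0.
have [->|cn0] := eqVneq c 0; first by rewrite !mul0r !mul0e subee // subrr sube0.
have {cn0}cp : 0 < c by rewrite lt_neqAle eq_sym cn0.
move: v0; rewrite le_eqVlt => /predU1P[<-|v0].
  rewrite !mulr0 !mul0e sube0 mul0r !subr0 relgap_v0 ?mulr_ge0 ?(ltW k0) //.
  by rewrite -EFinM -EFinB subrr.
have cv : 0 < c * v by rewrite mulr_gt0.
move: u0; rewrite le_eqVlt => /predU1P[<-|u0].
  (* Both sides are -oo here. *)
  rewrite !mul0r relgap_u0 // gt0_muley ?lte_fin // addeNy.
  rewrite (@lne_EFin _ (v / p)) ?divr_gt0 // le0_lneNy // gt0_muleNy ?lte_fin //.
rewrite !lne_EFin ?divr_gt0 // relgap_pos ?mulr_gt0 //.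
rewrite -!EFinM -!EFinB; congr EFin.
rewrite !(ln_div, lnM) ?posrE ?divr_gt0 ?mulr_gt0 //; ring.
Qed.

End entropy_kernel.

(** * Specifications and their Gibbs measures *)

Section kernel_probability.
Context {R : realType} {d q : nat}.
Variables (k : R.-pker conf d q ~> conf d q) (w : conf d q).

(** Packages the measure of the kernel at [w] as a probability, so that [cp] and the lemmas on
    expectations apply to it. *)
Definition kprob : set (conf d q) -> \bar R := k w.
HB.instance Definition _ := Measure.on kprob.
HB.instance Definition _ := Measure_isProbability.Build _ _ _ kprob (prob_kernel w).

End kernel_probability.

Section specification.
Context {R : realType} {d q : nat}.
Variable gamma : {fset site d} -> R.-pker conf d q ~> conf d q.
Hypothesis gamma_spec : specification gamma.
Hypothesis gamma_ql : quasilocal gamma.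
Hypothesis gamma_nn : nonnull gamma.
Hypothesis gamma_ti : spec_translation_invariant gamma.
Implicit Types (D L E : {fset site d}) (w s : conf d q).

Definition spec_cyl L (xi : pattern q L) w : R := cp (kprob (gamma L) w) xi.
Local Notation spf := (spec_fun gamma).

Lemma spec_cyl_restr L w : spec_cyl (restr L w) w = spf L w.
Proof. by []. Qed.

Lemma spec_cyl_ge0 L (xi : pattern q L) w : 0 <= spec_cyl xi w.
Proof. exact: cp_ge0. Qed.

Lemma spec_cyl_glue L (xi zeta : pattern q L) w : spec_cyl xi (glue zeta w) = spec_cyl xi w.
Proof.
have [gi _ _] := gamma_spec; rewrite /spec_cyl /cp /kprob; congr fine; apply: gi.
  by move=> x xL; rewrite glueE (negbTE xL).
exact: measurable_cyl.
Qed.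

Lemma spf_glue L (xi : pattern q L) w : spf L (glue xi w) = spec_cyl xi w.
Proof. by rewrite -spec_cyl_restr restr_glue spec_cyl_glue. Qed.

Lemma spec_cyl_sum1 L w : \sum_(xi : pattern q L) spec_cyl xi w = 1.
Proof. exact: cp_sum1. Qed.

Lemma spf_le1 L w : spf L w <= 1.
Proof.
rewrite -spec_cyl_restr -(spec_cyl_sum1 L w) (bigD1 (restr L w)) //= lerDl sumr_ge0 // => *.
exact: spec_cyl_ge0.
Qed.

Lemma cont_spf L : continuous (spf L).
Proof.
apply: unif_continuous => e e0.
have /(_ [set x | x < e%:E]%E) := @gamma_ql L.
have e0' : (0 < e%:E)%E by rewrite lte_fin.
move=> /(_ (open_ereal_lt_ereal e0'))[D _ HD].
have {}HD := HD (D `|` L)%fset (fsubsetUl D L).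
exists (D `|` L)%fset => w w' ww'.
rewrite -2!spec_cyl_restr -(restr_sub (fsubsetUr D L) ww') distrC -lee_fin ltW //.
apply: le_lt_trans HD; apply: ereal_sup_ubound; exists (w, w') => //=.
by rewrite ww' glue_restr.
Qed.

Lemma cont_spec_cyl L (xi : pattern q L) : continuous (spec_cyl xi).
Proof.
rewrite (_ : spec_cyl xi = fun w => spf L (glue xi w)); first exact/cont_glue/cont_spf.
by apply/funext => w; rewrite spf_glue.
Qed.

(** Properness seen through a window E around D: resampling D leaves the pattern on E \ D frozen. *)
Lemma kprob_proper D E w s : (D `<=` E)%fset ->
  cp (kprob (gamma D) s) (restr E w) =
  spec_cyl (restr D w) s * \1_(cyl (restr (E `\` D)%fset w)) s.
Proof.
move=> DE; have [_ gp _] := gamma_spec.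
have dj : [disjoint D & E `\` D]%fset by apply/fdisjointP => x xD; rewrite in_fsetD xD.
have := gp D (E `\` D)%fset (restr D w) (restr (E `\` D)%fset w) s dj.
have -> : cyl (restr D w) `&` cyl (restr (E `\` D)%fset w) = cyl (restr E w).
  apply/seteqP; split => [s' [/restrP h1 /restrP h2]|s' h].
    apply/restrP => x xE; have [xD|xD] := boolP (x \in D); first exact: h1.
    by apply: h2; rewrite in_fsetD xD.
  by split; apply: restr_sub h => //; exact: fsubsetDl.
rewrite {1}/cp {1}/kprob => ->.
by have -> : gamma D s (cyl (restr D w)) = (spec_cyl (restr D w) s)%:E := cpE (kprob (gamma D) s) _.
Qed.

Lemma cont_kprob_cyl D E w : (D `<=` E)%fset ->
  continuous (fun s => cp (kprob (gamma D) s) (restr E w)).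
Proof.
move=> DE; under eq_fun do rewrite kprob_proper //.
by apply: contM; [exact: cont_spec_cyl|exact: continuous_indic].
Qed.

Lemma kprob_consistent D L E w s : (D `<=` L)%fset -> (D `<=` E)%fset ->
  \int[kprob (gamma L) s]_s' cp (kprob (gamma D) s') (restr E w) =
  cp (kprob (gamma L) s) (restr E w).
Proof.
move=> DL DE; have [_ _ gc] := gamma_spec.
have := gc D L s (cyl (restr E w)) DL (measurable_cyl _).
rewrite /Rintegral {2}/cp {1}/kprob => <-; congr fine; apply: eq_integral => s' _.
by rewrite /= -cpE.
Qed.

Lemma spf_set1_ge : exists2 e : R, 0 < e & forall x w, e <= spf [fset x]%fset w.
Proof.
have [e e0 he] := gamma_nn; exists e => // x w.
have := gamma_ti [fset 0]%fset x (tau (- x) w).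
have -> : translate x [fset 0]%fset = [fset x]%fset.
  by apply/fsetP => y; rewrite in_translate !in_fset1 subr_eq0.
rewrite tauVK => ->; rewrite -lee_fin; apply: le_trans he _.
by apply: ereal_inf_lbound; exists (tau (- x) w).
Qed.

(** Non-nullness concerns single sites. By consistency a site may be resampled inside L, and each
    resampling costs at most one factor e. *)
Lemma spf_ge : exists2 e : R, 0 < e & forall L w, e ^+ #|` L| <= spf L w.
Proof.
have [e e0 he] := spf_set1_ge; exists e => // L w.
(* The kernel of L stays fixed while the observed window E loses one site at a time. *)
suff : forall n E, #|` E| = n -> (E `<=` L)%fset ->
    e ^+ n <= cp (kprob (gamma L) w) (restr E w) by apply.
elim=> [|n IH] E En EL.
  move/eqP: En; rewrite cardfs_eq0 => /eqP ->; rewrite expr0 /cp.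
  have -> : cyl (restr fset0 w) = setT.
    by apply/seteqP; split => // s _; apply/restrP => x; rewrite in_fset0.
  by have /= := probability_setT (kprob (gamma L) w) => ->.
have [x xE] : exists x, x \in E.
  by apply/fset0Pn; rewrite -cardfs_gt0 En.
have xL : ([fset x] `<=` L)%fset by rewrite fsub1set (fsubsetP EL).
have xE' : ([fset x] `<=` E)%fset by rewrite fsub1set.
rewrite -(kprob_consistent w w xL xE').
have h := IH (E `\ x)%fset _ (fsubset_trans (fsubsetDl _ _) EL).
have {h} : e ^+ n <= cp (kprob (gamma L) w) (restr (E `\ x)%fset w).
  by apply: h; rewrite (cardfsD1 x E) xE in En; case: En.
move=> h; rewrite exprS (le_trans (ler_wpM2l (ltW e0) h)) //.
rewrite cp_Exp -ExpZl; last exact: continuous_indic.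
apply: le_Exp.
- by apply: contM; [exact: contC|exact: continuous_indic].
- exact: cont_kprob_cyl.
by move=> s; rewrite kprob_proper // ler_wpM2r // -spf_glue.
Qed.

Section gibbs.
Variable mu : probability (conf d q) R.
Hypothesis mu_gibbs : gibbs gamma mu.

Lemma gibbs_spec_cyl L (xi : pattern q L) : \int[mu]_w spec_cyl xi w = cp mu xi.
Proof.
rewrite /Rintegral [RHS]/cp -(mu_gibbs xi); congr fine; apply: eq_integral => w _.
by rewrite /spec_cyl -cpE.
Qed.

(** [gibbs] tests each kernel only on cylinders over its own set. For a smaller D, pass to a window
    L' so large that the kernel of D is almost constant on its cylinders; there [gibbs] applies, and
    consistency of the kernels of L' and D finishes. *)
Lemma gibbs_cyl D L w : (D `<=` L)%fset ->
  cp mu (restr L w) = \int[mu]_s (spec_cyl (restr D w) s * \1_(cyl (restr (L `\` D)%fset w)) s).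
Proof.
move=> DL; pose phi s := cp (kprob (gamma D) s) (restr L w).
have cphi : continuous phi by exact: cont_kprob_cyl.
have -> : \int[mu]_s (spec_cyl (restr D w) s * \1_(cyl (restr (L `\` D)%fset w)) s) =
    \int[mu]_s phi s.
  by apply: eq_Rintegral => s _; rewrite /phi kprob_proper.
apply/eqP; rewrite -subr_eq0 -normr_le0; apply/ler_addgt0Pr => e e0; rewrite add0r.
have e20 : 0 < e / 2 by rewrite divr_gt0.
have [D' _ HD] := continuous_unif cphi e20.
pose L' := (D' `|` L)%fset.
have {}HD : forall s s', restr L' s = restr L' s' -> `|phi s - phi s'| <= e / 2.
  by apply: HD; exact: fsubsetUl.
have LL' : (L `<=` L')%fset by exact: fsubsetUr.
have DL' := fsubset_trans DL LL'.
(* Both sides are within e / 2 of this Riemann sum. *)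
pose S := \sum_(eta : pattern q L') phi (rep eta) * cp mu eta.
have h1 : `|\int[mu]_s phi s - S| <= e / 2 by exact: Exp_riem.
have h2 : `|cp mu (restr L w) - S| <= e / 2.
  have -> : cp mu (restr L w) =
      \int[mu]_s (\sum_(eta : pattern q L' | restr L (rep eta) == restr L w) spec_cyl eta s).
    rewrite Exp_sum => [|eta _]; last exact: cont_spec_cyl.
    by rewrite (cp_fiber mu _ LL'); apply: eq_bigr => eta _; rewrite gibbs_spec_cyl.
  have -> : S = \int[mu]_s (\sum_(eta : pattern q L') phi (rep eta) * spec_cyl eta s).
    rewrite Exp_sum => [|eta _]; last by apply: contM; [exact: contC|exact: cont_spec_cyl].
    by apply: eq_bigr => eta _; rewrite ExpZl ?gibbs_spec_cyl //; exact: cont_spec_cyl.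
  apply: Exp_dist => [| |s].
  - by apply: cont_sum => eta _; exact: cont_spec_cyl.
  - by apply: cont_sum => eta _; apply: contM; [exact: contC|exact: cont_spec_cyl].
  rewrite -(cp_fiber (kprob (gamma L') s) _ LL') -(kprob_consistent w s DL' DL).
  exact: Exp_riem.
rewrite (le_trans (ler_distD S _ _)) // (splitr e) lerD // distrC //.
Qed.

(** By uniform continuity the kernel in [gibbs_cyl] is constant up to e on the cylinder over L \ D.
    The error is relative to the probability of that cylinder, as is needed for dividing later. *)
Lemma cp_gibbs_near D (e : R) : 0 < e -> \forall L \near totally, forall w,
  `|cp mu (restr L w) - spf D w * cp mu (restr (L `\` D)%fset w)| <=
  e * cp mu (restr (L `\` D)%fset w).
Proof.
move=> e0; have [D' _ HD] := continuous_unif (@cont_spf D) e0.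
exists (D `|` D')%fset => // L; rewrite /= fsubUset => /andP[DL D'L] w.
have {}HD := HD L D'L.
have h s : restr (L `\` D)%fset s = restr (L `\` D)%fset w ->
    `|spec_cyl (restr D w) s - spf D w| <= e.
  move=> /restrP sw; rewrite -spf_glue; apply: HD; apply/restrP => x xL.
  by rewrite glue_restrE; case: ifPn => // xD; apply: sw; rewrite in_fsetD xD.
rewrite (gibbs_cyl w DL) cp_Exp -!ExpZl; try exact: continuous_indic.
have ci := @continuous_indic R _ _ _ (restr (L `\` D)%fset w).
have c1 r : continuous (fun s => r * \1_(cyl (restr (L `\` D)%fset w)) s : R).
  by apply: contM ci; exact: contC.
have c2 : continuous (fun s => spec_cyl (restr D w) s * \1_(cyl (restr (L `\` D)%fset w)) s).
  by apply: contM ci; exact: cont_spec_cyl.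
rewrite ler_distlC -ExpB -?ExpD //.
apply/andP; split; apply: le_Exp => //; try (exact: contB || exact: contD);
  move=> s; rewrite cyl_indic; case: eqP => [/h|_]; rewrite ?mulr1 ?mulr0 ?subr0 ?addr0 //;
  by rewrite ler_distlC => /andP[].
Qed.

Lemma cp_gibbs_ge : exists2 e : R, 0 < e & forall D L w, (D `<=` L)%fset ->
  e ^+ #|` D| * cp mu (restr (L `\` D)%fset w) <= cp mu (restr L w).
Proof.
have [e e0 he] := spf_ge; exists e => // D L w DL.
have ci := @continuous_indic R _ _ _ (restr (L `\` D)%fset w).
rewrite (gibbs_cyl w DL) cp_Exp -ExpZl //; apply: le_Exp.
- by apply: contM ci; exact: contC.
- by apply: contM ci; exact: cont_spec_cyl.
by move=> s; rewrite ler_wpM2r // -spf_glue.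
Qed.

End gibbs.

End specification.

(** * Ratios of cylinder probabilities before and after a jump *)

Section ratios.
Context {R : realType} {d q : nat}.
Variable gamma : {fset site d} -> R.-pker conf d q ~> conf d q.
Hypothesis gamma_spec : specification gamma.
Hypothesis gamma_ql : quasilocal gamma.
Hypothesis gamma_nn : nonnull gamma.
Hypothesis gamma_ti : spec_translation_invariant gamma.
Variable mu : probability (conf d q) R.
Hypothesis mu_gibbs : gibbs gamma mu.
Implicit Types (D L E : {fset site d}) (w s : conf d q).
Local Notation spf := (spec_fun gamma).

Definition spec_ratio D w (xi : pattern q D) : R := spf D (glue xi w) / spf D w.

Definition cp_ratio (nu : probability (conf d q) R) L D w (xi : pattern q D) : R :=
  cp nu (restr L (glue xi w)) / cp nu (restr L w).

Lemma spf_gt0 L w : 0 < spf L w.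
Proof.
have [e e0 he] := spf_ge gamma_spec gamma_ql gamma_nn gamma_ti.
by apply: lt_le_trans (he L w); rewrite exprn_gt0.
Qed.

Lemma spec_ratio_gt0 D w (xi : pattern q D) : 0 < spec_ratio w xi.
Proof. by rewrite divr_gt0 ?spf_gt0. Qed.

Lemma cont_spec_ratio D (xi : pattern q D) : continuous (fun w => spec_ratio w xi).
Proof.
have cs := @cont_spf _ _ _ _ gamma_ql D.
apply: contM; first exact: cont_glue.
by apply: contV => // w; rewrite gt_eqF ?spf_gt0.
Qed.

(** For D = L, [cp_gibbs_ge] compares with the only cylinder over the empty set, whose probability
    is one. *)
Lemma cp_mu_gt0 L (eta : pattern q L) : 0 < cp mu eta.
Proof.
rewrite -(restr_rep eta); set w := rep eta.
have [e e0 he] := cp_gibbs_ge gamma_spec gamma_ql gamma_nn gamma_ti mu_gibbs.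
apply: lt_le_trans (he L L w (fsubset_refl L)).
rewrite fsetDv mulr_gt0 ?exprn_gt0 //.
have <- : \sum_(zeta : pattern q fset0 | zeta == restr fset0 w) cp mu zeta =
    cp mu (restr fset0 w) by rewrite big_pred1_eq.
have h (zeta : pattern q fset0) : zeta == restr fset0 w.
  by apply/eqP; rewrite -[LHS]restr_rep; apply/restrP => x; rewrite in_fset0.
by rewrite (eq_bigl xpredT) ?cp_sum1.
Qed.

Lemma restrD_glue D L (xi : pattern q D) w :
  restr (L `\` D)%fset (glue xi w) = restr (L `\` D)%fset w.
Proof.
by apply/restrP => x; rewrite in_fsetD glueE => /andP[/negbTE->].
Qed.

Lemma cp_ratio_cvg D (e : R) : 0 < e -> \forall L \near totally,
  forall w (xi : pattern q D), `|cp_ratio mu L w xi - spec_ratio w xi| <= e.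
Proof.
move=> e0.
have [k k0 hk] := spf_ge gamma_spec gamma_ql gamma_nn gamma_ti.
have {}hk w := hk D w.
have [k' k'0 hk'] := cp_gibbs_ge gamma_spec gamma_ql gamma_nn gamma_ti mu_gibbs.
have {}k0 : 0 < k ^+ #|` D| by rewrite exprn_gt0.
have {}k'0 : 0 < k' ^+ #|` D| by rewrite exprn_gt0.
move: (k ^+ _) (k' ^+ _) (hk' D) k0 k'0 hk => {hk' k' }K K' hk' K0 K'0 hk.
(* K bounds the specification on D from below, and K' the probability of a pattern on L relative to
   its part p off D. The difference of the ratios has a numerator of at most twice this constant
   times p, and a denominator of at least [K' * p * K]. *)
have f0 : 0 < e * K * K' / 2 by rewrite !(mulr_gt0, divr_gt0).
have [D' _ HD] := cp_gibbs_near gamma_spec gamma_ql mu_gibbs D f0.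
exists (D `|` D')%fset => // L; rewrite /= fsubUset => /andP[DL D'L] w xi.
have h1 := HD L D'L w; have := HD L D'L (glue xi w); rewrite restrD_glue => h2.
have {hk'}h3 := hk' L w DL; have p0 := cp_mu_gt0 (restr (L `\` D)%fset w).
have a0 := cp_mu_gt0 (restr L w).
rewrite /cp_ratio /spec_ratio.
move: (cp mu (restr L w)) (cp mu (restr L (glue xi w))) (cp mu (restr (L `\` D)%fset w))
  (spf D w) (spf D (glue xi w)) (hk w) (hk (glue xi w)) (spf_le1 gamma D w) (spf_le1 gamma D (glue xi w)) h1 h2 h3 p0 a0.
move=> a a' p u u' Ku Ku' u1 u'1 h1 h2 h3 p0 a0 {HD}.
have u0 : 0 < u by apply: lt_le_trans Ku.
have u'0 : 0 < u' by apply: lt_le_trans Ku'.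
have -> : a' / a - u' / u = ((a' - u' * p) * u - u' * (a - u * p)) / (a * u).
  by field; rewrite !gt_eqF.
rewrite normrM normfV (gtr0_norm (mulr_gt0 a0 u0)) ler_pdivrMr ?mulr_gt0 //.
rewrite (le_trans (ler_normB _ _)) // !normrM (gtr0_norm u0) (gtr0_norm u'0).
apply: (@le_trans _ _ (e * K * K' / 2 * p + e * K * K' / 2 * p)).
  rewrite lerD //; first by rewrite (le_trans _ h2) // ler_piMr.
  by rewrite (le_trans _ h1) // ler_piMl.
have -> : e * K * K' / 2 * p + e * K * K' / 2 * p = e * (K' * p * K) by field.
by rewrite ler_wpM2l ?(ltW e0) // ler_pM // ?mulr_ge0 ?ltW.
Qed.

(** The ratio depends on the jump and not on the set on which it is recorded: for D and for E it is
    the limit of the same cylinder ratios of [mu]. *)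
Lemma spec_ratio_sub D E w (xi : pattern q D) : (D `<=` E)%fset ->
  spec_ratio w xi = spec_ratio w (restr E (glue xi w)).
Proof.
move=> DE; apply/eqP; rewrite -subr_eq0 -normr_le0; apply/ler_addgt0Pr => e e0; rewrite add0r.
have e20 : 0 < e / 2 by rewrite divr_gt0.
have [L [h1 h2]] := filter_ex (filterI (cp_ratio_cvg D e20) (cp_ratio_cvg E e20)).
have {}h1 := h1 w xi; have {}h2 := h2 w (restr E (glue xi w)).
have eqr : cp_ratio mu L w (restr E (glue xi w)) = cp_ratio mu L w xi.
  rewrite /cp_ratio; congr (cp mu (restr L _) / _).
  apply/funext => x; rewrite glue_restrE; case: ifPn => // xE.
  by rewrite glueE; case: ifPn => // /(fsubsetP DE); rewrite (negbTE xE).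
rewrite eqr in h2.
rewrite (le_trans (ler_distD (cp_ratio mu L w xi) _ _)) // (splitr e) lerD //.
by rewrite distrC.
Qed.

Lemma spec_ratio_tau x D w s :
  spec_ratio (tau x w) (restr (translate x D) (tau x s)) = spec_ratio w (restr D s).
Proof. by rewrite /spec_ratio glue_tau !gamma_ti. Qed.

End ratios.

(** * Cylinder averages *)

Section ereal_limits.
Context {R : realType} {T : Type} {F : set_system T} {FF : ProperFilter F}.

(** Separates lower from upper bounds and uses real thresholds only, which treats finite and
    infinite limits alike. *)
Lemma ecvgP (f : T -> \bar R) (l : \bar R) : f @ F --> l <->
  (forall a : R, (a%:E < l)%E -> \forall x \near F, (a%:E < f x)%E) /\
  (forall a : R, (l < a%:E)%E -> \forall x \near F, (f x < a%:E)%E).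
Proof.
split=> [fl|[fl lf]].
  by split=> a al; [exact: (fl _ (open_ereal_gt_ereal al))|exact: (fl _ (open_ereal_lt_ereal al))].
case: l fl lf => [l| |] fl lf; last 2 first.
- by apply/cvgeyPgt => A; apply: fl; rewrite ltry.
- by apply/cvgeNyPlt => A; apply: lf; rewrite ltNyr.
have h (e : R) : 0 < e -> \forall x \near F, (`|f x - l%:E| < e%:E)%E.
  move=> e0; have h1 : ((l - e)%:E < l%:E)%E by rewrite lte_fin ltrBlDr ltrDl.
  have h2 : (l%:E < (l + e)%:E)%E by rewrite lte_fin ltrDl.
  apply: filterS2 (fl _ h1) (lf _ h2) => x; case: (f x) => [r| |] //.
  by rewrite /= !lte_fin ltr_distl => -> ->.
apply/fine_cvgP; split.
  by apply: filterS (h 1 ltr01) => x; case: (f x).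
apply/cvgrPdist_lt => e e0; apply: filterS (h e e0) => x.
by rewrite /=; case: (f x) => [r| |] //=; rewrite distrC lte_fin.
Qed.

End ereal_limits.

Section averages.
Context {R : realType} {d q : nat}.
Variable nu : probability (conf d q) R.
Implicit Types (D L : {fset site d}) (w : conf d q).

Lemma avg_cvg D (f : conf d q -> pattern q D -> R)
    (F : forall L, pattern q L -> pattern q D -> R) :
  (forall xi, continuous (f^~ xi)) ->
  (forall e : R, 0 < e -> \forall L \near totally,
    forall eta xi, `|F L eta xi - f (rep eta) xi| <= e) ->
  (\sum_(eta : pattern q L) \sum_(xi : pattern q D) F L eta xi * cp nu eta)
    @[L --> totally] --> \int[nu]_w (\sum_(xi : pattern q D) f w xi).
Proof.
move=> cf HF; apply/cvgrPdist_le => e e0.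
pose N := (\sum_(xi : pattern q D) 1 : R).
have N0 : 0 <= N by rewrite sumr_ge0.
have e1 : 0 < e / 2 by rewrite divr_gt0.
have e2 : 0 < e / 2 / (N + 1) by rewrite divr_gt0 // ltr_wpDl.
have cs : continuous (fun w => \sum_(xi : pattern q D) f w xi) by apply: cont_sum.
apply: filterS2 (HF _ e2) (continuous_unif cs e1) => L HL1 HL2.
rewrite (le_trans (ler_distD (\sum_(eta : pattern q L)
  (\sum_(xi : pattern q D) f (rep eta) xi) * cp nu eta) _ _)) // (splitr e) lerD //.
  exact: Exp_riem.
rewrite -sumrB (le_trans (ler_norm_sum _ _ _)) //.
apply: (@le_trans _ _ (\sum_(eta : pattern q L) (e / 2) * cp nu eta)); last first.
  by rewrite -mulr_sumr cp_sum1 mulr1.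
apply: ler_sum => eta _; rewrite mulr_suml -sumrB (le_trans (ler_norm_sum _ _ _)) //.
apply: (@le_trans _ _ (\sum_(xi : pattern q D) (e / 2 / (N + 1)) * cp nu eta)).
  apply: ler_sum => xi _; rewrite -mulrBl normrM (ger0_norm (cp_ge0 _ _)).
  by rewrite ler_wpM2r ?cp_ge0 // distrC.
rewrite -mulr_suml ler_wpM2r ?cp_ge0 //.
have -> : \sum_(xi : pattern q D) (e / 2 / (N + 1)) = (e / 2) * (N / (N + 1)).
  rewrite [N / _]mulrC mulrA {2}/N mulr_sumr; apply: eq_bigr => xi _.
  by rewrite mulr1.
by rewrite ler_piMr ?(ltW e1) // ler_pdivrMr ?ltr_wpDl // mul1r lerDl.
Qed.

(** Here the weight belongs to the pattern after the jump. [pattern_swap] moves it back to the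
    pattern before, so that f is evaluated along the reversed jump. *)
Lemma avg_swap_cvg D (f : conf d q -> pattern q D -> R)
    (F : forall L, pattern q L -> pattern q D -> R) :
  (forall xi, continuous (f^~ xi)) ->
  (forall e : R, 0 < e -> \forall L \near totally,
    forall eta xi, `|F L eta xi - f (rep eta) xi| <= e) ->
  (\sum_(eta : pattern q L) \sum_(xi : pattern q D)
      F L eta xi * cp nu (restr L (glue xi (rep eta))))
    @[L --> totally] -->
  \int[nu]_w (\sum_(xi : pattern q D) f (glue xi w) (restr D w)).
Proof.
move=> cf HF; pose F' L (eta : pattern q L) (xi : pattern q D) :=
  F L (restr L (glue xi (rep eta))) (restr D (rep eta)).
have near_sub : \forall L \near totally, (D `<=` L)%fset by exists D.
have := @avg_cvg D (fun w xi => f (glue xi w) (restr D w)) F'.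
have H1 (xi : pattern q D) : continuous (fun w => f (glue xi w) (restr D w)).
  exact: cont_glue_restr.
have H2 (e : R) : 0 < e -> \forall L \near totally,
    forall (eta : pattern q L) (xi : pattern q D), `|F' L eta xi - f (glue xi (rep eta)) (restr D (rep eta))| <= e.
  move=> e0; have e1 : 0 < e / 2 by rewrite divr_gt0.
  have unif_f : \forall L \near totally, forall (zeta : pattern q D) w w',
      restr L w = restr L w' -> `|f w zeta - f w' zeta| <= e / 2.
    by apply: filter_forall => zeta; exact: continuous_unif.
  apply: filterS2 (HF _ e1) unif_f => L h1 h2 eta xi.
  rewrite (le_trans (ler_distD (f (rep (restr L (glue xi (rep eta)))) (restr D (rep eta))) _ _)) //.
  by rewrite (splitr e); apply: lerD; [exact: h1|apply: h2; exact: restr_rep].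
move=> /(_ H1 H2); apply: cvg_trans; apply: near_eq_cvg.
apply: filterS near_sub => L DL.
rewrite [RHS](pattern_swap _ DL); apply: eq_bigr => eta _; apply: eq_bigr => xi _.
rewrite /F'; congr (_ * cp nu _).
by rewrite restr_glue_rep glueK restr_rep.
Qed.

End averages.

Section uniform_limits.
Context {R : realType} {d q : nat}.
Implicit Types (D L : {fset site d}) (w : conf d q).

(** Uniformity over the patterns eta is what survives averaging against an arbitrary [nu]. *)
Definition ucvg D (F : forall L, pattern q L -> pattern q D -> R)
    (f : conf d q -> pattern q D -> R) :=
  forall e : R, 0 < e -> \forall L \near totally,
    forall eta xi, `|F L eta xi - f (rep eta) xi| <= e.

Lemma pattern_bounded D (f : conf d q -> pattern q D -> R) :
  (forall xi, continuous (f^~ xi)) ->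
  exists2 C : R, 0 < C & forall w xi, `|f w xi| <= C.
Proof.
move=> cf; have cC xi : exists C : R, 0 < C /\ forall w, `|f w xi| <= C.
  by have [C C0 HC] := continuous_bounded (cf xi); exists C.
have [C HC] := choice cC.
exists (\sum_(xi : pattern q D) C xi + 1).
  by rewrite ltr_wpDl // sumr_ge0 // => xi _; rewrite ltW // (HC xi).1.
move=> w xi; rewrite (le_trans ((HC xi).2 w)) // (bigD1 xi) //= -addrA lerDl.
by rewrite addr_ge0 // sumr_ge0 // => z _; rewrite ltW // (HC z).1.
Qed.

Lemma ucvg_mul D F1 F2 (f1 f2 : conf d q -> pattern q D -> R) :
  (forall xi, continuous (f1^~ xi)) -> (forall xi, continuous (f2^~ xi)) ->
  ucvg F1 f1 -> ucvg F2 f2 ->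
  ucvg (fun L eta xi => F1 L eta xi * F2 L eta xi) (fun w xi => f1 w xi * f2 w xi).
Proof.
move=> cf1 cf2 h1 h2 e e0.
have [C1 C10 HC1] := pattern_bounded cf1; have [C2 C20 HC2] := pattern_bounded cf2.
have e1 : 0 < e / 2 / (C2 + 1) by rewrite !divr_gt0 // addr_gt0.
have e2 : 0 < e / 2 / C1 by rewrite !divr_gt0.
apply: filterS3 (h1 _ e1) (h2 _ e2) (h2 _ ltr01) => L {}h1 {}h2 h3 eta xi.
have -> : F1 L eta xi * F2 L eta xi - f1 (rep eta) xi * f2 (rep eta) xi =
  (F1 L eta xi - f1 (rep eta) xi) * F2 L eta xi +
  f1 (rep eta) xi * (F2 L eta xi - f2 (rep eta) xi) by ring.
have hF : `|F2 L eta xi| <= C2 + 1.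
  rewrite -(subrK (f2 (rep eta) xi) (F2 L eta xi)) addrC (le_trans (ler_normD _ _)) //.
  by apply: lerD; [exact: HC2|exact: h3].
rewrite (le_trans (ler_normD _ _)) // !normrM.
apply: (@le_trans _ _ (e / 2 / (C2 + 1) * (C2 + 1) + C1 * (e / 2 / C1))).
  by apply: lerD; apply: ler_pM.
by rewrite divfK ?gt_eqF ?addr_gt0 // [C1 * _]mulrC divfK ?gt_eqF // -splitr.
Qed.

Lemma ucvg_inv D F (f : conf d q -> pattern q D -> R) :
  (forall xi, continuous (f^~ xi)) -> (forall w xi, 0 < f w xi) ->
  ucvg F f -> ucvg (fun L eta xi => (F L eta xi)^-1) (fun w xi => (f w xi)^-1).
Proof.
move=> cf f0 h e e0.
have cv xi : continuous (fun w => (f w xi)^-1).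
  by apply: contV; [move=> w; rewrite gt_eqF|exact: cf].
have [C C0 HC] := @pattern_bounded D (fun w xi => (f w xi)^-1) cv.
(* As f is at least 1 / C, this error keeps F above 1 / (2 C), so inverting multiplies errors by at
   most 2 C^2. *)
have C20 : 0 < (2 * C)^-1 by rewrite invr_gt0 mulr_gt0.
have e1 : 0 < e / (2 * C ^+ 2) by rewrite divr_gt0 // mulr_gt0 // exprn_gt0.
apply: filterS2 (h _ C20) (h _ e1) => L h1 h2 eta xi.
move: (f (rep eta) xi) (F L eta xi) (f0 (rep eta) xi) (HC (rep eta) xi) (h1 eta xi) (h2 eta xi).
move=> y x y0; rewrite gtr0_norm ?invr_gt0 // => yC {}h1 {}h2.
have Cy : C^-1 <= y by rewrite -(invrK y) lef_pV2 ?posrE ?invr_gt0.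
have xC : (2 * C)^-1 <= x.
  have : y - (2 * C)^-1 <= x by move: h1; rewrite ler_distl => /andP[].
  apply: le_trans; rewrite lerBrDr (le_trans _ Cy) //.
  by rewrite le_eqVlt; apply/orP; left; apply/eqP; field; rewrite gt_eqF.
have x0 : 0 < x by exact: lt_le_trans xC.
have -> : x^-1 - y^-1 = (y - x) * (x^-1 * y^-1) by field; rewrite !gt_eqF.
rewrite normrM distrC [X in _ * X]ger0_norm ?mulr_ge0 ?invr_ge0 ?(ltW x0) ?(ltW y0) //.
apply: (@le_trans _ _ (e / (2 * C ^+ 2) * ((2 * C) * C))).
  apply: ler_pM => //; first by rewrite mulr_ge0 ?invr_ge0 ?(ltW x0) ?(ltW y0).
  apply: ler_pM => //; rewrite ?invr_ge0 ?(ltW x0) ?(ltW y0) //.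
  by rewrite -(invrK (2 * C)) lef_pV2 ?posrE.
by rewrite le_eqVlt; apply/orP; left; apply/eqP; field; rewrite gt_eqF.
Qed.

Lemma ucvg_ln D F (f : conf d q -> pattern q D -> R) :
  (forall xi, continuous (f^~ xi)) -> (forall w xi, 0 < f w xi) ->
  (forall L eta xi, 0 < F L eta xi) ->
  ucvg F f -> ucvg (fun L eta xi => ln (F L eta xi)) (fun w xi => ln (f w xi)).
Proof.
move=> cf f0 F0 h e e0.
have cv xi : continuous (fun w => (f w xi)^-1).
  by apply: contV; [move=> w; rewrite gt_eqF|exact: cf].
have h' := ucvg_mul cf cv h (ucvg_inv cf f0 h).
have [C C0 HC] := @pattern_bounded D (fun w xi => (f w xi)^-1) cv.
have [C' C'0 HC'] := @pattern_bounded D f cf.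
have e1 : 0 < e / C by rewrite divr_gt0.
have e2 : 0 < e / C' by rewrite divr_gt0.
apply: filterS2 (h _ e1) (ucvg_inv cf f0 h e2) => L h1 h2 eta xi.
move: (f (rep eta) xi) (F L eta xi) (f0 (rep eta) xi) (F0 L eta xi) (HC (rep eta) xi)
  (HC' (rep eta) xi) (h1 eta xi) (h2 eta xi) => y x y0 x0 yC yC' {}h1 {}h2.
(* Both signs follow from [ln z <= z - 1], applied to y / x and to x / y. *)
rewrite -ln_div ?posrE // ler_norml -[- _ <= _]lerN2 opprK -lnV ?posrE ?divr_gt0 // invf_div.
apply/andP; split.
  apply: le_trans (ln_le_sub1 (divr_gt0 y0 x0)) _.
  have -> : y / x - 1 = y * (x^-1 - y^-1) by field; rewrite !gt_eqF.
  apply: le_trans (ler_norm _) _; rewrite normrM.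
  apply: (@le_trans _ _ (C' * (e / C'))); first exact: ler_pM.
  by rewrite [C' * _]mulrC divfK // gt_eqF.
apply: le_trans (ln_le_sub1 (divr_gt0 x0 y0)) _.
have -> : x / y - 1 = (x - y) * y^-1 by field; rewrite !gt_eqF.
apply: le_trans (ler_norm _) _; rewrite normrM.
apply: (@le_trans _ _ ((e / C) * C)); first exact: ler_pM.
by rewrite divfK // gt_eqF.
Qed.

End uniform_limits.

(** * Decomposition of the entropy loss of one update set *)

Section loss_decomposition.
Context {R : realType} {d q : nat}.
Variable c : rates R d q.
Hypothesis c_ge0 : rates_nonneg c.
Hypothesis c_cont : rates_continuous c.
Variables nu mu : probability (conf d q) R.
Hypothesis mu_gt0 : forall L (eta : pattern q L), 0 < cp mu eta.
Implicit Types (D L : {fset site d}) (w : conf d q).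

(** The conditional mean of the rate given eta. On null patterns a genuine value of the rate is
    taken, so that [cavg_bounds] and the uniform convergence hold for all patterns. *)
Definition cavg D L (eta : pattern q L) (xi : pattern q D) : R :=
  if cp nu eta == 0 then c (rep eta) xi
  else \int[nu]_w (c w xi * \1_(cyl eta) w) / cp nu eta.

Lemma cont_rate D (xi : pattern q D) : continuous (fun w => c w xi).
Proof. exact: c_cont. Qed.

Lemma cavgE D L (eta : pattern q L) (xi : pattern q D) :
  \int[nu]_w (c w xi * \1_(cyl eta) w) = cavg eta xi * cp nu eta.
Proof.
have ci : continuous (\1_(cyl eta) : conf d q -> R) by exact: continuous_indic.
have cc := @cont_rate D xi.
rewrite /cavg; case: eqP => [v0|/eqP v0]; last by rewrite divfK.
have [C C0 HC] := continuous_bounded cc.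
apply/eqP; rewrite v0 mulr0 eq_le; apply/andP; split; last first.
  by apply: Rintegral_ge0 => w _; rewrite mulr_ge0.
have -> : 0 = \int[nu]_w (C * \1_(cyl eta) w) by rewrite ExpZl // -cp_Exp v0 mulr0.
apply: le_Exp; [exact: contM|by apply: contM ci; exact: contC|] => w.
by rewrite ler_wpM2r // (le_trans (ler_norm _)).
Qed.

Lemma cavg_bounds D L (eta : pattern q L) (xi : pattern q D) (a b : R) :
  (forall w, restr L w = eta -> a <= c w xi <= b) -> a <= cavg eta xi <= b.
Proof.
move=> H; rewrite /cavg; case: eqP => [_|/eqP v0]; first by apply: H; rewrite restr_rep.
have vp : 0 < cp nu eta by rewrite lt_neqAle eq_sym v0 cp_ge0.
rewrite ler_pdivlMr // ler_pdivrMr //.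
have ci : continuous (\1_(cyl eta) : conf d q -> R) by exact: continuous_indic.
have cc := @cont_rate D xi.
rewrite !cp_Exp -!ExpZl //; apply/andP; split; apply: le_Exp;
  try (exact: contM || (by apply: contM ci; exact: contC)); move=> w.
  rewrite cyl_indic; case: eqP => [/H/andP[h _]|_]; last by rewrite !mulr0.
  by rewrite !mulr1.
rewrite cyl_indic; case: eqP => [/H/andP[_ h]|_]; last by rewrite !mulr0.
by rewrite !mulr1.
Qed.

Lemma cavg_ge0 D L (eta : pattern q L) (xi : pattern q D) : 0 <= cavg eta xi.
Proof.
have [C C0 HC] := continuous_bounded (@cont_rate D xi).
suff /andP[] : 0 <= cavg eta xi <= C by [].
by apply: cavg_bounds => w _; rewrite c_ge0 (le_trans (ler_norm _)).
Qed.

Lemma cavg_ucvg D : ucvg (fun L eta xi => @cavg D L eta xi) (fun w xi => c w xi).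
Proof.
move=> e e0.
have : \forall L \near totally, forall (xi : pattern q D) w w',
    restr L w = restr L w' -> `|c w xi - c w' xi| <= e.
  by apply: filter_forall => xi; apply: continuous_unif => //; exact: cont_rate.
apply: filterS => L HL eta xi; rewrite ler_distl.
apply: cavg_bounds => w ew; rewrite -ler_distl; apply: HL.
by rewrite ew restr_rep.
Qed.

Definition loss D L : \bar R :=
  (\sum_(eta : pattern q L) \sum_(xi : pattern q D)
    (\int[nu]_w (c w xi * (\1_(cyl eta) (glue xi w) - \1_(cyl eta) w)))%R%:E
      * log_ratio nu mu (cyl eta))%E.

Definition lr L (eta : pattern q L) : \bar R := lne (cp nu eta / cp mu eta)%:E.

Definition jumped D L (eta : pattern q L) (xi : pattern q D) : pattern q L :=
  restr L (glue xi (rep eta)).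

Lemma rate_in D L (eta : pattern q L) (xi : pattern q D) :
  \int[nu]_w (c w xi * \1_(cyl eta) (glue xi w)) =
  \sum_(zeta : pattern q L | jumped zeta xi == eta) cavg zeta xi * cp nu zeta.
Proof.
have -> : (fun w => c w xi * \1_(cyl eta) (glue xi w)) =
    fun w => \sum_(zeta : pattern q L | jumped zeta xi == eta) c w xi * \1_(cyl zeta) w.
  apply/funext => w; rewrite -mulr_sumr; congr (_ * _).
  under eq_bigr do rewrite cyl_indic.
  rewrite big_mkcond (bigD1 (restr L w)) //= eqxx big1 ?addr0; last first.
    by move=> zeta /negbTE zw; rewrite [restr L w == _]eq_sym zw; case: ifP.
  by rewrite cyl_indic /jumped restr_glue_rep; case: eqP.
rewrite Exp_sum; last by move=> zeta _; apply: contM; [exact: cont_rate|exact: continuous_indic].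
by apply: eq_bigr => zeta _; rewrite cavgE.
Qed.

(** Collects mass entering and leaving each pattern by jumps: each jump contributes its mass times
    the increment of the log-likelihood ratio. *)
Lemma lossE D L : (D `<=` L)%fset -> loss D L =
  (\sum_(eta : pattern q L) \sum_(xi : pattern q D)
    ((cavg eta xi * cp nu eta)%:E * lr (jumped eta xi)
     - (cavg eta xi * cp nu eta)%:E * lr eta))%E.
Proof.
move=> DL; rewrite /loss exchange_big [RHS]exchange_big; apply: eq_bigr => xi _ /=.
pose a (eta : pattern q L) := cavg eta xi * cp nu eta; have a0 eta : 0 <= a eta by rewrite mulr_ge0 ?cavg_ge0 ?cp_ge0.
pose b (eta : pattern q L) := \sum_(zeta : pattern q L | jumped zeta xi == eta) a zeta.
have b0 eta : 0 <= b eta by rewrite sumr_ge0.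
have -> : (\sum_(eta : pattern q L) (\int[nu]_w (c w xi * (\1_(cyl eta) (glue xi w) - \1_(cyl eta) w)))%R%:E
      * log_ratio nu mu (cyl eta) =
    \sum_(eta : pattern q L) ((b eta)%:E * lr eta - (a eta)%:E * lr eta))%E.
  apply: eq_bigr => eta _.
  have -> : \int[nu]_w (c w xi * (\1_(cyl eta) (glue xi w) - \1_(cyl eta) w)) = b eta - a eta.
    under eq_Rintegral do rewrite mulrBr.
    rewrite ExpB; first by rewrite rate_in cavgE.
    - apply: contM; first exact: cont_rate.
      by apply: cont_glue; exact: continuous_indic.
    - by apply: contM; [exact: cont_rate|exact: continuous_indic].
  rewrite [log_ratio _ _ _]/(lr eta).
  (* Where the logarithm is -oo no mass leaves eta, so the product splits without producing oo -
     oo. *)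
  have [v0|v0] := eqVneq (cp nu eta) 0.
    have -> : a eta = 0 by rewrite /a v0 mulr0.
    by rewrite subr0 mul0e sube0.
  rewrite /lr lne_EFin; last by rewrite divr_gt0 // lt_neqAle eq_sym v0 cp_ge0.
  by rewrite -!EFinM -EFinB mulrBl.
rewrite !big_split /=; congr (_ + _)%E.
transitivity (\sum_(eta : pattern q L) \sum_(zeta : pattern q L | jumped zeta xi == eta)
    (a zeta)%:E * lr eta)%E.
  apply: eq_bigr => eta _; rewrite /b -sumEFin ge0_sume_distrl // => zeta _.
  by rewrite lee_fin.
rewrite [RHS](partition_big (fun zeta => jumped zeta xi) xpredT) //=.
by apply: eq_bigr => eta _; apply: eq_bigr => zeta /eqP <-.
Qed.

Lemma sume_sub_ge0 (I : finType) (r : I -> R) (g : I -> \bar R) :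
  (forall i, 0 <= g i)%E ->
  (\sum_i ((r i)%:E - g i) = (\sum_i r i)%R%:E - \sum_i g i)%E.
Proof.
move=> g0; rewrite big_split /= sumEFin sumeN // => i j _ _.
by rewrite ge0_adde_def // inE.
Qed.

Lemma loss_decomp D L (k : pattern q L -> pattern q D -> R) :
  (D `<=` L)%fset -> (forall eta xi, 0 < k eta xi) ->
  (loss D L =
   (\sum_(eta : pattern q L) \sum_(xi : pattern q D)
      (cavg eta xi * (cp nu (jumped eta xi) * k eta xi - cp nu eta)
       - cavg eta xi * cp nu eta * ln (cp_ratio mu L (rep eta) xi * k eta xi)))%R%:E
   - \sum_(eta : pattern q L) \sum_(xi : pattern q D)
      (cavg eta xi)%:E * relgap (cp nu (jumped eta xi) * k eta xi)%R (cp nu eta))%E.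
Proof.
move=> DL k0; rewrite lossE // -sume_sub_ge0; last first.
  by move=> eta; apply: sume_ge0 => xi _; rewrite mule_ge0 ?relgap_ge0 // lee_fin cavg_ge0.
apply: eq_bigr => eta _; rewrite -sume_sub_ge0; last first.
  by move=> xi; rewrite mule_ge0 ?relgap_ge0 // lee_fin cavg_ge0.
apply: eq_bigr => xi _; rewrite /lr /cp_ratio restr_rep.
by rewrite (@lne_relgap _ _ _ _ _ _ (k eta xi)) ?cavg_ge0 ?cp_ge0.
Qed.

End loss_decomposition.

(** * The two decompositions and their real parts in large boxes *)

Section local_limits.
Context {R : realType} {d q : nat}.
Variable c : rates R d q.
Hypothesis c_ge0 : rates_nonneg c.
Hypothesis c_cont : rates_continuous c.
Variable gamma : {fset site d} -> R.-pker conf d q ~> conf d q.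
Hypothesis gamma_spec : specification gamma.
Hypothesis gamma_ql : quasilocal gamma.
Hypothesis gamma_nn : nonnull gamma.
Hypothesis gamma_ti : spec_translation_invariant gamma.
Variable mu : probability (conf d q) R.
Hypothesis mu_gibbs : gibbs gamma mu.
Variable nu : probability (conf d q) R.
Implicit Types (D L : {fset site d}) (w : conf d q).

Let mu_gt0 L (eta : pattern q L) : 0 < cp mu eta.
Proof. exact: (cp_mu_gt0 gamma_spec gamma_ql gamma_nn gamma_ti mu_gibbs). Qed.

Let g_gt0 D w (xi : pattern q D) : 0 < spec_ratio gamma w xi.
Proof. exact: (spec_ratio_gt0 gamma_spec gamma_ql gamma_nn gamma_ti). Qed.

Let cont_g D (xi : pattern q D) : continuous (fun w => spec_ratio gamma w xi).
Proof. exact: (cont_spec_ratio gamma_spec gamma_ql gamma_nn gamma_ti). Qed.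

Lemma cp_ratio_ucvg D :
  ucvg (fun L (eta : pattern q L) (xi : pattern q D) => cp_ratio mu L (rep eta) xi)
       (fun w xi => spec_ratio gamma w xi).
Proof.
move=> e e0.
by apply: filterS (cp_ratio_cvg gamma_spec gamma_ql gamma_nn gamma_ti mu_gibbs D e0) => L H eta xi.
Qed.

(** The limit integrand of [loss_drift], once [avg_swap_cvg] has moved the weight back before the
    jump. *)
Definition drift D : conf d q -> R := fun w => \sum_(xi : pattern q D)
  (c (glue xi w) (restr D w) - c w xi * (1 + ln (spec_ratio gamma w xi))).

(** Total rate of the time-reversed jumps minus that of the original ones. Under detailed balance
    each summand would vanish. *)
Definition excess D : conf d q -> R := fun w => \sum_(xi : pattern q D)
  (c (glue xi w) (restr D w) * spec_ratio gamma w xi - c w xi).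

Let cont_c D (xi : pattern q D) : continuous (fun w => c w xi).
Proof. exact: cont_rate. Qed.

Lemma cont_drift D : continuous (drift D).
Proof.
apply: cont_sum => xi _; apply: contB.
  by apply: (@cont_glue_restr R d q D _ (fun w xi => c w xi)) => zeta; exact: cont_c.
apply: contM; first exact: cont_c.
by apply: contD; [exact: contC|apply: cont_ln].
Qed.

Lemma cont_excess D : continuous (excess D).
Proof.
apply: cont_sum => xi _; apply: contB; last exact: cont_c.
apply: contM; last exact: cont_g.
by apply: (@cont_glue_restr R d q D _ (fun w xi => c w xi)) => zeta; exact: cont_c.
Qed.

(** [loss_drift] and [loss_gain] come from [loss_decomp] with k = 1, [loss_excess] and [loss_defect]
    from k the inverse ratio of [mu]. *)
Definition loss_drift D L : R := \sum_(eta : pattern q L) \sum_(xi : pattern q D)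
  (cavg c nu eta xi * (cp nu (jumped eta xi) - cp nu eta)
    - cavg c nu eta xi * cp nu eta * ln (cp_ratio mu L (rep eta) xi)).

Definition loss_gain D L : \bar R := (\sum_(eta : pattern q L) \sum_(xi : pattern q D)
  (cavg c nu eta xi)%:E * relgap (cp nu (jumped eta xi)) (cp nu eta))%E.

Definition loss_excess D L : R := \sum_(eta : pattern q L) \sum_(xi : pattern q D)
  cavg c nu eta xi * (cp nu (jumped eta xi) / cp_ratio mu L (rep eta) xi - cp nu eta).

Definition loss_defect D L : \bar R := (\sum_(eta : pattern q L) \sum_(xi : pattern q D)
  (cavg c nu eta xi)%:E *
    relgap (cp nu (jumped eta xi) / cp_ratio mu L (rep eta) xi)%R (cp nu eta))%E.

Lemma loss_driftE D L : (D `<=` L)%fset -> loss c nu mu D L = ((loss_drift D L)%:E - loss_gain D L)%E.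
Proof.
move=> DL; rewrite (@loss_decomp _ _ _ _ c_ge0 c_cont _ _ mu_gt0 _ _ (fun _ _ => 1)) //.
congr (_%:E - _)%E.
  by apply: eq_bigr => eta _; apply: eq_bigr => xi _; rewrite !mulr1.
by apply: eq_bigr => eta _; apply: eq_bigr => xi _; rewrite !mulr1.
Qed.

Lemma loss_excessE D L : (D `<=` L)%fset -> loss c nu mu D L = ((loss_excess D L)%:E - loss_defect D L)%E.
Proof.
move=> DL; have r0 (eta : pattern q L) (xi : pattern q D) : 0 < cp_ratio mu L (rep eta) xi.
  by rewrite divr_gt0.
rewrite (@loss_decomp _ _ _ _ c_ge0 c_cont _ _ mu_gt0 _ _
  (fun eta xi => (cp_ratio mu L (rep eta) xi)^-1)) //; last first.
  by move=> eta xi; rewrite invr_gt0.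
congr (_%:E - _)%E.
apply: eq_bigr => eta _; apply: eq_bigr => xi _.
by rewrite divff ?gt_eqF // ln1 mulr0 subr0.
Qed.

Lemma loss_defect_ge0 D L : (0 <= loss_defect D L)%E.
Proof.
apply: sume_ge0 => eta _; apply: sume_ge0 => xi _.
by rewrite mule_ge0 ?relgap_ge0 // lee_fin cavg_ge0.
Qed.

Lemma loss_drift_cvg D : loss_drift D L @[L --> totally] --> \int[nu]_w drift D w.
Proof.
have cln (xi : pattern q D) : continuous (fun w => 1 + ln (spec_ratio gamma w xi)).
  by apply: contD; [exact: contC|apply: cont_ln].
have uln : ucvg (fun L (eta : pattern q L) xi => 1 + ln (cp_ratio mu L (rep eta) xi))
    (fun w (xi : pattern q D) => 1 + ln (spec_ratio gamma w xi)).
  move=> e e0.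
    have r0 L (eta : pattern q L) (xi : pattern q D) : 0 < cp_ratio mu L (rep eta) xi.
    by rewrite divr_gt0.
  have := @ucvg_ln R d q D _ _ (@cont_g D) (@g_gt0 D) r0 (@cp_ratio_ucvg D) e e0.
  apply: filterS => L H eta xi.
  by rewrite [X in `|X|](_ : _ = ln (cp_ratio mu L (rep eta) xi) - ln (spec_ratio gamma (rep eta) xi));
    [exact: H|ring].
have h1 := @avg_swap_cvg R d q nu D (fun w xi => c w xi) _ (@cont_c D) (cavg_ucvg c_cont nu D).
have h2 := @avg_cvg R d q nu D _ _ _
  (ucvg_mul (@cont_c D) cln (cavg_ucvg c_cont nu D) uln).
have cM (xi : pattern q D) : continuous (fun w => c w xi * (1 + ln (spec_ratio gamma w xi))).
  by apply: contM; [exact: cont_c|exact: cln].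
have := cvgB h1 (h2 cM).
rewrite -ExpB; last 2 first.
- apply: cont_sum => xi _.
  by apply: (@cont_glue_restr R d q D _ (fun w xi => c w xi)) => zeta; exact: cont_c.
- by apply: cont_sum => xi _; exact: cM.
have -> : \int[nu]_w drift D w = \int[nu]_w
   (\sum_(xi : pattern q D) c (glue xi w) (restr D w) -
    \sum_(xi : pattern q D) c w xi * (1 + ln (spec_ratio gamma w xi))).
  by apply: eq_Rintegral => w _; rewrite -sumrB.
move=> /(_ (@totally_filter (site d))); apply: cvg_trans; apply: near_eq_cvg; apply: nearW => L.
rewrite fctE /= -sumrB /loss_drift; apply: eq_bigr => eta _; rewrite -sumrB; apply: eq_bigr => xi _.
by rewrite /jumped; ring.
Qed.

Lemma loss_excess_cvg D : loss_excess D L @[L --> totally] --> \int[nu]_w excess D w.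
Proof.
have ciN (xi : pattern q D) : continuous (fun w => (spec_ratio gamma w xi)^-1).
  by apply: contV; [move=> w; rewrite gt_eqF|exact: cont_g].
have cM (xi : pattern q D) : continuous (fun w => c w xi * (spec_ratio gamma w xi)^-1).
  by apply: contM; [exact: cont_c|exact: ciN].
have h1 := @avg_swap_cvg R d q nu D _ _ cM
  (ucvg_mul (@cont_c D) ciN (cavg_ucvg c_cont nu D) (ucvg_inv (@cont_g D) (@g_gt0 D) (@cp_ratio_ucvg D))).
have h2 := @avg_cvg R d q nu D _ _ (@cont_c D) (cavg_ucvg c_cont nu D).
have := cvgB h1 h2.
rewrite -ExpB; last 2 first.
- apply: cont_sum => xi _.
  exact: (@cont_glue_restr R d q D _ (fun w xi => c w xi * (spec_ratio gamma w xi)^-1)).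
- by apply: cont_sum => xi _; exact: cont_c.
have -> : \int[nu]_w (\sum_(xi : pattern q D) c (glue xi w) (restr D w) *
      (spec_ratio gamma (glue xi w) (restr D w))^-1 - \sum_(xi : pattern q D) c w xi) =
    \int[nu]_w excess D w.
  apply: eq_Rintegral => w _; rewrite -sumrB; apply: eq_bigr => xi _.
  by rewrite /spec_ratio glueK invf_div.
move=> /(_ (@totally_filter (site d))); apply: cvg_trans; apply: near_eq_cvg; apply: nearW => L.
rewrite fctE /= -sumrB /loss_excess; apply: eq_bigr => eta _; rewrite -sumrB; apply: eq_bigr => xi _.
by rewrite /jumped; ring.
Qed.

End local_limits.

(** * Monotonicity and convergence of the gain *)

Section dissipation.
Context {R : realType} {d q : nat}.
Variable c : rates R d q.
Hypothesis c_ge0 : rates_nonneg c.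
Hypothesis c_cont : rates_continuous c.
Hypothesis c_low : rates_bounded_below c.
Implicit Types (D L : {fset site d}) (w : conf d q) (nu : probability (conf d q) R).

Lemma rate_lower : exists2 c0 : R, 0 < c0 &
  forall D w (xi : pattern q D), 0 < c w xi -> c0 <= c w xi.
Proof.
move: c_low; rewrite /rates_bounded_below; set S := (X in ereal_inf X).
have Sc D w (xi : pattern q D) : 0 < c w xi -> S (c w xi)%:E.
  by move=> c0; exists (c w xi) => //=; split => //; exists D, w, xi.
case E : (ereal_inf S) => [r| |] // r0.
  exists r => // D w xi /Sc h; rewrite -lee_fin -E.
  exact: ereal_inf_lbound.
(* The infimum is +oo, so no rate is positive and any constant will do. *)
exists 1 => // D w xi /Sc h; have := ereal_inf_lbound h.
by rewrite E leye_eq.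
Qed.

(** Unlike [cavg], the minimal rate does not depend on [nu] and can only grow when the cylinder
    shrinks. Monotonicity of the gain uses the second property, semicontinuity the first. *)
Definition cmin D L (eta : pattern q L) (xi : pattern q D) : R :=
  inf [set c w xi | w in cyl eta].

Lemma cmin_ge D L (eta : pattern q L) (xi : pattern q D) (a : R) :
  (forall w, restr L w = eta -> a <= c w xi) -> a <= cmin eta xi.
Proof.
move=> H; apply: lb_le_inf; first by exists (c (rep eta) xi); exists (rep eta) => //; exact: restr_rep.
by move=> _ [w ew <-]; exact: H.
Qed.

Lemma cmin_ge0 D L (eta : pattern q L) (xi : pattern q D) : 0 <= cmin eta xi.
Proof. by apply: cmin_ge => w _; exact: c_ge0. Qed.

Lemma cmin_le D L (xi : pattern q D) w : cmin (restr L w) xi <= c w xi.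
Proof.
apply: ge_inf; last by exists w.
by exists 0 => _ [w' _ <-]; exact: c_ge0.
Qed.

Lemma cmin_le_cavg nu D L (eta : pattern q L) (xi : pattern q D) :
  cmin eta xi <= cavg c nu eta xi.
Proof.
have [C C0 HC] := continuous_bounded (@c_cont D xi).
suff /andP[] : cmin eta xi <= cavg c nu eta xi <= C by [].
apply: cavg_bounds => // w <-.
by rewrite cmin_le (le_trans (ler_norm _)).
Qed.

Lemma cavg_le_cmin D (e : R) : 0 < e -> \forall L \near totally,
  forall nu (eta : pattern q L) (xi : pattern q D),
    cavg c nu eta xi <= (1 + e) * cmin eta xi.
Proof.
move=> e0; have [c0 c00 Hc0] := rate_lower.
(* The bound c0 / 2 makes a rate that vanishes somewhere on a cylinder vanish on all of it, since
   positive rates are at least c0; the bound e * c0 turns the absolute error into a relative one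
   elsewhere. *)
pose f := Num.min (c0 / 2) (e * c0).
have f0 : 0 < f by rewrite lt_min divr_gt0 // mulr_gt0.
have : \forall L \near totally, forall (xi : pattern q D) w w',
    restr L w = restr L w' -> `|c w xi - c w' xi| <= f.
  by apply: filter_forall => xi; apply: continuous_unif => //; exact: c_cont.
apply: filterS => L HL nu eta xi.
have e1 : 0 < 1 + e by rewrite addr_gt0.
rewrite mulrC -ler_pdivrMr //; apply: cmin_ge => w ew.
rewrite ler_pdivrMr //.
have Hw w' : restr L w' = eta -> c w' xi <= c w xi + f.
  move=> ew'; have := HL xi w' w; rewrite ew ew' => /(_ erefl).
  by rewrite ler_distl => /andP[_].
suff /andP[] : 0 <= cavg c nu eta xi <= c w xi * (1 + e) by [].
apply: cavg_bounds => // w' ew'; rewrite c_ge0 /=.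
have {Hw}h := Hw w' ew'.
have := c_ge0 w xi; rewrite le_eqVlt => /predU1P[cw|cw].
  rewrite -cw mul0r; rewrite -cw add0r in h.
  have := c_ge0 w' xi; rewrite le_eqVlt => /predU1P[<-//|/Hc0 h'].
  have : c0 <= c0 / 2 by rewrite (le_trans h') // (le_trans h) // ge_min lexx.
  by lra.
rewrite mulrDr mulr1 (le_trans h) // lerD2l /f ge_min; apply/orP; right.
by rewrite mulrC ler_wpM2r ?(ltW e0) // Hc0.
Qed.

Definition gain_min nu D L : \bar R := (\sum_(eta : pattern q L) \sum_(xi : pattern q D)
  (cmin eta xi)%:E * relgap (cp nu (jumped eta xi)) (cp nu eta))%E.

Definition gain_lim nu D : \bar R :=
  ereal_sup [set gain_min nu D L | L in [set L | (D `<=` L)%fset]].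

Lemma gain_min_ge0 nu D L : (0 <= gain_min nu D L)%E.
Proof.
apply: sume_ge0 => eta _; apply: sume_ge0 => xi _.
by rewrite mule_ge0 ?relgap_ge0 // lee_fin cmin_ge0.
Qed.

(** The jump acts inside L, so it maps the extensions of eta to L' bijectively onto those of
    [jumped eta xi]; the inverse jump restores the pattern of eta on D. *)
Lemma cp_jumped_fiber nu D L L' (eta : pattern q L) (xi : pattern q D) :
  (D `<=` L)%fset -> (L `<=` L')%fset ->
  cp nu (jumped eta xi) =
  \sum_(zeta : pattern q L' | restr L (rep zeta) == eta) cp nu (jumped zeta xi).
Proof.
move=> DL LL'; rewrite {1}/jumped (cp_fiber nu _ LL').
pose h (zeta : pattern q L') := jumped zeta xi.
pose h' (zeta : pattern q L') := jumped zeta (restr D (rep eta)).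
have DL' := fsubset_trans DL LL'.
have hh (zeta : pattern q L') (xi' xi'' : pattern q D) : restr D (rep zeta) = xi' ->
    jumped (jumped zeta xi'' : pattern q L') xi' = zeta.
  by move=> <-; rewrite /jumped restr_glue_rep glueK restr_rep.
rewrite (reindex_onto h h') => [|zeta /eqP hz]; last first.
  apply: hh; have := congr1 (fun z => restr D (rep z)) hz.
  by rewrite restr_glueT // restr_rep_sub.
apply: eq_bigl => zeta; rewrite /h /h' {1}/jumped restr_rep_sub //.
apply/andP/eqP => [[/eqP h1 /eqP h2]|h1].
  rewrite -h2 /jumped restr_rep_sub //; apply/eqP.
  have -> : restr L (glue (restr D (rep eta)) (rep (restr L' (glue xi (rep zeta))))) =
    restr L (glue (restr D (rep eta)) (rep (restr L (glue xi (rep zeta))))).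
    by apply: restr_glue_eq; rewrite restr_rep restr_rep_sub.
  by rewrite h1 restr_glue_rep glueK restr_rep.
split; last first.
  by apply/eqP; apply: hh; rewrite -h1 restr_rep_sub.
by apply/eqP; apply: restr_glue_eq; rewrite h1 restr_rep.
Qed.

Lemma gain_min_mono nu D L L' : (D `<=` L)%fset -> (L `<=` L')%fset ->
  (gain_min nu D L <= gain_min nu D L')%E.
Proof.
move=> DL LL'; rewrite /gain_min exchange_big [leRHS]exchange_big; apply: lee_sum => xi _ /=.
rewrite [leRHS](partition_big (fun zeta => restr L (rep zeta)) xpredT) //=.
apply: lee_sum => eta _.
rewrite (cp_jumped_fiber nu eta xi DL LL') (cp_fiber nu eta LL').
apply: le_trans (lee_wpmul2l _ (relgap_sum _ _ _)) _; first by rewrite lee_fin cmin_ge0.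
rewrite ge0_sume_distrr; last by move=> *; exact: relgap_ge0.
apply: lee_sum => zeta /eqP <-; apply: lee_wpmul2r; first exact: relgap_ge0.
rewrite lee_fin; apply: cmin_ge => w <-.
by rewrite restr_rep_sub // cmin_le.
Qed.

(** The gain lies between [gain_min], which increases to its supremum, and eventually (1 + e) times
    it. *)
Lemma loss_gain_cvg nu D : loss_gain c nu D L @[L --> totally] --> gain_lim nu D.
Proof.
have K0 : (0 <= gain_lim nu D)%E.
  apply: le_trans (gain_min_ge0 nu D D) _.
  by apply: ereal_sup_ubound; exists D => //=; exact: fsubset_refl.
apply/ecvgP; split => a.
  move=> /ereal_sup_gt[_ [L0 /= DL0 <-] aL0].
  exists L0 => // L /= L0L; apply: lt_le_trans aL0 _.
  apply: le_trans (gain_min_mono nu DL0 L0L) _.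
  apply: lee_sum => eta _; apply: lee_sum => xi _.
  by apply: lee_wpmul2r; rewrite ?relgap_ge0 // lee_fin cmin_le_cavg.
case E : (gain_lim nu D) K0 => [k| |] // k0 ka; rewrite lee_fin in k0; rewrite lte_fin in ka.
(* Chosen so that (1 + e) * k < a; the denominator is k + 1 because k may be 0. *)
have e0 : 0 < (a - k) / 2 / (k + 1) by rewrite !divr_gt0 ?subr_gt0 // ltr_wpDl.
have near_sub : \forall L \near totally, (D `<=` L)%fset by exists D.
apply: filterS2 near_sub (cavg_le_cmin D e0) => L DL HL.
set e := (X in 1 + X) in HL.
apply: (@le_lt_trans _ _ ((1 + e)%:E * gain_min nu D L)%E).
  have e1 : (0 <= (1 + e)%:E)%E by rewrite lee_fin addr_ge0 // ltW.
  rewrite /gain_min ge0_sume_distrr; last first.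
    move=> eta _; apply: sume_ge0 => xi _.
    by rewrite mule_ge0 ?relgap_ge0 // lee_fin cmin_ge0.
  apply: lee_sum => eta _; rewrite ge0_sume_distrr; last first.
    by move=> xi _; rewrite mule_ge0 ?relgap_ge0 // lee_fin cmin_ge0.
  apply: lee_sum => xi _; rewrite muleA; apply: lee_wpmul2r; first exact: relgap_ge0.
  by rewrite -EFinM lee_fin HL.
apply: (@le_lt_trans _ _ ((1 + e)%:E * k%:E)%E).
  apply: lee_wpmul2l; first by rewrite lee_fin addr_ge0 // ltW.
  by rewrite -E; apply: ereal_sup_ubound; exists L.
rewrite -EFinM lte_fin mulrDl mul1r -ltrBrDl /e.
have -> : (a - k) / 2 / (k + 1) * k = (a - k) * (k / (2 * (k + 1))).
  by field; rewrite gt_eqF // ltr_wpDl.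
rewrite gtr_pMr ?subr_gt0 // ltr_pdivrMr ?mulr_gt0 ?ltr_wpDl // mul1r.
by lra.
Qed.

End dissipation.

(** * Translation invariance *)

Section translation.
Context {R : realType} {d q : nat}.
Implicit Types (D L : {fset site d}) (w : conf d q) (nu : probability (conf d q) R).

Lemma cp_tau nu x L w : translation_invariant nu ->
  cp nu (restr (translate x L) (tau x w)) = cp nu (restr L w).
Proof.
move=> inv_nu; rewrite /cp -(inv_nu x); last exact: measurable_cyl.
congr (fine (nu _)); apply/seteqP; split => w'; first by move/restr_tau.
by move=> h; apply/restr_tau.
Qed.

Lemma Exp_tau nu x (f : conf d q -> R) : translation_invariant nu -> continuous f ->
  \int[nu]_w f (tau x w) = \int[nu]_w f w.
Proof.
move=> inv_nu cf; have cft := @cont_tau R d q x f cf.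
apply/eqP; rewrite -subr_eq0 -normr_le0; apply/ler_addgt0Pr => e e0; rewrite add0r.
have e30 : 0 < e / 3 by rewrite divr_gt0.
have [L _ /(_ L (fsubset_refl L)) HL] := continuous_unif cft e30.
have HL' w w' : restr (translate x L) w = restr (translate x L) w' -> `|f w - f w'| <= e / 3.
  by rewrite -(tauVK x w) -(tauVK x w') => /restr_tau; exact: HL.
have h1 := Exp_riem nu cft HL; have h2 := Exp_riem nu cf HL'.
rewrite pattern_sum_translate in h2.
set S1 := (X in `|_ - X|) in h1; set S2 := (X in `|_ - X|) in h2.
have h3 : `|S1 - S2| <= e / 3.
  rewrite /S1 /S2 -sumrB (le_trans (ler_norm_sum _ _ _)) //.
  apply: (@le_trans _ _ (\sum_(eta : pattern q L) (e / 3) * cp nu eta)); last first.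
    by rewrite -mulr_sumr cp_sum1 mulr1.
  apply: ler_sum => eta _; rewrite cp_tau // restr_rep -mulrBl normrM.
  rewrite (ger0_norm (cp_ge0 _ _)) ler_wpM2r ?cp_ge0 //.
  by apply: HL'; rewrite restr_rep.
rewrite (le_trans (ler_distD S1 _ _)) // (_ : e = e / 3 + (e / 3 + e / 3)); last by field.
rewrite lerD // (le_trans (ler_distD S2 _ _)) // lerD //.
by rewrite distrC.
Qed.

Lemma totally_translate x : translate x @ totally --> (@totally (site d)).
Proof.
move=> A [B _ BA]; exists (translate (- x) B) => // L /= BL.
by apply: BA; rewrite /= -(translateVK x B) translate_sub.
Qed.

Variable c : rates R d q.
Hypothesis c_ge0 : rates_nonneg c.
Hypothesis c_cont : rates_continuous c.
Hypothesis c_ti : rates_translation_invariant c.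

Lemma loss_translate nu mu x D L :
  translation_invariant nu -> translation_invariant mu ->
  loss c nu mu (translate x D) (translate x L) = loss c nu mu D L.
Proof.
move=> inv_nu inv_mu; rewrite /loss pattern_sum_translate; apply: eq_bigr => eta _.
rewrite pattern_sum_translate; apply: eq_bigr => xi _.
set teta := restr (translate x L) _; set txi := restr (translate x D) _.
have cyl_t w : \1_(cyl teta) (tau x w) = \1_(cyl eta) w :> R.
  rewrite !cyl_indic; congr (nat_of_bool _)%:R; apply/eqP/eqP => [/restr_tau|we].
    by rewrite restr_rep.
  by apply/restr_tau; rewrite restr_rep.
have ct : continuous (fun w => c w txi * (\1_(cyl teta) (glue txi w) - \1_(cyl teta) w)).
  apply: contM; first exact: c_cont.
  apply: contB; last exact: continuous_indic.
  by apply: cont_glue; exact: continuous_indic.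
rewrite -(Exp_tau x inv_nu ct); congr (_%:E * _)%E.
  apply: eq_Rintegral => w _; rewrite glue_tau restr_rep !cyl_t.
  by rewrite /txi c_ti restr_rep.
rewrite /log_ratio; congr (lne (_ / _)%:E).
  by have := cp_tau x L (rep eta) inv_nu; rewrite restr_rep.
by have := cp_tau x L (rep eta) inv_mu; rewrite restr_rep.
Qed.

End translation.

(** * Limit loss and limit defect of one update set *)

Section limits.
Context {R : realType} {d q : nat}.
Variable c : rates R d q.
Hypothesis c_ge0 : rates_nonneg c.
Hypothesis c_cont : rates_continuous c.
Hypothesis c_low : rates_bounded_below c.
Hypothesis c_ti : rates_translation_invariant c.
Variable gamma : {fset site d} -> R.-pker conf d q ~> conf d q.
Hypothesis gamma_spec : specification gamma.
Hypothesis gamma_ql : quasilocal gamma.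
Hypothesis gamma_nn : nonnull gamma.
Hypothesis gamma_ti : spec_translation_invariant gamma.
Variable mu : probability (conf d q) R.
Hypothesis mu_gibbs : gibbs gamma mu.
Implicit Types (D L : {fset site d}) (w : conf d q) (nu : probability (conf d q) R).

Definition loss_lim nu D : \bar R := ((\int[nu]_w drift c gamma D w)%:E - gain_lim c nu D)%E.

(** Defined as a difference: [loss_defect] is not monotone in L, and its convergence is deduced from
    that of the loss and of the excess. *)
Definition defect_lim nu D : \bar R := ((\int[nu]_w excess c gamma D w)%:E - loss_lim nu D)%E.

Lemma gain_lim_ge0 nu D : (0 <= gain_lim c nu D)%E.
Proof.
apply: le_trans (gain_min_ge0 c_ge0 nu D D) _.
by apply: ereal_sup_ubound; exists D => //=; exact: fsubset_refl.
Qed.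

Lemma loss_lim_lty nu D : (loss_lim nu D < +oo)%E.
Proof.
rewrite /loss_lim; have := gain_lim_ge0 nu D; case: (gain_lim c nu D) => [k| |] // _.
by rewrite -EFinB ltry.
Qed.

Lemma loss_cvg nu D : loss c nu mu D L @[L --> totally] --> loss_lim nu D.
Proof.
have near_sub : \forall L \near totally, (D `<=` L)%fset by exists D.
have h1 : (loss_drift c mu nu D L)%:E @[L --> totally] --> (\int[nu]_w drift c gamma D w)%:E.
  by apply/fine_cvgP; split; [by apply: nearW|exact: (loss_drift_cvg c_cont gamma_spec gamma_ql gamma_nn gamma_ti mu_gibbs)].
have h2 := @loss_gain_cvg R d q c c_ge0 c_cont c_low nu D.
have ad : ((\int[nu]_w drift c gamma D w)%:E +? - gain_lim c nu D)%E by [].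
have /(_ (@totally_filter (site d))) := cvgeB ad h1 h2; apply: cvg_trans; apply: near_eq_cvg.
apply: filterS near_sub => L DL.
by rewrite (loss_driftE c_ge0 c_cont gamma_spec gamma_ql gamma_nn gamma_ti mu_gibbs).
Qed.

Lemma loss_defect_cvg nu D : loss_defect c mu nu D L @[L --> totally] --> defect_lim nu D.
Proof.
have near_sub : \forall L \near totally, (D `<=` L)%fset by exists D.
have h1 : (loss_excess c mu nu D L)%:E @[L --> totally] --> (\int[nu]_w excess c gamma D w)%:E.
  by apply/fine_cvgP; split; [by apply: nearW|exact: (loss_excess_cvg c_cont gamma_spec gamma_ql gamma_nn gamma_ti mu_gibbs)].
have ad : ((\int[nu]_w excess c gamma D w)%:E +? - loss_lim nu D)%E by [].
have /(_ (@totally_filter (site d))) := cvgeB ad h1 (@loss_cvg nu D); apply: cvg_trans; apply: near_eq_cvg.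
apply: filterS near_sub => L DL.
rewrite (loss_excessE c_ge0 c_cont gamma_spec gamma_ql gamma_nn gamma_ti mu_gibbs) //.
have := loss_defect_ge0 c_ge0 c_cont mu nu D L; case: (loss_defect _ _ _ _ _) => [s| |] // _.
by rewrite -!EFinB opprB addrC subrK.
Qed.

Lemma defect_lim_ge0 nu D : (0 <= defect_lim nu D)%E.
Proof.
have [_ H] := (ecvgP _ _).1 (@loss_defect_cvg nu D).
rewrite leNgt; apply/negP => s0.
have [b sb b0] : exists2 b : R, (defect_lim nu D < b%:E)%E & b < 0.
  case: (defect_lim nu D) s0 => [s| |] //; last by exists (-1); rewrite ?ltNyr.
  by rewrite lte_fin => s0; exists (s / 2); rewrite ?lte_fin; lra.
have [L hL] := filter_ex (H b sb).
have := loss_defect_ge0 c_ge0 c_cont mu nu D L; rewrite leNgt => /negP; apply.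
by rewrite (lt_trans hL) // lte_fin.
Qed.

(** The sets [translate x L] still run through all large sets, and along them the loss of the
    translated update set is that of D. *)
Lemma loss_lim_translate nu x D : translation_invariant nu -> translation_invariant mu ->
  loss_lim nu (translate x D) = loss_lim nu D.
Proof.
move=> inv_nu inv_mu.
have h1 : loss c nu mu D L @[L --> totally] --> loss_lim nu (translate x D).
  have := cvg_comp _ _ (@totally_translate d x) (@loss_cvg nu (translate x D)).
  apply: cvg_trans; apply: near_eq_cvg; apply: nearW => L /=.
  by rewrite loss_translate.
by apply: (cvg_unique _ h1 (@loss_cvg nu D)); exact: ereal_hausdorff.
Qed.

Lemma excess_tau x D w : excess c gamma (translate x D) (tau x w) = excess c gamma D w.
Proof.
rewrite /excess pattern_sum_translate; apply: eq_bigr => xi _.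
by rewrite glue_tau spec_ratio_tau // !c_ti !restr_rep.
Qed.

Lemma cont_excess_gibbs D : continuous (excess c gamma D).
Proof. exact: (cont_excess c_cont gamma_spec gamma_ql gamma_nn gamma_ti). Qed.

Lemma Exp_excess_translate nu x D : translation_invariant nu ->
  \int[nu]_w excess c gamma (translate x D) w = \int[nu]_w excess c gamma D w.
Proof.
move=> inv_nu; rewrite -(Exp_tau x inv_nu (@cont_excess_gibbs _)).
by apply: eq_Rintegral => w _; rewrite excess_tau.
Qed.

Lemma defect_lim_translate nu x D : translation_invariant nu -> translation_invariant mu ->
  defect_lim nu (translate x D) = defect_lim nu D.
Proof. by move=> inv_nu inv_mu; rewrite /defect_lim loss_lim_translate // Exp_excess_translate. Qed.

End limits.

(** * Averaging over boxes *)

Section boxes.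
Context {d : nat}.
Implicit Types (D L : {fset site d}) (x : site d) (k r n : nat).

Lemma boxP k x : reflect (forall i, (`|x 0%R i| <= k)%N) (x \in box d k).
Proof.
rewrite mem_box; apply: (iffP forallP) => h i; first by have /andP[] := h i; lia.
by have := h i; move=> ?; apply/andP; split; lia.
Qed.

Lemma card_box k : #|` box d k| = ((2 * k).+1 ^ d)%N.
Proof.
pose f (z : {ffun 'I_d -> 'I_(2 * k).+1}) : site d :=
  \row_i ((nat_of_ord (z i))%:Z - k%:Z).
have f_inj : injective f.
  move=> z z' /rowP h; apply/ffunP => i; apply: val_inj.
  by have := h i; rewrite !mxE /=; lia.
have -> : box d k = [fset f z | z : {ffun 'I_d -> 'I_(2 * k).+1}]%fset.
  apply/fsetP => x; apply/boxP/imfsetP => [h|[z _ ->] i]; last first.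
    by rewrite mxE; have := ltn_ord (z i); move: (nat_of_ord (z i)) => m; lia.
  exists [ffun i => inord `|(x 0 i + k%:Z)%R|%N] => //=.
  apply/rowP => i; rewrite mxE ffunE inordK; have := h i; lia.
by rewrite card_imfset //= -cardE card_ffun !card_ord.
Qed.

Lemma box_sub k k' : (k <= k')%N -> (box d k `<=` box d k')%fset.
Proof.
move=> kk'; apply/fsubsetP => x /boxP h; apply/boxP => i.
by have := h i; lia.
Qed.

Lemma box_exhaust L : exists k, (L `<=` box d k)%fset.
Proof.
exists (\max_(x : L) \max_(i < d) `|(val x) 0%R i|)%N.
apply/fsubsetP => x xL; apply/boxP => i.
have h1 : (`|x 0%R i| <= \max_(i < d) `|x 0%R i|)%N by exact: (leq_bigmax (F := fun i => `|x 0%R i|%N)).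
have h2 := @leq_bigmax _ (fun y : L => \max_(i < d) `|(val y) 0%R i|)%N [` xL]%fset.
exact: leq_trans h1 h2.
Qed.

Lemma box_translate k r x : x \in box d k ->
  (translate x (box d r) `<=` box d (k + r))%fset.
Proof.
move=> /boxP hx; apply/fsubsetP => y; rewrite in_translate => /boxP hy.
apply/boxP => i; have := hx i; have := hy i; rewrite !mxE.
by move: (y 0 i) (x 0 i) => a b; lia.
Qed.

Lemma box_translateN k r x : x \in box d k ->
  (box d r `<=` translate (- x) (box d (k + r)))%fset.
Proof.
move=> xk; rewrite -(translateK x (box d r)) translate_sub.
exact: box_translate.
Qed.

Lemma ltn_expn n : (n < 2 ^ n)%N. Proof. exact: ltn_expl. Qed.

Lemma Lam_tilde_sub n : (@Lam_tilde d n `<=` @Lam d n)%fset.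
Proof. by apply: box_sub; lia. Qed.

(** This is where the margin n is used: seen from any site of the smaller box, the larger one
    contains a ball of radius n, so limits along [totally] become uniform in the site. *)
Lemma Lam_translate n x : x \in @Lam_tilde d n -> (box d n `<=` translate (- x) (@Lam d n))%fset.
Proof.
move=> xn; have -> : @Lam d n = box d (2 ^ n - n - 1 + n).
  by rewrite /Lam; congr box; have := ltn_expn n; lia.
exact: box_translateN.
Qed.

Definition inner n D : {fset site d} :=
  [fset x in @Lam d n | (translate x D `<=` @Lam_tilde d n)%fset]%fset.

Lemma inner_sub n D : (inner n D `<=` @Lam d n)%fset.
Proof. exact: fset_sub. Qed.

Lemma inner_Lam_tilde n D x : 0 \in D -> x \in inner n D -> x \in @Lam_tilde d n.
Proof.
move=> D0; rewrite !inE => /andP[_ /fsubsetP h].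
by apply: h; rewrite in_translate subrr.
Qed.

Lemma card_inner_le n D : (#|` inner n D| <= #|` @Lam d n|)%N.
Proof. exact/fsubset_leq_card/inner_sub. Qed.

Lemma inner_box n D r : (D `<=` box d r)%fset -> (r <= 2 ^ n - n - 1)%N ->
  (box d (2 ^ n - n - 1 - r) `<=` inner n D)%fset.
Proof.
move=> Dr rn; apply/fsubsetP => x xb; rewrite !inE /=; apply/andP; split.
  by move: xb; apply/fsubsetP/box_sub; lia.
have := box_translate r xb; rewrite subnK //; apply: fsubset_trans.
by rewrite translate_sub.
Qed.

End boxes.

Section averaging.
Context {R : realType} {d : nat}.
Implicit Types (D L : {fset site d}) (x : site d) (k r n : nat).

Lemma card_Lam_gt0 n : 0 < #|` @Lam d n|%:R :> R.
Proof. by rewrite ltr0n card_box expn_gt0. Qed.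

Lemma bernoulli (t : R) n : 0 <= t <= 1 -> 1 - n%:R * t <= (1 - t) ^+ n.
Proof.
move=> /andP[t0 t1]; elim: n => [|n IH]; first by rewrite mul0r subr0 expr0.
rewrite exprS; have := ler_wpM2l (_ : 0 <= 1 - t) IH; rewrite subr_ge0 => /(_ t1).
apply: le_trans; rewrite -natr1.
have : 0 <= n%:R * t * t by rewrite !mulr_ge0.
by lra.
Qed.

Lemma sqr_le_expn n : (n ^ 2 <= 2 * 2 ^ n)%N.
Proof.
elim: n => // n IH; rewrite [(2 ^ n.+1)%N]expnS.
have := ltn_expn n; move: IH; rewrite -!mulnn; nia.
Qed.

Lemma card_inner_cvg D :
  (#|` inner n D|%:R / #|` @Lam d n|%:R : R) @[n --> \oo] --> (1 : R).
Proof.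
have [r Dr] := box_exhaust D.
apply/cvgrPdist_le => e e0.
(* In one dimension the proportion t of lost sites is at most 8 / n, because n^2 <= 2 * 2^n;
   Bernoulli's inequality then bounds the loss in dimension d by 8 d / n. *)
have [N hN] : exists N, 8 * d%:R / e < N%:R :> R.
  by exists (Num.bound (8 * d%:R / e : R)); rewrite archi_boundP // divr_ge0 ?mulr_ge0 // ltW.
exists (maxn N (maxn r 8)) => // n /=; rewrite !geq_max => /and3P[nN nr n8].
have n0 : 0 < n%:R :> R by rewrite ltr0n; lia.
have b0 := card_Lam_gt0 n.
have sq := sqr_le_expn n.
have n2 : (2 * n + 1 <= 2 ^ n)%N.
  by move: sq; rewrite -mulnn; nia.
rewrite ger0_norm; last first.
  by rewrite subr_ge0 ler_pdivrMr // mul1r ler_nat card_inner_le.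
have bd : (2 * (2 ^ n - n - 1 - r)).+1%:R / (2 * (2 ^ n - 1)).+1%:R =
    1 - (2 * (n + r))%:R / (2 * (2 ^ n - 1)).+1%:R :> R.
  have B0 : (2 * (2 ^ n - 1)).+1%:R != 0 :> R by rewrite pnatr_eq0.
  apply: (mulIf B0); rewrite divfK // mulrBl mul1r divfK //.
  by rewrite -natrB; [congr (_%:R)|]; lia.
set t := (2 * (n + r))%:R / (2 * (2 ^ n - 1)).+1%:R in bd.
have t0 : 0 <= t by rewrite divr_ge0.
have t1 : t <= 1 by rewrite /t ler_pdivrMr ?ltr0n // mul1r ler_nat; lia.
have tn : t <= 8 / n%:R.
  rewrite /t ler_pdivrMr ?ltr0n // mulrAC ler_pdivlMr // -!natrM ler_nat.
  by move: sq; rewrite -mulnn; nia.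
have lb : 1 - d%:R * t <= #|` inner n D|%:R / #|` @Lam d n|%:R.
  have := bernoulli d (_ : 0 <= t <= 1); rewrite t0 t1 => /(_ isT) h; apply: le_trans h _.
  rewrite -bd expr_div_n -!natrX card_box ler_pM2r ?invr_gt0 ?ltr0n ?expn_gt0 //.
  rewrite ler_nat -card_box; apply/fsubset_leq_card/inner_box => //.
  by lia.
have : d%:R * t <= e.
  apply: (@le_trans _ _ (d%:R * (8 / n%:R))); first by rewrite ler_wpM2l.
  rewrite mulrA ler_pdivrMr // -ler_pdivrMl // mulrC (mulrC d%:R) .
  by rewrite (le_trans (ltW hN)) // ler_nat.
by lra.
Qed.

Lemma near_inner D (P : {fset site d} -> Prop) : 0 \in D ->
  (\forall L \near totally, P L) ->
  \forall n \near \oo, forall x, x \in inner n D -> P (translate (- x) (@Lam d n)).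
Proof.
move=> D0 [L0 _ HL0]; have [k L0k] := box_exhaust L0.
exists k => // n /= kn x /(inner_Lam_tilde D0)/Lam_translate h.
apply: HL0; apply: fsubset_trans L0k (fsubset_trans _ h).
exact: box_sub.
Qed.

(** All terms pass a given threshold at once by [near_inner], and the number of terms divided by the
    volume tends to one. *)
Lemma avg_inner_cvg D (f : {fset site d} -> \bar R) (l : \bar R) : 0 \in D ->
  f @ totally --> l ->
  ((#|` @Lam d n|%:R^-1)%:E * \sum_(x <- inner n D) f (translate (- x)%R (@Lam d n)))%E
    @[n --> \oo] --> l.
Proof.
move=> D0 /ecvgP[lf fl].
have sum_b n (b : R) :
   ((#|` @Lam d n|%:R^-1)%:E * \sum_(x <- inner n D) b%:E =
    ((#|` inner n D|%:R / #|` @Lam d n|%:R) * b)%:E)%E.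
  rewrite sumEFin -EFinM; congr EFin.
  rewrite big_const_seq count_predT iter_addr_0 -[b *+ _]mulr_natl.
  by rewrite mulrA [_^-1 * _]mulrC.
have L0 n : (0 <= (#|` @Lam d n|%:R^-1)%:E :> \bar R)%E by rewrite lee_fin invr_ge0.
have cvg_b (b : R) : ((#|` inner n D|%:R / #|` @Lam d n|%:R) * b) @[n --> \oo] --> b.
  rewrite -[X in _ --> X]mul1r; apply: cvgM; last exact: cvg_cst.
  exact: card_inner_cvg.
(* A real strictly between a and the limit leaves room for the volume ratio to differ from one. *)
have between (x y : \bar R) : (x < y)%E -> exists b : R, (x < b%:E /\ b%:E < y)%E.
  case: x y => [x| |] [y| |] //.
  - by rewrite lte_fin => xy; exists ((x + y) / 2); rewrite !lte_fin; lra.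
  - by move=> _; exists (x + 1); rewrite lte_fin ltry ltrDl.
  - by move=> _; exists (y - 1); rewrite lte_fin ltNyr ltrBlDr ltrDl.
  - by move=> _; exists 0; rewrite ltNyr ltry.
apply/ecvgP; split => a al.
  have [b [ab bl]] := between _ _ al; rewrite lte_fin in ab.
  have h1 := near_inner D0 (lf b bl).
  have h2 : \forall n \near \oo, a < (#|` inner n D|%:R / #|` @Lam d n|%:R) * b.
    exact: (cvgr_gt _ (cvg_b b)).
  apply: filterS2 h1 h2 => n h1 h2.
  apply: (@lt_le_trans _ _ ((#|` @Lam d n|%:R^-1)%:E * \sum_(x <- inner n D) b%:E)%E).
    by rewrite sum_b lte_fin.
  apply: lee_wpmul2l => //; rewrite big_seq [leRHS]big_seq; apply: lee_sum => x xi.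
  exact/ltW/h1.
have [b [lb ba]] := between _ _ al; rewrite lte_fin in ba.
have h1 := near_inner D0 (fl b lb).
have h2 : \forall n \near \oo, (#|` inner n D|%:R / #|` @Lam d n|%:R) * b < a.
  exact: (cvgr_lt _ (cvg_b b)).
apply: filterS2 h1 h2 => n h1 h2.
apply: (@le_lt_trans _ _ ((#|` @Lam d n|%:R^-1)%:E * \sum_(x <- inner n D) b%:E)%E).
  apply: lee_wpmul2l => //; rewrite big_seq [leRHS]big_seq; apply: lee_sum => x xi.
  exact/ltW/h1.
by rewrite sum_b lte_fin.
Qed.

End averaging.

(** * Sorting update sets by translation *)

Section bulk.
Context {R : realType} {d q : nat}.
Variable c : rates R d q.
Hypothesis c_fin : rates_finite_type c.
Hypothesis c_ti : rates_translation_invariant c.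
Implicit Types (D L : {fset site d}) (w : conf d q) (x : site d) (n : nat).

Definition active : {fset {fset site d}} :=
  fset_set [set D : {fset site d} | 0 \in D /\ (0 < rate_sup c D)%E].

Lemma active0 D : D \in active -> 0 \in D.
Proof. by rewrite in_fset_set // => /set_mem[]. Qed.

Lemma inactive_rate D : 0 \in D -> D \notin active -> forall w (xi : pattern q D), c w xi = 0.
Proof.
move=> D0 /negP nD w xi; apply/eqP; rewrite -normr_le0 -lee_fin leNgt; apply/negP => cw.
apply: nD; rewrite in_fset_set //; apply/mem_set; split => //.
apply: lt_le_trans cw _; apply: (@le_trans _ _ (supnorm (fun w => c w xi))).
  by apply: ereal_sup_ubound; exists w.
by apply: ereal_sup_ubound; exists xi.
Qed.

Lemma rate_eq0 D x : x \in D -> translate (- x) D \notin active ->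
  forall w (xi : pattern q D), c w xi = 0.
Proof.
move=> xD nD w xi; have := c_ti (- x) D w (rep xi); rewrite restr_rep => <-.
by apply: inactive_rate nD _ _; rewrite in_translate sub0r opprK.
Qed.

Lemma translates_sum (V : nmodType) (F : {fset site d} -> V) x L :
  (forall D, x \in D -> translate (- x) D \notin active -> F D = 0) ->
  \sum_(D <- fpowerset L | x \in D) F D =
  \sum_(D <- active | (translate x D `<=` L)%fset) F (translate x D).
Proof.
move=> F0; rewrite (bigID (fun D => translate (- x) D \in active)) /=.
rewrite [X in _ + X]big1 ?addr0; last by move=> D /andP[]; exact: F0.
rewrite -[RHS]big_filter -(big_map (translate x) xpredT F) -[LHS]big_filter.
apply: perm_big; apply: uniq_perm.
- exact/filter_uniq/fset_uniq.
- rewrite map_inj_uniq; first exact/filter_uniq/fset_uniq.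
  exact: can_inj (translateK x).
move=> D; rewrite mem_filter fpowersetE; apply/idP/mapP.
  move=> /andP[/andP[xD tD] DL]; exists (translate (- x) D); last by rewrite translateVK.
  by rewrite mem_filter tD translateVK DL.
move=> [D']; rewrite mem_filter => /andP[DL D'a] ->.
by rewrite DL translateK D'a in_translate subrr active0.
Qed.

(** The weight of D is X D divided by its cardinality; saying so without division covers real and
    extended real sums at once. *)
Lemma weighted_sum (V : nmodType) (X wt : {fset site d} -> V) L :
  (forall D, wt D *+ #|` D| = X D) ->
  \sum_(D <- fpowerset L) X D = \sum_(x <- L) \sum_(D <- fpowerset L | x \in D) wt D.
Proof.
move=> wX; under [RHS]eq_bigr do rewrite big_mkcond.
rewrite exchange_big big_seq [RHS]big_seq; apply: eq_bigr => D /=.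
rewrite fpowersetE => DL; rewrite -big_mkcond -wX big_const_seq.
have -> : count (fun x => x \in D) L = #|` D|.
  rewrite -size_filter; apply/perm_size/uniq_perm => [| |x].
  - exact/filter_uniq/fset_uniq.
  - exact: fset_uniq.
  by rewrite mem_filter andb_idr //; apply/fsubsetP: x.
by rewrite iter_addr_0.
Qed.

(** A contributing set D is a translate by x of an active set in one way for each of its sites x.
    The weights undo this multiplicity without a choice of representatives of the translation
    classes. *)
Lemma bulk_sum (V : nmodType) (X wt : {fset site d} -> V) n :
  (forall D, wt D *+ #|` D| = X D) ->
  (forall D x, x \in D -> translate (- x) D \notin active -> wt D = 0) ->
  \sum_(D <- fpowerset (Lam_tilde n)) X D =
  \sum_(D <- active) \sum_(x <- inner n D) wt (translate x D).
Proof.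
move=> wX w0; rewrite (weighted_sum _ wX).
under eq_bigr => x _ do rewrite (translates_sum _ (w0 ^~ x)) big_mkcond.
rewrite exchange_big big_seq [RHS]big_seq; apply: eq_bigr => D Da /=.
rewrite -big_mkcond -big_filter; apply/perm_big/uniq_perm.
- exact/filter_uniq/fset_uniq.
- exact: fset_uniq.
move=> x; rewrite mem_filter; apply/idP/idP => [/andP[xD xn]|xi].
  by rewrite !inE /= xD andbT (fsubsetP (Lam_tilde_sub n)).
rewrite (inner_Lam_tilde (active0 Da) xi) andbT.
by move: xi; rewrite !inE => /andP[].
Qed.

End bulk.

(** * Existence of the density as a limit *)

Section density.
Context {R : realType} {d q : nat}.
Variable c : rates R d q.
Hypothesis c_ge0 : rates_nonneg c.
Hypothesis c_cont : rates_continuous c.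
Hypothesis c_fin : rates_finite_type c.
Hypothesis c_low : rates_bounded_below c.
Hypothesis c_ti : rates_translation_invariant c.
Variable gamma : {fset site d} -> R.-pker conf d q ~> conf d q.
Hypothesis gamma_spec : specification gamma.
Hypothesis gamma_ql : quasilocal gamma.
Hypothesis gamma_nn : nonnull gamma.
Hypothesis gamma_ti : spec_translation_invariant gamma.
Variable mu : probability (conf d q) R.
Hypothesis mu_gibbs : gibbs gamma mu.
Hypothesis mu_inv : translation_invariant mu.
Implicit Types (D L : {fset site d}) (w : conf d q) (x : site d) (n : nat)
  (nu : probability (conf d q) R).

Definition wgt D : R := #|` D|%:R^-1.

Lemma entropy_loss_sum nu n :
  entropy_loss c nu mu n = (\sum_(D <- fpowerset (Lam_tilde n)) loss c nu mu D (Lam n))%E.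
Proof. by rewrite /entropy_loss exchange_big. Qed.

Lemma loss_rate0 nu D L : (forall w (xi : pattern q D), c w xi = 0) ->
  loss c nu mu D L = 0%E.
Proof.
move=> c0; rewrite /loss big1 // => eta _; rewrite big1 // => xi _.
under eq_Rintegral do rewrite c0 mul0r.
by rewrite Exp_cst mul0e.
Qed.

(** The empty set is reached from no site, so the weighted count misses it; its contribution has to
    vanish. *)
Lemma loss_fset0 nu L : loss c nu mu fset0 L = 0%E.
Proof.
rewrite /loss big1 // => eta _; rewrite big1 // => xi _.
have g w : glue xi w = w by apply/funext => y; rewrite glueE in_fset0.
under eq_Rintegral do rewrite g subrr mulr0.
by rewrite Exp_cst mul0e.
Qed.

Definition density nu : \bar R := (\sum_(D <- active c) (wgt D)%:E * loss_lim c gamma nu D)%E.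

(** Limits may be -oo; excluding +oo keeps every partial sum defined and is itself inherited by the
    sum. *)
Lemma cvg_sum_lty (I : Type) (r : seq I) (f : I -> nat -> \bar R) (l : I -> \bar R) :
  (forall i, f i n @[n --> \oo] --> l i) -> (forall i, l i < +oo)%E ->
  (\sum_(i <- r) f i n)%E @[n --> \oo] --> (\sum_(i <- r) l i)%E /\
  (\sum_(i <- r) l i < +oo)%E.
Proof.
move=> fl ly; elim: r => [|i r [IH1 IH2]].
  by under eq_fun do rewrite big_nil; rewrite big_nil; split => //; exact: cvg_cst.
under eq_fun do rewrite big_cons; rewrite big_cons; split.
  apply: cvgeD => //.
  by move: (ly i) IH2; case: (l i) (bigop _ _ _) => [a| |] [b| |].
by rewrite lte_add_pinfty.
Qed.

Lemma loss_lty nu D L : (D `<=` L)%fset -> (loss c nu mu D L < +oo)%E.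
Proof.
move=> DL; rewrite (loss_excessE c_ge0 c_cont gamma_spec gamma_ql gamma_nn gamma_ti mu_gibbs) //.
have := loss_defect_ge0 c_ge0 c_cont mu nu D L; case: (loss_defect _ _ _ _ _) => [s| |] // _.
by rewrite -EFinB ltry.
Qed.

Lemma wgt_lty nu D : ((wgt D)%:E * loss_lim c gamma nu D < +oo)%E.
Proof.
have := loss_lim_lty c_ge0 gamma nu D; case: (loss_lim _ _ _ _) => [r _| |_] //.
  by rewrite -EFinM ltry.
have : 0 <= wgt D by rewrite invr_ge0.
rewrite le_eqVlt => /predU1P[<-|w0]; first by rewrite mul0e.
by rewrite gt0_muleNy ?lte_fin.
Qed.

Lemma entropy_loss_cvg nu : translation_invariant nu ->
  entropy_loss_seq c nu mu @ \oo --> density nu.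
Proof.
move=> nu_inv; rewrite /entropy_loss_seq.
pose f D n := ((wgt D)%:E * ((#|` @Lam d n|%:R^-1)%:E *
  \sum_(x <- inner n D) loss c nu mu D (translate (- x)%R (Lam n))))%E.
have fl D : D \in active c -> f D n @[n --> \oo] --> ((wgt D)%:E * loss_lim c gamma nu D)%E.
  move=> Da; apply: cvgeZl => //; apply: avg_inner_cvg; first exact: (active0 c_fin).
  exact: (loss_cvg c_ge0 c_cont c_low gamma_spec gamma_ql gamma_nn gamma_ti mu_gibbs).
(* Extension by 0 off the active sets, since [cvg_sum_lty] asks for convergence at every index. *)
pose f' D := if D \in active c then f D else fun=> 0%E.
pose l' D := if D \in active c then ((wgt D)%:E * loss_lim c gamma nu D)%E else 0%E.
have fl' D : f' D n @[n --> \oo] --> l' D.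
  by rewrite /f' /l'; case: ifP => [/fl//|_]; exact: cvg_cst.
have ly' D : (l' D < +oo)%E by rewrite /l'; case: ifP => // _; exact: wgt_lty.
have [+ _] := cvg_sum_lty (active c) fl' ly'.
have -> : (\sum_(D <- active c) l' D = density nu)%E.
  by rewrite /density big_seq [RHS]big_seq; apply: eq_bigr => D Da; rewrite /l' Da.
apply: cvg_trans; apply: near_eq_cvg; apply: nearW => n.
pose wt D := ((wgt D)%:E * loss c nu mu D (Lam n))%E.
rewrite entropy_loss_sum (@bulk_sum _ _ _ _ c_fin _ _ wt); last 2 first.
- move=> D; have [->|D0] := eqVneq D fset0; first by rewrite cardfs0 mulr0n loss_fset0.
  rewrite /wt /wgt.
  have n0 : (0 < #|` D|)%N by rewrite cardfs_gt0.
  have nR : 0 < #|` D|%:R :> R by rewrite ltr0n.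
  have natE (y : \bar R) k : (y *+ k)%R = (k%:R%:E * y)%E.
    elim: k => [|k IH]; first by rewrite mulr0n mul0e.
    by rewrite mulrS IH -nat1r EFinD ge0_muleDl ?lee_fin // mul1e.
  by rewrite natE muleA -EFinM divff ?mul1e // gt_eqF.
- by move=> D x xD nD; rewrite /wt loss_rate0 ?mule0 //; exact: (rate_eq0 c_fin c_ti xD nD).
have lossE' D x : loss c nu mu (translate x D) (Lam n) =
    loss c nu mu D (translate (- x) (Lam n)).
  by rewrite -{1}(translateVK x (Lam n)) loss_translate.
have inD D x : x \in inner n D -> (D `<=` translate (- x) (Lam n))%fset.
  rewrite !inE /= => /andP[_ h]; rewrite -(translateK x D) translate_sub.
  exact: fsubset_trans h (Lam_tilde_sub n).
(* Distributivity in the extended reals; it holds because no term is +oo. *)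
have addable (I : eqType) (r : seq I) (P : I -> \bar R) : (forall i, i \in r -> P i < +oo)%E ->
    forall t : R, (t%:E * (\sum_(i <- r) P i) = \sum_(i <- r) t%:E * P i)%E.
  move=> Py t; rewrite big_seq [RHS]big_seq fin_num_sume_distrr // => i j.
  by move=> /Py + /Py; case: (P i) (P j) => [a| |] [b| |].
rewrite [RHS]addable; last first.
  move=> D Da; rewrite big_seq; elim/big_ind: _ => //; first by move=> a b *; rewrite lte_add_pinfty.
  move=> x xi; rewrite /wt lossE'; have := loss_lty nu (inD D x xi).
  case: (loss _ _ _ _ _) => [r _| |_] //; first by rewrite -EFinM ltry.
  have : 0 <= wgt (translate x D) by rewrite invr_ge0.
  rewrite le_eqVlt => /predU1P[<-|w0]; first by rewrite mul0e.
  by rewrite gt0_muleNy ?lte_fin.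
rewrite big_seq [RHS]big_seq; apply: eq_bigr => D Da; rewrite /f' Da /f muleCA; congr (_ * _)%E.
rewrite addable; last by move=> x xi; apply: loss_lty; exact: inD.
by apply: eq_bigr => x _; rewrite /wt lossE' /wgt card_translate.
Qed.

End density.

(** * Stationarity *)

Section stationarity.
Context {R : realType} {d q : nat}.
Variable c : rates R d q.
Variable P : R -> (conf d q -> R) -> conf d q -> R.
Hypothesis c_cont : rates_continuous c.
Hypothesis c_fin : rates_finite_type c.
Hypothesis c_ti : rates_translation_invariant c.
Hypothesis P_gen : generated_semigroup c P.
Variable gamma : {fset site d} -> R.-pker conf d q ~> conf d q.
Hypothesis gamma_spec : specification gamma.
Hypothesis gamma_ql : quasilocal gamma.
Hypothesis gamma_nn : nonnull gamma.
Hypothesis gamma_ti : spec_translation_invariant gamma.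
Variable mu : probability (conf d q) R.
Hypothesis mu_gibbs : gibbs gamma mu.
Hypothesis mu_stat : time_stationary P mu.
Implicit Types (D L : {fset site d}) (w : conf d q) (x : site d) (n : nat)
  (nu : probability (conf d q) R).

Let mu_gt0 L (eta : pattern q L) : 0 < cp mu eta.
Proof. exact: (cp_mu_gt0 gamma_spec gamma_ql gamma_nn gamma_ti mu_gibbs). Qed.

Let cont_g D (xi : pattern q D) : continuous (fun w => spec_ratio gamma w xi).
Proof. exact: (cont_spec_ratio gamma_spec gamma_ql gamma_nn gamma_ti). Qed.

Let g_gt0 D w (xi : pattern q D) : 0 < spec_ratio gamma w xi.
Proof. exact: (spec_ratio_gt0 gamma_spec gamma_ql gamma_nn gamma_ti). Qed.

(** Both integrals are limits of the same cylinder sums: the inverse ratio of [mu] turns the weight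
    after the jump into the weight before it. *)
Lemma gibbs_swap D (phi : conf d q -> pattern q D -> R) :
  (forall xi, continuous (phi^~ xi)) ->
  \int[mu]_w (\sum_(xi : pattern q D) phi w xi) =
  \int[mu]_w (\sum_(xi : pattern q D) phi (glue xi w) (restr D w) * spec_ratio gamma w xi).
Proof.
move=> cphi.
have uphi : ucvg (fun L (eta : pattern q L) xi => phi (rep eta) xi) phi.
  by move=> e e0; apply: nearW => L eta xi; rewrite subrr normr0 ltW.
have ciN (xi : pattern q D) : continuous (fun w => (spec_ratio gamma w xi)^-1).
  by apply: contV; [move=> w; rewrite gt_eqF|exact: cont_g].
have cM (xi : pattern q D) : continuous (fun w => phi w xi * (spec_ratio gamma w xi)^-1).
  by apply: contM; [exact: cphi|exact: ciN].
have h1 := @avg_cvg R d q mu D _ _ cphi uphi.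
have h2 := @avg_swap_cvg R d q mu D _ _ cM (ucvg_mul cphi ciN uphi
  (ucvg_inv (@cont_g D) (@g_gt0 D)
    (@cp_ratio_ucvg R d q gamma gamma_spec gamma_ql gamma_nn gamma_ti mu mu_gibbs D))).
have <- : \int[mu]_w (\sum_(xi : pattern q D) phi (glue xi w) (restr D w) *
      (spec_ratio gamma (glue xi w) (restr D w))^-1) =
    \int[mu]_w (\sum_(xi : pattern q D) phi (glue xi w) (restr D w) * spec_ratio gamma w xi).
  apply: eq_Rintegral => w _; apply: eq_bigr => xi _.
  by rewrite /spec_ratio glueK invf_div.
apply: (cvg_unique _ h1); first exact: norm_hausdorff.
apply: cvg_trans h2; apply: near_eq_cvg; apply: nearW => L.
apply: eq_bigr => eta _; apply: eq_bigr => xi _; rewrite -mulrA /cp_ratio invf_div.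
by rewrite divfK ?gt_eqF // restr_rep.
Qed.

Definition flow D L (eta : pattern q L) : conf d q -> R := fun w =>
  \sum_(xi : pattern q D) c w xi * (\1_(cyl eta) (glue xi w) - \1_(cyl eta) w).

Lemma cont_flow D L (eta : pattern q L) : continuous (flow D eta).
Proof.
apply: cont_sum => xi _; apply: contM; first exact: c_cont.
apply: contB; last exact: continuous_indic.
by apply: cont_glue; exact: continuous_indic.
Qed.

(** [excess] is the adjoint in L^2(mu) of the D-part of the generator, applied to the constant 1. *)
Lemma Exp_flow D L (eta : pattern q L) :
  \int[mu]_w flow D eta w = \int[mu]_w (excess c gamma D w * \1_(cyl eta) w).
Proof.
have c1 (xi : pattern q D) : continuous (fun w => c w xi * \1_(cyl eta) (glue xi w)).
  by apply: contM; [exact: c_cont|apply: cont_glue; exact: continuous_indic].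
have c2 (xi : pattern q D) : continuous (fun w => c w xi * \1_(cyl eta) w).
  by apply: contM; [exact: c_cont|exact: continuous_indic].
have cs (xi : pattern q D) : continuous (fun w => c (glue xi w) (restr D w)).
  by apply: (@cont_glue_restr R d q D _ (fun w xi => c w xi)) => zeta; exact: c_cont.
have -> : \int[mu]_w flow D eta w = \int[mu]_w
    (\sum_(xi : pattern q D) c w xi * \1_(cyl eta) (glue xi w) -
     \sum_(xi : pattern q D) c w xi * \1_(cyl eta) w).
  by apply: eq_Rintegral => w _; rewrite -sumrB; apply: eq_bigr => xi _; rewrite mulrBr.
rewrite ExpB; try exact: cont_sum.
rewrite (gibbs_swap c1) -ExpB; last 2 first.
- apply: cont_sum => xi _; apply: contM; last exact: cont_g.
  have -> : (fun w => c (glue xi w) (restr D w) * \1_(cyl eta) (glue (restr D w) (glue xi w))) =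
      fun w => c (glue xi w) (restr D w) * \1_(cyl eta) w.
    by apply/funext => w; rewrite glueK.
  by apply: contM; [exact: cs|exact: continuous_indic].
- exact: cont_sum.
apply: eq_Rintegral => w _; rewrite -sumrB /excess mulr_suml; apply: eq_bigr => xi _.
by rewrite glueK; ring.
Qed.

(** The difference quotients of the semigroup have integral 0 by stationarity and converge uniformly
    to [gen c f]. *)
Lemma gen_stationary (f : conf d q -> R) :
  gen_core f -> continuous (gen c f) -> \int[mu]_w gen c f w = 0.
Proof.
move=> cf cg; have [[[Pc _ _ _] _] PG] := P_gen; have cf0 := cf.1.
have : infinitesimal_generator P f (gen c f).
  apply/PG; split => // e e0; exists f; split => //.
    apply: ge_ereal_sup => _ [w _ <-].
    by rewrite lee_fin fctE subrr normr0 ltW.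
  apply: ge_ereal_sup => _ [w _ <-].
  by rewrite lee_fin fctE subrr normr0 ltW.
move=> [_ _ G0]; apply/eqP; rewrite -normr_le0; apply/ler_addgt0Pr => e e0; rewrite add0r.
have e0' : (0 < e%:E)%E by rewrite lte_fin.
have h1 : \forall t \near 0^'+, (supnorm (t^-1 *: (P t f - f) - gen c f)%R < e%:E)%E.
  exact: G0 _ (open_ereal_lt_ereal e0').
have h2 : \forall t \near 0^'+, 0 < t :> R by exact: nbhs_right_gt.
have [t [/= ht t0]] := filter_ex (filterI h1 h2).
have cPt : continuous (P t f) by apply: Pc => //; exact: ltW.
have cdiff : continuous (fun w => t^-1 * (P t f w - f w)).
  by apply: contM; [exact: contC|exact: contB].
have -> : \int[mu]_w gen c f w =
    \int[mu]_w gen c f w - \int[mu]_w (t^-1 * (P t f w - f w)).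
  by rewrite ExpZl ?ExpB ?mu_stat ?subrr ?mulr0 ?subr0 ?(ltW t0) //; exact: contB.
apply: Exp_dist => // w; rewrite distrC -lee_fin; apply: le_trans (ltW ht).
by apply: ereal_sup_ubound; exists w.
Qed.

Lemma gen_finite (f : conf d q -> R) (A : {fset {fset site d}}) w :
  (forall D, D \notin A -> \sum_(xi : pattern q D) c w xi * (f (glue xi w) - f w) = 0) ->
  gen c f w = \sum_(D <- A) \sum_(xi : pattern q D) c w xi * (f (glue xi w) - f w).
Proof.
move=> HA; rewrite /gen /summability.sum; apply: cvg_lim; first exact: norm_hausdorff.
apply: cvg_near_cst; exists A => // B /= AB.
pose F D := \sum_(xi : pattern q D) c w xi * (f (glue xi w) - f w).
transitivity (\sum_(D <- B) F D); first by rewrite big_seq_fsetE.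
by apply/esym/big_fset_incl => // D _; exact: HA.
Qed.

Lemma gen_core_cyl L (eta : pattern q L) : gen_core (\1_(cyl eta) : conf d q -> R).
Proof.
split; first exact: continuous_indic.
have os x : (osc x (\1_(cyl eta) : conf d q -> R) <= (x \in L)%:R%:E)%E.
  apply: ge_ereal_sup => _ [[w w'] /= ww' <-]; rewrite lee_fin !cyl_indic.
  case: (boolP (x \in L)) => xL; first by do 2 case: eqP; rewrite ?subrr ?subr0 ?sub0r ?normrN ?normr0 ?normr1.
  have -> : restr L w = restr L w'.
    by apply/restrP => y yL; apply: ww'; apply: contraNneq xL => <-.
  by rewrite subrr normr0.
apply: (@le_lt_trans _ _ (\sum_(x <- L) 1)%E); last by rewrite sumEFin ltry.
apply: ge_ereal_sup => _ [A [finA _] <-].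
rewrite fsbig_finite //=.
apply: (@le_trans _ _ (\sum_(x <- fset_set A) (x \in L)%:R%:E)%E); first by apply: lee_sum => x _; exact: os.
rewrite !sumEFin lee_fin.
apply: (@le_trans _ _ (\sum_(x <- fset_set A | x \in L) 1)).
  by rewrite [leRHS]big_mkcond; apply: ler_sum => x _; case: (x \in L).
rewrite -big_filter -!(big_map (fun=> 1) xpredT id).
rewrite !big_map !big_const_seq !count_predT !iter_addr_0 ler_nat.
apply: uniq_leq_size; first exact/filter_uniq/fset_uniq.
by move=> x; rewrite mem_filter => /andP[].
Qed.

(** The active translates that touch the large box without lying in the small one: they act on
    cylinders over the large box but are absent from the loss. *)
Definition boundary n : {fset {fset site d}} :=
  [fset D in [seq translate x D | D <- active c, x <- (Lam n `\` inner n D)%fset]]%fset.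

Lemma boundaryP n D : reflect (exists D0 x, [/\ D0 \in active c, x \in Lam n,
    x \notin inner n D0 & D = translate x D0]) (D \in boundary n).
Proof.
rewrite in_fset /=; apply: (iffP allpairsPdep) => -[D0 [x]].
  by move=> []; rewrite in_fsetD => D0a /andP[xi xL] ->; exists D0, x.
by move=> [D0a xL xi ->]; exists D0, x; rewrite in_fsetD xi xL.
Qed.

Lemma card_boundary n : (#|` boundary n| <=
  \sum_(D <- active c) (#|` @Lam d n| - #|` inner n D|))%N.
Proof.
rewrite card_fseq (leq_trans (size_undup _)) // size_allpairs_dep sumnE big_map.
by apply: leq_sum => D _; rewrite cardfsDS // inner_sub.
Qed.

Lemma boundary_disjoint n : [disjoint fpowerset (Lam_tilde n) & boundary n]%fset.
Proof.
apply/fdisjointP => D; rewrite fpowersetE => DL; apply/negP => /boundaryP[D0 [x [_ xL + E]]].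
by rewrite !inE /= xL -E DL.
Qed.

Definition relevant n := (fpowerset (Lam_tilde n) `|` boundary n)%fset.

Lemma irrelevant_flow n D (eta : pattern q (@Lam d n)) w : D \notin relevant n -> flow D eta w = 0.
Proof.
rewrite in_fsetU negb_or fpowersetE => /andP[DL DB].
have [[x xD xL]|nx] := pselect (exists2 x, x \in D & x \in @Lam d n).
  have [Da|Da] := boolP (translate (- x) D \in active c); last first.
    by rewrite /flow big1 // => xi _; rewrite (rate_eq0 c_fin c_ti xD Da) mul0r.
  exfalso; move/negP: DB; apply; apply/boundaryP; exists (translate (- x) D), x.
  by split; rewrite ?translateVK // !inE /= xL translateVK.
rewrite /flow big1 // => xi _.
have -> : \1_(cyl eta) (glue xi w) = \1_(cyl eta) w :> R.
  rewrite !cyl_indic; congr (nat_of_bool (_ == _))%:R; apply/restrP => y yL.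
  by rewrite glueE; case: ifPn => // yD; exfalso; apply: nx; exists y.
by rewrite subrr mulr0.
Qed.

Lemma Exp_relevant n (eta : pattern q (@Lam d n)) :
  \int[mu]_w ((\sum_(D <- relevant n) excess c gamma D w) * \1_(cyl eta) w) = 0.
Proof.
have ch := cont_excess_gibbs c_cont gamma_spec gamma_ql gamma_nn gamma_ti.
have cM D : continuous (fun w => excess c gamma D w * \1_(cyl eta) w).
  by apply: contM; [exact: ch|exact: continuous_indic].
have genE w : gen c (\1_(cyl eta)) w = \sum_(D <- relevant n) flow D eta w.
  by apply: gen_finite => D /irrelevant_flow; exact.
have genE' : gen c (\1_(cyl eta)) = fun w => \sum_(D <- relevant n) flow D eta w.
  exact/funext.
have cg : continuous (gen c (\1_(cyl eta))).
  by rewrite genE'; apply: cont_sum => D _; exact: cont_flow.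
apply: etrans (gen_stationary (gen_core_cyl eta) cg); rewrite genE' Exp_sum; last first.
  by move=> D _; exact: cont_flow.
under [RHS]eq_bigr do rewrite Exp_flow.
rewrite -Exp_sum; last by move=> D _; exact: cM.
by apply: eq_Rintegral => w _; rewrite mulr_suml.
Qed.

End stationarity.

(** * Negligibility of the excess and sign of the density *)

Section balance.
Context {R : realType} {d q : nat}.
Variable c : rates R d q.
Variable P : R -> (conf d q -> R) -> conf d q -> R.
Hypothesis c_ge0 : rates_nonneg c.
Hypothesis c_cont : rates_continuous c.
Hypothesis c_fin : rates_finite_type c.
Hypothesis c_ti : rates_translation_invariant c.
Hypothesis P_gen : generated_semigroup c P.
Variable gamma : {fset site d} -> R.-pker conf d q ~> conf d q.
Hypothesis gamma_spec : specification gamma.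
Hypothesis gamma_ql : quasilocal gamma.
Hypothesis gamma_nn : nonnull gamma.
Hypothesis gamma_ti : spec_translation_invariant gamma.
Variable mu : probability (conf d q) R.
Hypothesis mu_gibbs : gibbs gamma mu.
Hypothesis mu_stat : time_stationary P mu.
Implicit Types (D L : {fset site d}) (w : conf d q) (x : site d) (n : nat)
  (nu : probability (conf d q) R).

Let ch D : continuous (excess c gamma D).
Proof. exact: (cont_excess_gibbs c_cont gamma_spec gamma_ql gamma_nn gamma_ti). Qed.

Lemma excess_bound (s : seq {fset site d}) :
  exists2 C : R, 0 < C & forall D w, D \in s -> `|excess c gamma D w| <= C.
Proof.
elim: s => [|D s [C C0 HC]]; first by exists 1.
have [C' C'0 HC'] := continuous_bounded (@ch D).
exists (C + C'); first by rewrite addr_gt0.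
move=> D' w; rewrite inE => /predU1P[->|/HC h].
  by rewrite (le_trans (HC' w)) // lerDr ltW.
by rewrite (le_trans (h w)) // lerDl ltW.
Qed.

Lemma excess_rate0 D w : (forall w (xi : pattern q D), c w xi = 0) -> excess c gamma D w = 0.
Proof. by move=> c0; rewrite /excess big1 // => xi _; rewrite !c0 mul0r subrr. Qed.

Lemma excess_fset0 w : excess c gamma fset0 w = 0.
Proof.
rewrite /excess big1 // => xi _.
have g : glue xi w = w by apply/funext => y; rewrite glueE in_fset0.
have -> : restr fset0 w = xi by rewrite -[in LHS]g restr_glue.
by rewrite /spec_ratio g divff ?mulr1 ?subrr // gt_eqF // (spf_gt0 gamma_spec gamma_ql gamma_nn gamma_ti).
Qed.

Definition bulk_excess n w : R := \sum_(D <- fpowerset (Lam_tilde n)) excess c gamma D w.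

Lemma wgt_ge0 D : 0 <= wgt D :> R. Proof. by rewrite invr_ge0. Qed.

Lemma wgt_gt0 D : 0 \in D -> 0 < wgt D :> R.
Proof.
move=> D0; rewrite invr_gt0 ltr0n cardfs_gt0.
by apply/fset0Pn; exists 0.
Qed.

Lemma wgt_le1 D : wgt D <= 1 :> R.
Proof.
rewrite /wgt; case: (posnP #|` D|) => [->|D0]; first by rewrite invr0.
by rewrite invf_le1 ?ltr0n // ler1n.
Qed.

Lemma bulk_excessE n w : bulk_excess n w = \sum_(D <- active c) \sum_(x <- inner n D)
  wgt D * excess c gamma D (tau (- x) w).
Proof.
rewrite /bulk_excess (@bulk_sum _ _ _ _ c_fin _ _ (fun D => wgt D * excess c gamma D w)).
- apply: eq_bigr => D _; apply: eq_bigr => x _; rewrite /wgt card_translate.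
  by rewrite -(@excess_tau _ _ _ _ c_ti _ gamma_ti x D (tau (- x) w)) tauVK.
- move=> D; have [->|D0] := eqVneq D fset0; first by rewrite cardfs0 mulr0n excess_fset0.
  rewrite -mulr_natl mulrA divff ?mul1r // pnatr_eq0 -lt0n cardfs_gt0 //.
- by move=> D x xD nD; rewrite excess_rate0 ?mulr0 //; exact: (rate_eq0 c_fin c_ti xD nD).
Qed.

Lemma cont_bulk_excess n : continuous (bulk_excess n).
Proof. by apply: cont_sum => D _; exact: ch. Qed.

Lemma near_active (Q : {fset site d} -> nat -> Prop) :
  (forall D, D \in active c -> \forall n \near \oo, Q D n) ->
  \forall n \near \oo, forall D, D \in active c -> Q D n.
Proof.
move=> H; have : \forall n \near \oo, forall D : active c, Q (val D) n.
  by apply: filter_forall => D; apply: H; exact: valP.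
by apply: filterS => n HQ D Da; have := HQ [` Da]%fset.
Qed.

(** Each term is a translate of one of finitely many continuous functions, and the margin around its
    location grows with n; hence each oscillates little on a cylinder over the large box. *)
Lemma bulk_excess_osc (e : R) : 0 < e -> \forall n \near \oo, forall w w',
  restr (Lam n) w = restr (Lam n) w' ->
  `|bulk_excess n w - bulk_excess n w'| <= e * #|` @Lam d n|%:R.
Proof.
move=> e0; pose N : R := (size (active c))%:R.
have e1 : 0 < e / (N + 1) by rewrite divr_gt0 // ltr_wpDl.
have := @near_active (fun D n => forall x, x \in inner n D -> forall w w',
  restr (translate (- x) (@Lam d n)) w = restr (translate (- x) (@Lam d n)) w' ->
  `|excess c gamma D w - excess c gamma D w'| <= e / (N + 1)).
have H D : D \in active c -> \forall n \near \oo, forall x, x \in inner n D -> forall w w',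
  restr (translate (- x) (@Lam d n)) w = restr (translate (- x) (@Lam d n)) w' ->
  `|excess c gamma D w - excess c gamma D w'| <= e / (N + 1).
  move=> /(active0 c_fin) D0.
  have := @near_inner d D (fun L => forall w w', restr L w = restr L w' ->
    `|excess c gamma D w - excess c gamma D w'| <= e / (N + 1)) D0.
  by apply; exact: continuous_unif.
move=> /(_ H); apply: filterS => n Hn w w' ww'.
have L0 : 0 <= #|` @Lam d n|%:R :> R by [].
rewrite !bulk_excessE -sumrB (le_trans (ler_norm_sum _ _ _)) //.
apply: (@le_trans _ _ (\sum_(D <- active c) #|` @Lam d n|%:R * (e / (N + 1)))).
  rewrite big_seq [leRHS]big_seq; apply: ler_sum => D Da.
  rewrite -sumrB (le_trans (ler_norm_sum _ _ _)) //.
  apply: (@le_trans _ _ (\sum_(x <- inner n D) e / (N + 1))).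
    rewrite big_seq [leRHS]big_seq; apply: ler_sum => x xi.
    rewrite -mulrBr normrM (ger0_norm (wgt_ge0 _)) -[leRHS]mul1r.
    apply: ler_pM => //; [exact: wgt_ge0|exact: wgt_le1|].
    by apply: (Hn D Da x xi); apply/restr_tau.
  rewrite big_const_seq count_predT iter_addr_0 -[leLHS]mulr_natl ler_wpM2r ?(ltW e1) //.
  by rewrite ler_nat card_inner_le.
rewrite big_const_seq count_predT iter_addr_0 -[leLHS]mulr_natl -/N.
rewrite mulrCA [leRHS]mulrC ler_wpM2l // mulrCA ler_piMr ?(ltW e0) //.
by rewrite ler_pdivrMr ?ltr_wpDl // mul1r lerDl.
Qed.

Lemma boundary_small (e : R) : 0 < e -> \forall n \near \oo,
  #|` boundary c n|%:R <= e * #|` @Lam d n|%:R :> R.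
Proof.
move=> e0; pose N : R := (size (active c))%:R.
have e1 : 0 < e / (N + 1) by rewrite divr_gt0 // ltr_wpDl.
have := @near_active (fun D n => `|1 - #|` inner n D|%:R / #|` @Lam d n|%:R| <= e / (N + 1)).
have H D : D \in active c -> \forall n \near \oo,
    `|1 - #|` inner n D|%:R / #|` @Lam d n|%:R| <= e / (N + 1).
  by move=> _; have /cvgrPdist_le := @card_inner_cvg R d D; apply.
move=> /(_ H); apply: filterS => n Hn.
have L0 := @card_Lam_gt0 R d n.
apply: (@le_trans _ _ (\sum_(D <- active c) (#|` @Lam d n| - #|` inner n D|))%N%:R).
  by rewrite ler_nat; exact: card_boundary.
rewrite natr_sum.
apply: (@le_trans _ _ (\sum_(D <- active c) #|` @Lam d n|%:R * (e / (N + 1)))).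
  rewrite big_seq [leRHS]big_seq; apply: ler_sum => D Da.
  rewrite natrB ?card_inner_le // mulrC -ler_pdivrMr // mulrBl divff ?gt_eqF //.
  by rewrite (le_trans (ler_norm _)) // Hn.
rewrite big_const_seq count_predT iter_addr_0 -[leLHS]mulr_natl -/N.
rewrite mulrCA [leRHS]mulrC ler_wpM2l ?(ltW L0) // mulrCA ler_piMr ?(ltW e0) //.
by rewrite ler_pdivrMr ?ltr_wpDl // mul1r lerDl.
Qed.

(** On the cylinder of w over the large box, the bulk excess is almost constant and close to the
    full excess g, whose [mu]-integral over that cylinder vanishes. Dividing by the positive
    probability of the cylinder turns an identity in mean under [mu] into a bound at every w, valid
    for integration against any [nu]. *)
Lemma bulk_excess_small (e : R) : 0 < e -> \forall n \near \oo, forall w,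
  `|bulk_excess n w| <= e * #|` @Lam d n|%:R.
Proof.
move=> e0; have [C C0 HC] := excess_bound (active c).
have e1 : 0 < e / 2 by rewrite divr_gt0.
(* C bounds each boundary term, so all of them together use the other half of e. *)
have e2 : 0 < e / 2 / C by rewrite divr_gt0.
apply: filterS2 (bulk_excess_osc e1) (boundary_small e2) => n h1 h2 w.
set eta := restr (Lam n) w; set K := (X in _ <= X).
have p0 : 0 < cp mu eta.
  exact: (cp_mu_gt0 gamma_spec gamma_ql gamma_nn gamma_ti mu_gibbs).
pose g w' := \sum_(D <- relevant c n) excess c gamma D w'.
have cg : continuous g by apply: cont_sum => D _; exact: ch.
have g0 : \int[mu]_w' (g w' * \1_(cyl eta) w') = 0.
  exact: (Exp_relevant c_cont c_fin c_ti P_gen gamma_spec gamma_ql gamma_nn gamma_ti mu_gibbs mu_stat).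
have gE w' : g w' = bulk_excess n w' + \sum_(D <- boundary c n) excess c gamma D w'.
  rewrite /g /bulk_excess -big_cat; apply/perm_big/uniq_perm.
  - exact: fset_uniq.
  - rewrite cat_uniq !fset_uniq andbT; apply/hasPn => D DB /=.
    by have /fdisjointP_sym := boundary_disjoint c n; apply.
  by move=> D; rewrite mem_cat in_fsetU.
have bd w' : `|\sum_(D <- boundary c n) excess c gamma D w'| <= C * #|` boundary c n|%:R.
  rewrite (le_trans (ler_norm_sum _ _ _)) //.
  apply: (@le_trans _ _ (\sum_(D <- boundary c n) C)).
    rewrite big_seq [leRHS]big_seq; apply: ler_sum => D /boundaryP[D0 [x [D0a _ _ ->]]].
    by rewrite -(tauVK x w') (@excess_tau _ _ _ _ c_ti _ gamma_ti) HC.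
  by rewrite big_const_seq count_predT iter_addr_0 mulr_natr.
have close w' : restr (Lam n) w' = eta -> `|bulk_excess n w - g w'| <= K.
  move=> ew; rewrite gE opprD addrA (le_trans (ler_normB _ _)) //.
  have -> : K = e / 2 * #|` @Lam d n|%:R + C * (e / 2 / C * #|` @Lam d n|%:R).
    by rewrite /K; field; rewrite gt_eqF.
  apply: lerD; first by apply: h1; rewrite ew.
  by rewrite (le_trans (bd w')) // ler_wpM2l // ltW.
have ci : continuous (\1_(cyl eta) : conf d q -> R) by exact: continuous_indic.
have cK (k : R) : continuous (fun w' => k * \1_(cyl eta) w') by apply: contM ci; exact: contC.
have cgi : continuous (fun w' => g w' * \1_(cyl eta) w') by exact: contM.
suff : `|bulk_excess n w| * cp mu eta <= K * cp mu eta by rewrite ler_pM2r.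
rewrite -{1}(gtr0_norm p0) -normrM ler_norml; apply/andP; split.
  rewrite -mulNr cp_Exp -!ExpZl // -[leRHS]subr0 -g0 -ExpB //.
  apply: le_Exp => [||w']; [exact: cK|exact: contB|rewrite cyl_indic].
  case: eqP => [/close|_]; rewrite ?mulr1 ?mulr0 ?subr0 // ler_norml.
  by move=> /andP[].
rewrite cp_Exp -!ExpZl // -[leLHS]subr0 -g0 -ExpB //.
apply: le_Exp => [||w']; [exact: contB|exact: cK|rewrite cyl_indic].
case: eqP => [/close|_]; rewrite ?mulr1 ?mulr0 ?subr0 // ler_norml.
by move=> /andP[].
Qed.

(** The normalised mean of the bulk excess has two limits: the left-hand side, by translation
    invariance of [nu], and 0, by the pointwise bound. *)
Lemma balance nu : translation_invariant nu ->
  \sum_(D <- active c) wgt D * \int[nu]_w excess c gamma D w = 0.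
Proof.
move=> nu_inv; set T := (LHS).
pose a n := #|` @Lam d n|%:R^-1 * \int[nu]_w bulk_excess n w.
have aE n : a n = \sum_(D <- active c)
    (#|` inner n D|%:R / #|` @Lam d n|%:R) * (wgt D * \int[nu]_w excess c gamma D w).
  rewrite /a; have -> : \int[nu]_w bulk_excess n w = \sum_(D <- active c)
      #|` inner n D|%:R * (wgt D * \int[nu]_w excess c gamma D w).
    have cx D x : continuous (fun w => wgt D * excess c gamma D (tau (- x) w)).
      by apply: contM; [exact: contC|apply: cont_tau; exact: ch].
    under eq_Rintegral do rewrite bulk_excessE.
    rewrite Exp_sum; last by move=> D _; apply: cont_sum => x _; exact: cx.
    apply: eq_bigr => D _; rewrite Exp_sum; last by move=> x _; exact: cx.
    under eq_bigr => x _.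
      rewrite ExpZl; last by apply: cont_tau; exact: ch.
      rewrite (Exp_tau (- x) nu_inv (@ch D)).
      over.
    by rewrite big_const_seq count_predT iter_addr_0 -[LHS]mulr_natl.
  rewrite mulr_sumr; apply: eq_bigr => D _.
  by ring.
have aT : a @ \oo --> T.
  have -> : a = fun n => \sum_(D <- active c)
    (#|` inner n D|%:R / #|` @Lam d n|%:R) * (wgt D * \int[nu]_w excess c gamma D w).
    exact/funext.
  rewrite /T; elim: (enum_fset (active c)) => [|D s IH].
    by under eq_fun do rewrite big_nil; rewrite big_nil; exact: cvg_cst.
  under eq_fun do rewrite big_cons; rewrite big_cons; apply: cvgD => //.
  rewrite -[X in _ --> X]mul1r; apply: cvgM; last exact: cvg_cst.
  exact: card_inner_cvg.
have a0 : a @ \oo --> (0 : R).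
  apply/cvgrPdist_le => e e0; apply: filterS (bulk_excess_small e0) => n Hn.
  rewrite sub0r normrN /a normrM ger0_norm ?invr_ge0 // mulrC ler_pdivrMr ?card_Lam_gt0 //.
  rewrite -[\int[nu]_w _]subr0 -(Exp_cst nu 0); apply: Exp_dist => [||w].
  - exact: cont_bulk_excess.
  - exact: contC.
  by rewrite subr0.
by apply: (cvg_unique _ aT a0); exact: norm_hausdorff.
Qed.

Hypothesis c_low : rates_bounded_below c.

(** By [balance] the mean excesses add up to zero, so inserting them turns each limit loss into
    minus a limit defect. *)
Lemma density_defect nu : translation_invariant nu ->
  density c gamma nu = (- \sum_(D <- active c) (wgt D)%:E * defect_lim c gamma nu D)%E.
Proof.
move=> nu_inv.
have sg D : (0 <= (wgt D)%:E * defect_lim c gamma nu D)%E.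
  rewrite mule_ge0 // ?lee_fin ?wgt_ge0 //.
  exact: (defect_lim_ge0 c_ge0 c_cont c_low gamma_spec gamma_ql gamma_nn gamma_ti mu_gibbs).
rewrite -sumeN; last by move=> D D' _ _; rewrite ge0_adde_def ?inE.
rewrite -[RHS]add0e; transitivity ((\sum_(D <- active c) wgt D * \int[nu]_w excess c gamma D w)%R%:E +
    \sum_(D <- active c) - ((wgt D)%:E * defect_lim c gamma nu D))%E; last by rewrite balance.
rewrite -sumEFin -big_split; apply: eq_bigr => D _ /=.
rewrite /defect_lim; have := loss_lim_lty c_ge0 gamma nu D.
case: (loss_lim _ _ _ _) => [r| |] // _.
  by rewrite -EFinB -!EFinM; congr EFin; ring.
rewrite (_ : (_ - -oo)%E = +oo%E) //; have := wgt_ge0 D; rewrite le_eqVlt => /predU1P[<-|w0].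
  by rewrite !mul0e mul0r oppe0 adde0.
by rewrite gt0_muley ?lte_fin // gt0_muleNy ?lte_fin.
Qed.

Lemma density_le0 nu : translation_invariant nu -> (density c gamma nu <= 0)%E.
Proof.
move=> nu_inv; rewrite density_defect // leeNl oppe0; apply: sume_ge0 => D _.
rewrite mule_ge0 // ?lee_fin ?wgt_ge0 //.
exact: (defect_lim_ge0 c_ge0 c_cont c_low gamma_spec gamma_ql gamma_nn gamma_ti mu_gibbs).
Qed.

Lemma density0_defect nu D : translation_invariant nu -> density c gamma nu = 0%E ->
  D \in active c -> defect_lim c gamma nu D = 0%E.
Proof.
move=> nu_inv; rewrite density_defect // => /eqP; rewrite oppe_eq0 => /eqP S0 Da.
have sg D' : (0 <= (wgt D')%:E * defect_lim c gamma nu D')%E.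
  rewrite mule_ge0 // ?lee_fin ?wgt_ge0 //.
  exact: (defect_lim_ge0 c_ge0 c_cont c_low gamma_spec gamma_ql gamma_nn gamma_ti mu_gibbs).
have : ((wgt D)%:E * defect_lim c gamma nu D = 0)%E.
  apply/eqP; rewrite eq_le sg andbT -S0 (big_fsetD1 D) //= leeDl //.
  by apply: sume_ge0.
move/eqP; rewrite mule_eq0 eqe gt_eqF ?orFb; first by move/eqP.
exact/wgt_gt0/(active0 c_fin).
Qed.

End balance.

(** * Upper semicontinuity *)

Section semicontinuity.
Context {R : realType} {X : topologicalType}.
Implicit Types (x : X) (f g : X -> \bar R).

Definition lsc_at x f := forall a : R, (a%:E < f x)%E -> \forall y \near x, (a%:E < f y)%E.
Definition usc_at x f := forall a : R, (f x < a%:E)%E -> \forall y \near x, (f y < a%:E)%E.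

Lemma lsc_add x f g : (0 <= f x)%E -> (0 <= g x)%E ->
  lsc_at x f -> lsc_at x g -> lsc_at x (fun y => f y + g y)%E.
Proof.
move=> f0 g0 lf lg a afg.
have [b [bf bg]] : exists b : R, (b%:E < f x)%E /\ ((a - b)%:E < g x)%E.
  case: (f x) (g x) f0 g0 afg => [u| |] [v| |] //=; rewrite ?lee_fin.
  - rewrite -EFinD lte_fin => u0 v0 auv; exists (u - (u + v - a) / 2).
    by rewrite !lte_fin; lra.
  - by move=> u0 _ _; exists (u - 1); rewrite ltry lte_fin; lra.
  - by move=> _ v0 _; exists (a - v + 1); rewrite ltry lte_fin; lra.
  - by move=> _ _ _; exists 0; rewrite !ltry.
apply: filterS2 (lf _ bf) (lg _ bg) => y h1 h2.
by rewrite -(subrK b a) addrC EFinD lteD.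
Qed.

Lemma lsc_sum x (I : Type) (r : seq I) (f : I -> X -> \bar R) :
  (forall i y, 0 <= f i y)%E -> (forall i, lsc_at x (f i)) ->
  lsc_at x (fun y => \sum_(i <- r) f i y)%E.
Proof.
move=> f0 lf; elim: r => [|i r IH] a.
  by rewrite big_nil => a0; apply: nearW => y; rewrite big_nil.
rewrite big_cons => h.
have S0 : (0 <= \sum_(j <- r) f j x)%E by apply: sume_ge0 => j _.
have := lsc_add (f0 i x) S0 (lf i) IH h.
by apply: filterS => y; rewrite big_cons.
Qed.

Lemma usc_add x f g : (f x < +oo)%E -> (g x < +oo)%E ->
  usc_at x f -> usc_at x g -> usc_at x (fun y => f y + g y)%E.
Proof.
move=> f0 g0 lf lg a afg.
have [b [bf bg]] : exists b : R, (f x < b%:E)%E /\ (g x < (a - b)%:E)%E.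
  case: (f x) (g x) f0 g0 afg => [u| |] [v| |] //=.
  - rewrite -EFinD lte_fin => u0 v0 auv; exists (u - (u + v - a) / 2).
    by rewrite !lte_fin; lra.
  - by move=> u0 _ _; exists (u + 1); rewrite ltNyr lte_fin; lra.
  - by move=> _ v0 _; exists (a - v - 1); rewrite ltNyr lte_fin; lra.
  - by move=> _ _ _; exists 0; rewrite !ltNyr.
apply: filterS2 (lf _ bf) (lg _ bg) => y h1 h2.
by rewrite -(subrK b a) addrC EFinD lteD.
Qed.

Lemma lscN_usc x f : lsc_at x f -> usc_at x (fun y => - f y)%E.
Proof.
move=> lf a; rewrite lteNl -EFinN => /lf; apply: filterS => y.
by rewrite [in X in _ -> X]lteNl.
Qed.

Lemma usc_cst x (l : \bar R) : usc_at x (fun=> l).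
Proof. by move=> a la; apply: nearW. Qed.

Lemma cont_usc x (f : X -> R) : {for x, continuous f} -> usc_at x (fun y => (f y)%:E).
Proof.
move=> cf a; rewrite lte_fin => fa.
have : \forall y \near x, f y < a by exact: (cvgr_lt _ cf).
by apply: filterS => y; rewrite lte_fin.
Qed.

Lemma lsc_scale x (k : R) f : 0 <= k -> lsc_at x f -> lsc_at x (fun y => k%:E * f y)%E.
Proof.
rewrite le_eqVlt => /predU1P[<-|k0] lf a.
  by rewrite mul0e => a0; apply: nearW => y; rewrite mul0e.
have E (z : \bar R) : (a%:E < k%:E * z)%E = ((a / k)%:E < z)%E.
  by rewrite [(a / k)%:E]EFinM [(a%:E * _)%E]muleC lte_pdivrMl.
by rewrite E => /lf; apply: filterS => y; rewrite E.
Qed.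

Lemma usc_scale x (k : R) f : 0 < k -> usc_at x f -> usc_at x (fun y => k%:E * f y)%E.
Proof.
move=> k0 lf a.
have E (z : \bar R) : (k%:E * z < a%:E)%E = (z < (a / k)%:E)%E.
  by rewrite [(a / k)%:E]EFinM [(a%:E * _)%E]muleC lte_pdivlMl.
by rewrite E => /lf; apply: filterS => y; rewrite E.
Qed.

Lemma lsc_sup x (I : Type) (S : set I) (f : I -> X -> \bar R) :
  (forall i, S i -> lsc_at x (f i)) -> lsc_at x (fun y => ereal_sup [set f i y | i in S]).
Proof.
move=> lf a /ereal_sup_gt[_ [i Si <-]] /(lf i Si); apply: filterS => y ay.
by apply: lt_le_trans ay _; apply: ereal_sup_ubound; exists i.
Qed.

End semicontinuity.

Section weak_topology.
Context {R : realType} {d q : nat}.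
Implicit Types (nu : weak_probability R d q) (f : conf d q -> R).

Lemma cont_weak f nu : continuous f ->
  {for nu, continuous (fun nu : weak_probability R d q =>
    \int[(nu : probability (conf d q) R)]_w f w)}.
Proof.
move=> cf.
pose F (nu : probability (conf d q) R) : {ptws continuousType (conf d q) R -> R} :=
  fun f : continuousType (conf d q) R => \int[nu]_w f w.
pose fc : continuousType (conf d q) R := mkcts cf.
have h1 : {for nu, continuous (F : weak_probability R d q -> _)}.
  exact: (@initial_continuous _ _ F).
have h2 := @proj_continuous (continuousType (conf d q) R) (fun=> R) fc (F nu).
exact: (cvg_comp _ _ h1 h2).
Qed.

End weak_topology.

Section density_usc.
Context {R : realType} {d q : nat}.
Variable c : rates R d q.
Hypothesis c_ge0 : rates_nonneg c.
Hypothesis c_cont : rates_continuous c.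
Hypothesis c_fin : rates_finite_type c.
Variable gamma : {fset site d} -> R.-pker conf d q ~> conf d q.
Hypothesis gamma_spec : specification gamma.
Hypothesis gamma_ql : quasilocal gamma.
Hypothesis gamma_nn : nonnull gamma.
Hypothesis gamma_ti : spec_translation_invariant gamma.
Implicit Types (D L : {fset site d}) (nu : weak_probability R d q).

(** The gain is built from suprema and nonnegative combinations of functions linear in cylinder
    probabilities, and these are weakly continuous since cylinders are clopen. *)
Lemma gain_lim_lsc nu D :
  lsc_at nu (fun nu : weak_probability R d q => gain_lim c (nu : probability (conf d q) R) D).
Proof.
apply: lsc_sup => L _.
apply: lsc_sum => [eta m|eta].
  by apply: sume_ge0 => xi _; rewrite mule_ge0 ?relgap_ge0 // lee_fin cmin_ge0.
apply: lsc_sum => [xi m|xi]; first by rewrite mule_ge0 ?relgap_ge0 // lee_fin cmin_ge0.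
apply: lsc_scale; first exact: cmin_ge0.
apply: lsc_sup => s _ a; rewrite lte_fin => h.
pose f w : R := (1 - s) * \1_(cyl (jumped eta xi)) w + \1_(cyl eta) w * ln s.
have cf : continuous f.
  apply: contD; apply: contM; try exact: contC; exact: continuous_indic.
have fE (m : probability (conf d q) R) :
    \int[m]_w f w = (1 - s) * cp m (jumped eta xi) + cp m eta * ln s.
  rewrite ExpD; last 2 first.
  - by apply: contM; [exact: contC|exact: continuous_indic].
  - by apply: contM; [exact: continuous_indic|exact: contC].
  rewrite ExpZl; last exact: continuous_indic.
  under [X in _ + X]eq_Rintegral do rewrite mulrC.
  by rewrite ExpZl ?[ln s * _]mulrC -?cp_Exp //; exact: continuous_indic.
have : \forall m \near nu, a < \int[(m : probability (conf d q) R)]_w f w.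
  have h' : a < \int[(nu : probability (conf d q) R)]_w f w by rewrite fE.
  exact: (cvgr_gt _ (@cont_weak R d q f nu cf) _ h').
by apply: filterS => m; rewrite fE lte_fin.
Qed.

Lemma loss_lim_usc nu D :
  usc_at nu (fun nu : weak_probability R d q => loss_lim c gamma (nu : probability (conf d q) R) D).
Proof.
apply: usc_add; first exact: ltry.
- by have /= := gain_lim_ge0 c_ge0 (nu : probability (conf d q) R) D; case: (gain_lim c _ D) => [k| |] // _; rewrite ltry.
- apply: cont_usc; apply: cont_weak.
  exact: (cont_drift c_cont gamma_spec gamma_ql gamma_nn gamma_ti).
- exact/lscN_usc/gain_lim_lsc.
Qed.

Lemma density_usc nu :
  usc_at nu (fun nu : weak_probability R d q => density c gamma (nu : probability (conf d q) R)).
Proof.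
suff [] : usc_at nu (fun nu : weak_probability R d q =>
    \sum_(D <- active c) (wgt D)%:E * loss_lim c gamma (nu : probability (conf d q) R) D)%E /\
    (\sum_(D <- active c) (wgt D)%:E * loss_lim c gamma (nu : probability (conf d q) R) D < +oo)%E by [].
have : forall D, D \in enum_fset (active c) -> 0 \in D by move=> D; exact: active0.
elim: (enum_fset (active c)) => [|D s IH] s0.
  split; last by rewrite big_nil.
  move=> a; rewrite big_nil => /(@usc_cst R _ nu); apply: filterS => m.
  by rewrite big_nil.
have [D' D's|IH1 IH2] := IH; first by apply: s0; rewrite inE D's orbT.
have w0 : 0 < wgt D :> R by apply: wgt_gt0; apply: s0; rewrite inE eqxx.
have wl := wgt_lty c_ge0 gamma (nu : probability (conf d q) R) D.
split; last by rewrite big_cons lte_add_pinfty.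
pose f1 (m : weak_probability R d q) :=
  ((wgt D)%:E * loss_lim c gamma (m : probability (conf d q) R) D)%E.
have h := @usc_add R _ nu f1 _ wl IH2 (usc_scale w0 (@loss_lim_usc nu D)) IH1.
move=> a; rewrite big_cons => /h; apply: filterS => m.
by rewrite big_cons.
Qed.

End density_usc.

(** * Measures with vanishing entropy loss *)

Section transfer.
Context {R : realType} {d q : nat}.
Variable c : rates R d q.
Hypothesis c_ge0 : rates_nonneg c.
Hypothesis c_cont : rates_continuous c.
Hypothesis c_fin : rates_finite_type c.
Hypothesis c_low : rates_bounded_below c.
Hypothesis c_ti : rates_translation_invariant c.
Hypothesis c_irr : rates_irreducible c.
Variable gamma : {fset site d} -> R.-pker conf d q ~> conf d q.
Hypothesis gamma_spec : specification gamma.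
Hypothesis gamma_ql : quasilocal gamma.
Hypothesis gamma_nn : nonnull gamma.
Hypothesis gamma_ti : spec_translation_invariant gamma.
Variable mu : probability (conf d q) R.
Hypothesis mu_gibbs : gibbs gamma mu.
Hypothesis mu_inv : translation_invariant mu.
Variable nu : probability (conf d q) R.
Hypothesis nu_inv : translation_invariant nu.
Implicit Types (D L E : {fset site d}) (w v s : conf d q) (f g : conf d q -> R).

Let mu_gt0 L (eta : pattern q L) : 0 < cp mu eta.
Proof. exact: (cp_mu_gt0 gamma_spec gamma_ql gamma_nn gamma_ti mu_gibbs). Qed.

Let cont_g D (xi : pattern q D) : continuous (fun w => spec_ratio gamma w xi).
Proof. exact: (cont_spec_ratio gamma_spec gamma_ql gamma_nn gamma_ti). Qed.

Let g_gt0 D w (xi : pattern q D) : 0 < spec_ratio gamma w xi.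
Proof. exact: (spec_ratio_gt0 gamma_spec gamma_ql gamma_nn gamma_ti). Qed.

Let spf_neq0 D w : spec_fun gamma D w != 0.
Proof. by rewrite gt_eqF // (spf_gt0 gamma_spec gamma_ql gamma_nn gamma_ti). Qed.

(** A vanishing limit defect controls the L^1 distance of the two fluxes through [relgap_dist]. *)
Lemma flux_small D : defect_lim c gamma nu D = 0%E -> forall e : R, 0 < e ->
  \forall L \near totally, \sum_(eta : pattern q L) \sum_(xi : pattern q D)
    cavg c nu eta xi * `|cp nu (jumped eta xi) / cp_ratio mu L (rep eta) xi - cp nu eta| <= e.
Proof.
move=> s0 e e0.
have [C C0 HC] := @pattern_bounded R d q D (fun w xi => c w xi) (@c_cont D).
have cC L (eta : pattern q L) (xi : pattern q D) : cavg c nu eta xi <= C.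
  suff /andP[] : 0 <= cavg c nu eta xi <= C by [].
  by apply: cavg_bounds => // w _; rewrite c_ge0 (le_trans (ler_norm _)).
pose N : R := \sum_(xi : pattern q D) 1.
have N0 : 0 <= N by rewrite sumr_ge0.
pose K := N * C; have K0 : 0 <= K by rewrite mulr_ge0 // ltW.
(* With A the sum to be bounded and K a bound for the total rate, t A <= defect + 2 t^2 K. The
   choice gives 2 t K <= e / 2, and the defect is eventually below t e / 2; the bound 1 / 2 is
   required by [relgap_dist]. *)
pose t := Num.min (1 / 2) (e / 2 / (2 * (K + 1))).
have K1 : 0 < 2 * (K + 1) by rewrite mulr_gt0 // ltr_wpDl.
have t0 : 0 < t by rewrite lt_min !divr_gt0.
have t2 : t <= 1 / 2 by rewrite ge_min lexx.
have tK : t * (2 * (K + 1)) <= e / 2 by rewrite -ler_pdivlMr // ge_min lexx orbT.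
have near_defect : \forall L \near totally, (loss_defect c mu nu D L < (t * (e / 2))%:E)%E.
  have [_ H] := (ecvgP _ _).1 (loss_defect_cvg c_ge0 c_cont c_low gamma_spec gamma_ql gamma_nn gamma_ti mu_gibbs (nu := nu) (D := D)).
  by apply: H; rewrite s0 lte_fin mulr_gt0 // divr_gt0.
apply: filterS near_defect => L HL; set A := (X in X <= _).
pose B := \sum_(eta : pattern q L) \sum_(xi : pattern q D) cavg c nu eta xi * cp nu eta.
have BK : B <= K.
  apply: (@le_trans _ _ (\sum_(eta : pattern q L) K * cp nu eta)); last first.
    by rewrite -mulr_sumr cp_sum1 mulr1.
  apply: ler_sum => eta _; rewrite -mulr_suml ler_wpM2r ?cp_ge0 // /K /N mulr_suml.
  by apply: ler_sum => xi _; rewrite mul1r.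
have : ((t * A - 2 * t ^+ 2 * B)%:E <= loss_defect c mu nu D L)%E.
  rewrite /A /B !mulr_sumr -sumrB -sumEFin; apply: lee_sum => eta _.
  rewrite !mulr_sumr -sumrB -sumEFin; apply: lee_sum => xi _.
  have h := relgap_dist (cp nu (jumped eta xi) / cp_ratio mu L (rep eta) xi) (cp_ge0 nu eta) t0 t2.
  have c0 : (0 <= (cavg c nu eta xi)%:E)%E by rewrite lee_fin cavg_ge0.
  apply: le_trans (lee_wpmul2l c0 h); rewrite -EFinM lee_fin.
  by rewrite le_eqVlt; apply/orP; left; apply/eqP; ring.
move=> /le_lt_trans/(_ HL); rewrite lte_fin => h.
have {}h : t * A < t * (e / 2 + 2 * t * B) by apply: le_lt_trans (_ : _ <= t * A - 2 * t ^+ 2 * B + 2 * t ^+ 2 * B) _; [lra|nra].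
rewrite ltr_pM2l // in h; apply: (le_trans (ltW h)).
have : 2 * t * B <= 2 * t * K by rewrite ler_wpM2l // mulr_ge0 // ltW.
nra.
Qed.

(** For [nu], this is the identity that [gibbs_swap] gives for [mu], but restricted to integrands
    weighted by the rate: nothing is learnt where c vanishes. *)
Lemma stationary_flux D (f : conf d q -> pattern q D -> R) :
  defect_lim c gamma nu D = 0%E -> (forall xi, continuous (f^~ xi)) ->
  \int[nu]_w (\sum_(xi : pattern q D) c w xi * f w xi) =
  \int[nu]_w (\sum_(xi : pattern q D)
    c (glue xi w) (restr D w) * f (glue xi w) (restr D w) * spec_ratio gamma w xi).
Proof.
move=> s0 cf.
have [C C0 HC] := pattern_bounded cf.
have ciN (xi : pattern q D) : continuous (fun w => (spec_ratio gamma w xi)^-1).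
  by apply: contV; [move=> w; rewrite gt_eqF|exact: cont_g].
have ccf (xi : pattern q D) : continuous (fun w => c w xi * f w xi).
  by apply: contM; [exact: c_cont|exact: cf].
have cM (xi : pattern q D) : continuous (fun w => c w xi * f w xi * (spec_ratio gamma w xi)^-1).
  by apply: contM; [exact: ccf|exact: ciN].
have uf : ucvg (fun L (eta : pattern q L) xi => f (rep eta) xi) f.
  by move=> e e0; apply: nearW => L eta xi; rewrite subrr normr0 ltW.
have ucf := ucvg_mul (@c_cont D) cf (cavg_ucvg c_cont nu D) uf.
have h1 := @avg_cvg R d q nu D _ _ ccf ucf.
have h2 := @avg_swap_cvg R d q nu D _ _ cM (ucvg_mul ccf ciN ucf
  (ucvg_inv (@cont_g D) (@g_gt0 D)
    (@cp_ratio_ucvg R d q gamma gamma_spec gamma_ql gamma_nn gamma_ti mu mu_gibbs D))).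
have <- : \int[nu]_w (\sum_(xi : pattern q D) c (glue xi w) (restr D w) *
      f (glue xi w) (restr D w) * (spec_ratio gamma (glue xi w) (restr D w))^-1) =
    \int[nu]_w (\sum_(xi : pattern q D)
    c (glue xi w) (restr D w) * f (glue xi w) (restr D w) * spec_ratio gamma w xi).
  apply: eq_Rintegral => w _; apply: eq_bigr => xi _.
  by rewrite /spec_ratio glueK invf_div.
have h3 : (fun L => \sum_(eta : pattern q L) \sum_(xi : pattern q D)
     cavg c nu eta xi * f (rep eta) xi * (cp_ratio mu L (rep eta) xi)^-1 *
       cp nu (restr L (glue xi (rep eta))) -
   \sum_(eta : pattern q L) \sum_(xi : pattern q D)
     cavg c nu eta xi * f (rep eta) xi * cp nu eta) @ totally --> (0 : R).
  apply/cvgrPdist_le => e e0.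
  have e1 : 0 < e / C by rewrite divr_gt0.
  apply: filterS (flux_small s0 e1) => L HL.
  rewrite sub0r normrN -sumrB (le_trans (ler_norm_sum _ _ _)) //.
  rewrite -[leRHS](divfK (lt0r_neq0 C0)) mulrC; move: HL => /(ler_wpM2l (ltW C0)).
  apply: le_trans; rewrite mulr_sumr; apply: ler_sum => eta _.
  rewrite -sumrB (le_trans (ler_norm_sum _ _ _)) // mulr_sumr; apply: ler_sum => xi _.
  rewrite [X in `|X|](_ : _ = f (rep eta) xi * (cavg c nu eta xi *
    (cp nu (jumped eta xi) / cp_ratio mu L (rep eta) xi - cp nu eta))); last first.
    by rewrite /jumped; ring.
  rewrite !normrM (ger0_norm (cavg_ge0 c_ge0 c_cont _ _ _)).
  by rewrite ler_wpM2r ?mulr_ge0 ?cavg_ge0.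
have h4 := cvgB h2 h1.
have h5 := cvg_unique (@norm_hausdorff R R) (h4 (@totally_filter (site d))) h3.
have /eqP := h5 (fmap_proper_filter _ (@totally_filter (site d))).
by rewrite subr_eq0 => /eqP.
Qed.

(* The image under s |-> v_D s of nu restricted to the cylinder of w has, on the
   cylinder of v, the density with respect to nu that a Gibbs measure would
   have. This property composes along sequences of jumps. *)
Definition transfer D w v := forall g, continuous g ->
  \int[nu]_s (\1_(cyl (restr D w)) s * g (glue (restr D v) s)) =
  \int[nu]_s (\1_(cyl (restr D v)) s * (g s * spec_ratio gamma s (restr D w))).

Let spec_ratioS D L s (xi : pattern q D) : (D `<=` L)%fset ->
  spec_ratio gamma s xi = spec_ratio gamma s (restr L (glue xi s)).
Proof. exact: (spec_ratio_sub gamma_spec gamma_ql gamma_nn gamma_ti mu_gibbs). Qed.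

(** Multiply the test function by the indicator of the pattern on L \ D, which the change on D
    leaves alone; the ratio does not depend on the window. *)
Lemma transfer_sub D L w v w' : (D `<=` L)%fset -> restr D w' = restr D w ->
  transfer D w v -> transfer L w' (glue (restr D v) w').
Proof.
move=> DL w'w tr g cg; pose E := (L `\` D)%fset.
have cylL (u : conf d q) s : \1_(cyl (restr L u)) s =
    \1_(cyl (restr D u)) s * \1_(cyl (restr E u)) s :> R.
  rewrite !cyl_indic -natrM mulnb; congr (nat_of_bool _)%:R.
  apply/eqP/andP => [h|[/eqP/restrP h1 /eqP/restrP h2]].
    by split; apply/eqP; apply: restr_sub h => //; exact: fsubsetDl.
  apply/restrP => x xL; have [xD|xD] := boolP (x \in D); first exact: h1.
  by apply: h2; rewrite in_fsetD xD.
pose i s : R := \1_(cyl (restr E w')) s.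
have ci : continuous (fun s => i s * g s) by apply: contM => //; exact: continuous_indic.
have E1 s (xi : pattern q D) : restr E (glue xi s) = restr E s by exact: restrD_glue.
have -> : \int[nu]_s (\1_(cyl (restr L w')) s * g (glue (restr L (glue (restr D v) w')) s)) =
    \int[nu]_s (\1_(cyl (restr D w)) s * (i (glue (restr D v) s) * g (glue (restr D v) s))).
  apply: eq_Rintegral => s _; rewrite cylL w'w -mulrA; congr (_ * _).
  rewrite /i !cyl_indic E1; case: eqP => [/restrP se|_]; last by rewrite !mul0r.
  congr (_ * g _); apply/funext => x; rewrite !glue_restrE.
  have [xD|xD] := boolP (x \in D); first by rewrite (fsubsetP DL).
  by case: ifPn => // xL; rewrite se // in_fsetD xD.
rewrite (tr _ ci); apply: eq_Rintegral => s _; rewrite cylL restr_glue E1 -/(i s).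
rewrite -!mulrA !cyl_indic; case: eqP => [sv|_]; last by rewrite !mul0r.
rewrite !mul1r /i cyl_indic; case: eqP => [/restrP se|_]; last by rewrite !mul0r.
rewrite !mul1r; congr (_ * _); rewrite (spec_ratioS s (restr D w) DL); congr (spec_ratio _ _ _).
apply/restrP => x xL; rewrite glue_restrE; case: ifPn => xD.
  by move/restrP: w'w => ->.
by rewrite se // in_fsetD xD.
Qed.

Lemma transfer_refl D w : transfer D w w.
Proof.
move=> g cg; apply: eq_Rintegral => s _; rewrite !cyl_indic.
case: eqP => [<-|_]; last by rewrite !mul0r.
by rewrite glue_restr /spec_ratio glue_restr divff // mulr1.
Qed.

(** The densities multiply because [spec_ratio] is a cocycle along successive changes. *)
Lemma transfer_trans D w v u : transfer D w v -> transfer D v u -> transfer D w u.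
Proof.
move=> h1 h2 g cg.
have c1 := @cont_glue R d q D (restr D u) g cg.
have -> : \int[nu]_s (\1_(cyl (restr D w)) s * g (glue (restr D u) s)) =
    \int[nu]_s (\1_(cyl (restr D w)) s * g (glue (restr D u) (glue (restr D v) s))).
  by apply: eq_Rintegral => s _; rewrite glue_glue.
rewrite (h1 _ c1).
pose g2 t := g t * spec_ratio gamma (glue (restr D v) t) (restr D w).
have c2 : continuous g2.
  apply: contM => //.
  by have := @cont_glue R d q D (restr D v) (fun t => spec_ratio gamma t (restr D w)); apply; exact: cont_g.
have -> : \int[nu]_s (\1_(cyl (restr D v)) s *
      (g (glue (restr D u) s) * spec_ratio gamma s (restr D w))) =
    \int[nu]_s (\1_(cyl (restr D v)) s * g2 (glue (restr D u) s)).
  apply: eq_Rintegral => s _; rewrite /g2 glue_glue cyl_indic.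
  case: eqP => [<-|_]; last by rewrite !mul0r.
  by rewrite glue_restr.
rewrite (h2 _ c2); apply: eq_Rintegral => s _; congr (_ * _).
rewrite /g2 -mulrA; congr (_ * _); rewrite /spec_ratio glue_glue mulrA divfK //.
Qed.

Hypothesis nu_defect : forall D, D \in active c -> defect_lim c gamma nu D = 0%E.

Lemma transfer_jump D w (xi : pattern q D) : 0 < c w xi ->
  exists2 L, (D `<=` L)%fset & transfer L w (glue xi w).
Proof.
move=> cw; have [D0|/fset0Pn[x xD]] := eqVneq D fset0.
  exists D => //; have -> : glue xi w = w.
    apply/funext => x; rewrite glueE; case: ifPn => // xD.
    by move: D0 => /fsetP/(_ x); rewrite xD in_fset0.
  exact: transfer_refl.
have s0 : defect_lim c gamma nu D = 0%E.
  rewrite -(translateVK x D) (defect_lim_translate c_ge0 c_cont c_low c_ti gamma_spec gamma_ql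
    gamma_nn gamma_ti mu_gibbs) //.
  apply: nu_defect; apply/negPn/negP => nD.
  by move: cw; rewrite (rate_eq0 c_fin c_ti xD nD) ltxx.
have cw2 : 0 < c w xi / 2 by rewrite divr_gt0.
(* On the cylinder over D1 the rate varies by at most half its value at w, so it stays positive. *)
have [D1 _ /(_ D1 (fsubset_refl _)) HD1] := continuous_unif (@c_cont D xi) cw2.
pose L := (D `|` D1)%fset; have DL : (D `<=` L)%fset by exact: fsubsetUl.
exists L => // g cg.
have cpos s : restr L s = restr L w -> 0 < c s xi.
  move=> /(restr_sub (fsubsetUr D D1))/esym/HD1; rewrite ler_distl => /andP[_].
  by lra.
pose i s : R := \1_(cyl (restr L w)) s.
(* Equal to the rate on the cylinder of w and positive everywhere, so that dividing by it keeps the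
   test function continuous while cancelling the rate where it matters. *)
pose k s : R := c s xi + (1 - i s).
have ci : continuous i by exact: continuous_indic.
have ck : continuous k.
  by apply: contD; [exact: c_cont|apply: contB; [exact: contC|exact: ci]].
have k0 s : 0 < k s.
  rewrite /k /i cyl_indic; case: eqP => [/cpos|_]; first by rewrite subrr addr0.
  by rewrite subr0 ltr_wpDl.
pose f s (zeta : pattern q D) : R := (zeta == xi)%:R * (i s * g (glue xi s) / k s).
have cf zeta : continuous (fun s => f s zeta).
  apply: contM; first exact: contC.
  apply: contM; last by apply: contV => // s; rewrite gt_eqF.
  by apply: contM => //; exact: cont_glue.
have := stationary_flux s0 cf.
have fE s zeta : c s zeta * f s zeta = (zeta == xi)%:R * (i s * g (glue xi s)).
  rewrite /f; case: eqP => [->|_]; last by rewrite !mul0r mulr0.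
  rewrite !mul1r /k /i cyl_indic; case: eqP => [/cpos cs|_]; last by rewrite !mul0r mulr0.
  by rewrite subrr addr0 !mul1r mulrC divfK // gt_eqF.
have -> : \int[nu]_s (\sum_(zeta : pattern q D) c s zeta * f s zeta) =
    \int[nu]_s (\1_(cyl (restr L w)) s * g (glue (restr L (glue xi w)) s)).
  apply: eq_Rintegral => s _; rewrite (bigD1 xi) //= big1 ?addr0; last first.
    by move=> zeta /negbTE zx; rewrite fE zx mul0r.
  rewrite fE eqxx mul1r /i cyl_indic; case: eqP => [/restrP sw|_]; last by rewrite !mul0r.
  congr (_ * g _); apply/funext => y; rewrite glue_restrE !glueE.
  have [yL|yL] := boolP (y \in L); first by rewrite sw.
  by case: ifPn => // /(fsubsetP DL); rewrite (negbTE yL).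
move=> ->; apply: eq_Rintegral => s _.
under eq_bigr do rewrite fE.
rewrite cyl_indic.
have [sx|sx] := eqVneq (restr D s) xi; last first.
  rewrite big1 ?mul0r => [|zeta _]; last by rewrite !mul0r.
  case: eqP => [sw|_]; last by rewrite mul0r.
  by case/eqP: sx; rewrite (restr_sub DL sw) restr_glue.
(* A reversed jump counts only if it lands in the cylinder of w, which singles out the pattern of w
   on D. *)
rewrite (bigD1 (restr D w)) //= big1 ?addr0; last first.
  move=> zeta zw; rewrite /i cyl_indic; case: eqP => [sw|_]; last by rewrite !(mul0r, mulr0).
  by case/eqP: zw; rewrite -(restr_sub DL sw) restr_glue.
rewrite mul1r /i cyl_indic.
have -> : (restr L (glue (restr D w) s) == restr L w) = (restr L s == restr L (glue xi w)).
  apply/eqP/eqP => /restrP h; apply/restrP => y yL; have := h y yL; rewrite !glueE.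
    by case: ifPn => // yD _; rewrite -sx rep_restr.
  by case: ifPn => // yD _; rewrite rep_restr.
case: eqP => [sw|_]; last by rewrite !mul0r.
rewrite !mul1r glue_glue -sx glue_restr; congr (_ * _).
rewrite (spec_ratioS s (restr D w) DL); congr (spec_ratio _ _ _).
apply/restrP => y yL; rewrite glue_restrE; case: ifPn => // yD.
by move/restrP: sw => ->; rewrite // glueE (negbTE yD).
Qed.

(** Each jump of the chain comes with its own window; [transfer_sub] brings them to a common one and
    [transfer_trans] composes them. *)
Lemma transfer_irr L (xi : pattern q L) w :
  exists2 D, (L `<=` D)%fset & transfer D w (glue xi w).
Proof.
have [n [s [s0 sn sj]]] := c_irr w xi.
(* Agreement with w off the window lets later enlargements keep both endpoints of the transfer. *)
suff : forall i, (i <= n)%N -> exists D, (forall x, x \notin D -> s i x = w x) /\ transfer D w (s i).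
  move=> /(_ n (leqnn n))[D [eD tD]]; rewrite sn in eD tD.
  exists (D `|` L)%fset; first exact: fsubsetUr.
  have := transfer_sub (fsubsetUl D L) (erefl (restr D w)) tD.
  congr (transfer _ _ _); apply/funext => x; rewrite glue_restrE.
  by case: ifPn => // /eD.
elim=> [|i IH] il.
  by exists fset0; rewrite s0; split => //; exact: transfer_refl.
have [D [eD tD]] := IH (ltnW il).
have [E [xi' [cE sE]]] := sj i il.
have [L' EL' tL'] := transfer_jump cE.
exists (D `|` L')%fset; rewrite -sE in tL'; split.
  move=> x; rewrite in_fsetU negb_or => /andP[xD xL'].
  rewrite sE glueE; case: ifPn => [/(fsubsetP EL')|_]; first by rewrite (negbTE xL').
  exact: eD.
have h1 := transfer_sub (fsubsetUl D L') (erefl (restr D w)) tD.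
have h2 := transfer_sub (fsubsetUr D L') (erefl (restr L' (s i))) tL'.
have e1 : glue (restr D (s i)) w = s i.
  by apply/funext => x; rewrite glue_restrE; case: ifPn => // /eD.
have e2 : glue (restr L' (s i.+1)) (s i) = s i.+1.
  apply/funext => x; rewrite glue_restrE; case: ifPn => // xL'.
  by rewrite sE glueE; case: ifPn => // /(fsubsetP EL'); rewrite (negbTE xL').
by rewrite e1 in h1; rewrite e2 in h2; exact: transfer_trans h1 h2.
Qed.

(** The window given by irreducibility depends on w; compactness makes it uniform. *)
Lemma transfer_uniform L (xi : pattern q L) :
  exists2 D, (L `<=` D)%fset & forall w, transfer D w (glue xi w).
Proof.
have := @near_totally_conf d q (fun D w => (L `<=` D)%fset /\ transfer D w (glue xi w)).
case=> [w|D _ /(_ D (fsubset_refl _)) HD].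
  have [D LD tD] := transfer_irr xi w; exists D => w' D' DD' w'w; split.
    exact: fsubset_trans DD'.
  have := transfer_sub DD' w'w tD; congr (transfer _ _ _).
  apply/funext => x; rewrite glue_restrE !glueE; case: ifPn => xD.
    by case: ifPn => // _; move/restrP: w'w => ->.
  by case: ifPn => // /(fsubsetP LD); rewrite (negbTE xD).
by exists D; [exact: (HD point).1|move=> w; exact: (HD w).2].
Qed.

Lemma transfer_gibbs : gibbs gamma nu.
Proof.
move=> L xi; have [D LD tD] := transfer_uniform xi.
have cg (zeta : pattern q L) : continuous (spec_cyl gamma zeta) by exact: cont_spec_cyl.
have ci (eta : pattern q D) : continuous (\1_(cyl eta) : conf d q -> R).
  exact: continuous_indic.
have cM (eta : pattern q D) (zeta : pattern q L) :
  continuous (fun s => \1_(cyl eta) s * spec_cyl gamma zeta s) by exact: contM.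
suff E : \int[nu]_s spec_cyl gamma xi s = cp nu xi.
  rewrite cpE -E /Rintegral fineK; last first.
    by apply: integrable_fin_num => //; exact: continuous_integrable.
  by apply: eq_integral => s _; rewrite /spec_cyl -cpE.
(* Detailed balance of [nu] for the heat-bath update of L, from the transfer identity with test
   function [spec_fun gamma L]. Summing over zeta, and over the extensions eta of xi, yields the DLR
   equation. *)
have step (eta : pattern q D) (zeta : pattern q L) : restr L (rep eta) = xi ->
    \int[nu]_s (\1_(cyl eta) s * spec_cyl gamma zeta s) =
    \int[nu]_s (\1_(cyl (jumped eta zeta)) s * spec_cyl gamma xi s).
  move=> ex; have := tD (glue zeta (rep eta)) _ (@cont_spf _ _ _ _ gamma_ql L).
  have -> : glue xi (glue zeta (rep eta)) = rep eta.
    by rewrite glue_glue -ex glue_restr.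
  rewrite restr_rep -/(jumped eta zeta) => h; apply/esym.
  transitivity (\int[nu]_s (\1_(cyl (jumped eta zeta)) s * spec_fun gamma L (glue eta s))).
    apply: eq_Rintegral => s _; rewrite cyl_indic; case: eqP => [/restrP sj|_]; last by rewrite !mul0r.
    rewrite -spf_glue //; congr (_ * spec_fun _ _ _); apply/funext => x.
    rewrite !glueE; case: ifPn => xL.
      by rewrite (fsubsetP LD) // -ex rep_restr.
    by case: ifPn => // xD; rewrite sj // glueE (negbTE xL).
  rewrite h; apply: eq_Rintegral => s _; rewrite cyl_indic; case: eqP => [se|_]; last by rewrite !mul0r.
  congr (_ * _).
  have -> : jumped eta zeta = restr D (glue zeta s).
    by apply: restr_glue_eq; rewrite se restr_rep.
  by rewrite -(spec_ratioS s zeta LD) /spec_ratio mulrC divfK // spf_glue.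
have sum1 s : \sum_(eta : pattern q D) \1_(cyl eta) s = 1 :> R.
  have h := @localE R d q D (fun=> 1) s (fun _ _ _ => erefl).
  by apply/esym; apply: etrans h _; apply: eq_bigr => eta _; rewrite mul1r.
apply/esym; rewrite (cp_fiber nu xi LD).
(* The factor [zeta == xi] allows [pattern_swap] to be applied; afterwards it selects the extensions
   eta of xi. *)
pose F (eta : pattern q D) (zeta : pattern q L) : R :=
  (zeta == xi)%:R * \int[nu]_s (\1_(cyl eta) s * spec_cyl gamma xi s).
transitivity (\sum_(eta : pattern q D) \sum_(zeta : pattern q L) F eta zeta); last first.
  transitivity (\sum_(eta : pattern q D) \int[nu]_s (\1_(cyl eta) s * spec_cyl gamma xi s)).
    apply: eq_bigr => eta _; rewrite (bigD1 xi) //= big1 ?addr0.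
      by rewrite /F eqxx mul1r.
    by move=> zeta /negbTE zx; rewrite /F zx mul0r.
  rewrite -Exp_sum; last by move=> eta _; exact: cM.
  by apply: eq_Rintegral => s _; rewrite -mulr_suml sum1 mul1r.
rewrite (pattern_swap _ LD) big_mkcond; apply: eq_bigr => eta _.
rewrite /F; case: eqP => [ex|_]; last by rewrite big1 // => zeta _; rewrite mul0r.
under eq_bigr do rewrite mul1r -step //.
rewrite -Exp_sum; last by move=> zeta _; exact: cM.
rewrite cp_Exp; apply: eq_Rintegral => s _.
by rewrite -mulr_sumr spec_cyl_sum1 mulr1.
Qed.

End transfer.

Theorem theorem2p6 (R : realType) (d q : nat)
  (c : rates R d q)
  (P : R -> (conf d q -> R) -> conf d q -> R)
  (mu : probability (conf d q) R)
  (gamma : {fset site d} -> R.-pker (conf d q) ~> (conf d q))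
  (c_ge0 : rates_nonneg c)
  (R1 : rates_continuous c)
  (R2 : rates_finite_type c)
  (R3 : rates_summable c)
  (R4 : rates_translation_invariant c)
  (R5 : rates_bounded_below c)
  (R6 : rates_irreducible c)
  (P_generated : generated_semigroup c P)
  (mu_invariant : translation_invariant mu)
  (mu_stationary : time_stationary P mu)
  (gamma_spec : specification gamma)
  (S1 : quasilocal gamma)
  (S2 : nonnull gamma)
  (S3 : spec_summable c gamma)
  (S4 : spec_translation_invariant gamma)
  (mu_gibbs : gibbs gamma mu) :
  [/\ forall nu : probability (conf d q) R, translation_invariant nu ->
        entropy_loss_seq c nu mu @ \oo --> entropy_loss_density c nu mu /\
        entropy_loss_density c nu mu != +oo%E,
      upper_semicontinuous_on
        ([set nu | translation_invariant nu] : set (weak_probability R d q))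
        (fun nu => entropy_loss_density c nu mu),
      forall nu : probability (conf d q) R, translation_invariant nu ->
        (entropy_loss_density c nu mu <= 0)%E &
      forall nu : probability (conf d q) R, translation_invariant nu ->
        entropy_loss_density c nu mu = 0%E -> gibbs gamma nu].
Proof.
have lim (nu : probability (conf d q) R) : translation_invariant nu ->
    entropy_loss_seq c nu mu @ \oo --> density c gamma nu.
  move=> nu_inv.
  exact: (entropy_loss_cvg c_ge0 R1 R2 R5 R4 gamma_spec S1 S2 S4 mu_gibbs mu_invariant nu_inv).
have densE (nu : probability (conf d q) R) : translation_invariant nu ->
    entropy_loss_density c nu mu = density c gamma nu.
  move=> /lim h; rewrite /entropy_loss_density is_cvg_limn_esupE; last first.
    by apply/cvg_ex; exists (density c gamma nu).
  by apply: cvg_lim h; exact: ereal_hausdorff.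
have le0 (nu : probability (conf d q) R) : translation_invariant nu ->
    (density c gamma nu <= 0)%E.
  exact: (density_le0 c_ge0 R1 R2 R4 P_generated gamma_spec S1 S2 S4 mu_gibbs mu_stationary R5).
split=> [nu nu_inv|nu nu_inv a|nu nu_inv|nu nu_inv].
- rewrite densE //; split; first exact: lim.
  by have := le0 nu nu_inv; case: (density _ _ _).
- rewrite densE // => /(density_usc c_ge0 R1 R2 gamma_spec S1 S2 S4) usc.
  by apply: filterS usc => m ma m_inv; rewrite densE.
- by rewrite densE //; exact: le0.
rewrite densE // => d0.
apply: (transfer_gibbs c_ge0 R1 R2 R5 R4 R6 gamma_spec S1 S2 S4 mu_gibbs mu_invariant nu_inv).
move=> D Da.
exact: (density0_defect c_ge0 R1 R2 R4 P_generated gamma_spec S1 S2 S4 mu_gibbs mu_stationary R5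
  nu_inv d0 Da).
Qed.
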